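(* There exists $n_0$ such that for all $n\geq n_0$ the following holds: an $n$-vertex planar graph $G$ contains exactly $f_I(n,C_6)$ induced 6-cycles if and only if $G\in\mathcal{F}_n$. Consequently, for all $n\geq n_0$, \[f_I(n,C_6)=\begin{cases}\left(\frac{n}{3}-1\right)^3=\frac{1}{27}(n^3-9n^2+27n-27), & \text{if } n\equiv 0\pmod{3},\\ \left(\frac{n-4}{3}\right)^2\left(\frac{n-1}{3}\right)=\frac{1}{27}(n^3-9n^2+24n-16), & \text{if } n\equiv 1\pmod{3},\\ \left(\frac{n-2}{3}\right)^2\left(\frac{n-5}{3}\right)=\frac{1}{27}(n^3-9n^2+24n-20), & \text{if } n\equiv 2\pmod{3}.\end{cases}\]
   Context: For a graph $H$, $f_I(n,H)$ denotes the maximum number of induced copies of $H$ contained in a planar graph on $n$ vertices; $C_6$ is the 6-cycle. For $n\geq 6$, $\mathcal{F}_n$ is the family of graphs $G$ such that: (i) $G$ has exactly $n$ vertices, with vertex set $\{u_1,u_2,u_3\}\cup A\cup B\cup C$ (disjoint union), where $|A|+|B|+|C|=n-3$ and the sizes of $A,B,C$ are as equal as possible; (ii) for all $a\in A$, $b\in B$, $c\in C$, $G$ contains the edges $au_1,au_2,bu_2,bu_3,cu_3,cu_1$; (iii) there exist labelings $A=\{a_1,\dots,a_{|A|}\}$, $B=\{b_1,\dots,b_{|B|}\}$, $C=\{c_1,\dots,c_{|C|}\}$ such that all remaining edges of $G$ form a subset of $\{a_ia_{i+1}:1\leq i\leq |A|-1\}\cup\{b_ib_{i+1}:1\leq i\leq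 |B|-1\}\cup\{c_ic_{i+1}:1\leq i\leq |C|-1\}$. *)

(* Defs.v *)
From HB Require Import structures.
From mathcomp Require Import all_boot all_order all_algebra.
From mathcomp Require Import all_classical all_reals all_analysis.
Import Order.TTheory GRing.Theory Num.Theory.
Import numFieldNormedType.Exports.

Set Implicit Arguments.
Unset Strict Implicit.
Unset Printing Implicit Defensive.

Local Open Scope ring_scope.

Record sgraph (V : finType) := SGraph {
  edges : {set {set V}};
  edgesP : [forall e in edges, #|e| == 2]
}.

HB.instance Definition _ (V : finType) := [isSub for @edges V].
HB.instance Definition _ (V : finType) := [Finite of sgraph V by <:].

(* Irreflexive, because [set x; x] has cardinality 1. *)
Definition adj (V : finType) (G : sgraph V) : rel V :=
  fun x y => [set x; y] \in edges G.

Lemma rel_edgesP (V : finType) (r : rel V) :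
  [forall e in [set [set p.1; p.2] | p : V * V & (p.1 != p.2) && r p.1 p.2],
     #|e| == 2].
Proof.
by apply/forall_inP => e /imsetP[p]; rewrite inE => /andP[np _] ->; rewrite cards2 np.
Qed.

(* Loops of r are dropped and r is symmetrized. *)
Definition sgraph_of_rel (V : finType) (r : rel V) : sgraph V :=
  SGraph (rel_edgesP r).

(* ordS is the cyclic successor i |-> i + 1 mod k; this is the k-cycle for
   k >= 3. *)
Definition cycle_graph (k : nat) : sgraph 'I_k :=
  sgraph_of_rel (fun i j => j == ordS i).

(* S spans an induced copy of H: G[S] is isomorphic to H. *)
Definition induced_copy (V W : finType) (G : sgraph V) (H : sgraph W)
    (S : {set V}) : bool :=
  [exists f : {ffun W -> V},
    [&& injectiveb f, f @: [set: W] == S &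
        [forall x, forall y, adj G (f x) (f y) == adj H x y]]].

Definition num_induced (V W : finType) (G : sgraph V) (H : sgraph W) : nat :=
  #|[set S : {set V} | induced_copy G H S]|.

(* A drawing of G in the plane R^2: p places the vertices and, for each edge e,
   g e restricted to [0, 1] parametrizes the arc representing e. *)
Definition plane_drawing (R : realType) (V : finType) (G : sgraph V)
    (p : V -> R * R) (g : {set V} -> R -> R * R) : Prop :=
  [/\ injective p,
      (forall e, e \in edges G ->
        [/\ {within `[0, 1], continuous (g e)}%classic,
            {in `[0, 1] &, injective (g e)} &
            exists x y, [/\ e = [set x; y], g e 0 = p x & g e 1 = p y]]),
      (forall e, e \in edges G ->
        forall t v, t \in `]0, 1[ -> g e t <> p v) &
      (forall e e', e \in edges G -> e' \in edges G -> e != e' ->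
        forall s t, s \in `]0, 1[ -> t \in `]0, 1[ -> g e s <> g e' t)].

Definition planar (R : realType) (V : finType) (G : sgraph V) : Prop :=
  exists p g, @plane_drawing R V G p g.

(* f_I(n, H); up to isomorphism, every n-vertex graph lives on 'I_n. *)
Definition max_induced (R : realType) (n : nat) (W : finType) (H : sgraph W) :
    nat :=
  (\max_(G : sgraph 'I_n | `[< planar R G >]) num_induced G H)%N.

Definition balanced3 (k l m : nat) : Prop :=
  (forall i j, i \in [:: k; l; m] -> j \in [:: k; l; m] -> i <= j.+1)%N.

(* The edge e joins two consecutive terms of the sequence s. *)
Definition path_edge (V : finType) (s : seq V) (e : {set V}) : Prop :=
  exists x y, infix [:: x; y] s /\ e = [set x; y].

(* Membership of G in the family F_n, where n = #|V|; the labelings of A, B, C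
   are duplicate-free sequences sa, sb, sc enumerating them. *)
Definition extremal_family (V : finType) (G : sgraph V) : Prop :=
  exists (u1 u2 u3 : V) (A B C : {set V}),
  let hub_edges : {set {set V}} :=
     [set [set x; u1] | x in A] :|: [set [set x; u2] | x in A] :|:
     [set [set x; u2] | x in B] :|: [set [set x; u3] | x in B] :|:
     [set [set x; u3] | x in C] :|: [set [set x; u1] | x in C] in
  [/\ [/\ uniq [:: u1; u2; u3],
          [disjoint A & B], [disjoint B & C], [disjoint A & C] &
          A :|: B :|: C = ~: [set u1; u2; u3]],
      balanced3 #|A| #|B| #|C|,
      hub_edges \subset edges G &
      exists sa sb sc : seq V,
        [/\ perm_eq sa (enum A), perm_eq sb (enum B), perm_eq sc (enum C) &
            forall e, e \in edges G -> e \notin hub_edges ->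
              [\/ path_edge sa e, path_edge sb e | path_edge sc e]]].

(* Main.v *)
(** Planarity enters only through the van Kampen obstruction: in a drawing, let
    U x y tell whether x lies in the upper half-plane as seen from y, and let
    K w x y be the parity of the number of times the arc xy crosses the
    horizontal ray issuing from w. For disjoint edges xy and zw the differences
    between points of the two arcs never vanish, so that the crossings around
    the square of parameters cancel, which is a linear relation modulo 2 between
    values of U and K. Graphs with such data are closed under contraction, and
    adding up the relations shows that K_5 and K_{3,3} are not among them. Edge
    density, the bound on common neighbours of three vertices, and the
    structure inside the extremal graphs all follow by contraction.

    In a planar graph on n vertices all but o(n^3) induced hexagons alternate
    between vertices of large degree and small vertices with exactly two large
    neighbours. Their number is at most the sum, over the triples {x, y, z} of
    large vertices, of the product of the multiplicities of the pairs xy, yz and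
    zx; by moving weight between disjoint pairs this is at most n^3 / 27, and
    nearly all the weight sits on a single triple when it is close to n^3 / 27.
    So if there are at least as many hexagons as in the extremal graphs, three
    hubs are joined by classes A, B, C of common neighbours of two of them which
    cover nearly all vertices. A vertex outside the classes and the hubs loses
    about n^2 / 9 hexagons and gains few, an edge between two classes loses about
    n / 3 of them and gains a bounded number, and an edge between hubs loses them
    all; hence there are no such vertices or edges. *)
From Stdlib Require Import Btauto.
Require Import Defs.
From mathcomp Require Import all_boot all_order all_algebra.
From mathcomp Require Import zify ring lra.
Import Order.TTheory GRing.Theory Num.Theory.

Set Implicit Arguments.
Unset Strict Implicit.
Unset Printing Implicit Defensive.

(** * The van Kampen obstruction *)

(** The obstacle in the weight argument is that undoing a move between disjoint pairs spoils the
    estimate for the heavy triple, and there can be as many moves as pairs. Errors do not accumulate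
    because the estimate repairs itself: if the pairs of one triple have total weight s, the number
    of hexagons divided by n^3 is at most s^3 / 27 + (1 - s)^2. Once s >= 19/20, this times 27 is at
    most s, so a crude bound on s already implies the sharp one.

    The constants are fixed in the order k1, K, D, n0. The hexagons through x outside vertices
    number at most about k1 x^2 n, apart from terms linear in x n. To lie below the loss of order x
    n^2 this needs x to be a small multiple of n / k1, which dictates the coverage error 1/K. The
    degree threshold D then depends on K alone: it makes the number of large vertices a small
    fraction of n while n^2 D^2 remains quadratic in n. The densities obtained by contraction are
    linear with crude coefficients, such as 14 for the average degree, which n0 absorbs. *)

Definition van_kampen_sum (V : Type) (U : V -> V -> bool)
    (K : V -> V -> V -> bool) (x y z w : V) : bool :=
  xorb (xorb (xorb (K z x y) (K w x y)) (xorb (K x z w) (K y z w)))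
       (xorb (xorb (U z x) (U w x)) (xorb (U z y) (U w y))).

(** The four [K] terms of [van_kampen_sum] are the sides of the square of parameters: the arc xy
    seen from z and from w, and the arc zw seen from x and from y. The last two sides occur in the
    drawing with opposite sign, and replacing a curve by its negative costs the values of [U] at its
    two ends; this is the origin of the [U] terms. *)
Definition van_kampen (V : finType) (e : rel V) : Prop :=
  exists (U : V -> V -> bool) (K : V -> V -> V -> bool),
  [/\ forall x y, x != y -> U y x = negb (U x y),
      forall w x y, K w x y = K w y x &
      forall x y z w, e x y -> e z w -> uniq [:: x; y; z; w] ->
        van_kampen_sum U K x y z w = false].

(** The vertex y is merged into x but stays in the type as an isolated vertex, so that repeated
    contractions need no change of type. The conjunct [u != v] removes the loop at x. *)
Definition contract (V : finType) (e : rel V) (x y : V) : rel V :=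
  fun u v => [&& u != y, v != y, u != v &
    [|| e u v, (u == x) && e y v | (v == x) && e y u]].

Section Contract.
Variables (V : finType) (e : rel V).
Hypotheses (esym : symmetric e) (eirr : irreflexive e).

Lemma contract_sym x y : symmetric (contract e x y).
Proof.
move=> u v; rewrite /contract (esym u v) (eq_sym u v).
by case: (u != y); case: (v != y); case: (v != u); case: (e v u);
   case: (u == x); case: (v == x); case: (e y v); case: (e y u).
Qed.

Lemma contract_irr x y : irreflexive (contract e x y).
Proof. by move=> u; rewrite /contract eqxx !andbF. Qed.

Lemma contract_keep x y u v : e u v -> u != y -> v != y -> contract e x y u v.
Proof.
move=> euv uy vy; rewrite /contract uy vy euv /= andbT.
by apply/eqP => uv; rewrite uv eirr in euv.
Qed.

Lemma contract_new x y v : e y v -> v != x -> x != y -> contract e x y x v.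
Proof.
move=> eyv vx xy; rewrite /contract xy (eq_sym x v) vx eqxx eyv orbT !andbT /=.
by apply/eqP => vy; rewrite vy eirr in eyv.
Qed.

(** A new edge xu stands for the path x, y, u, so its [K] is the sum of the values for xy and yu.
    Adding the relations for these two edges, every term at y occurs twice and cancels. *)
Lemma van_kampen_contract x y : e x y -> van_kampen e ->
  van_kampen (contract e x y).
Proof.
move=> exy [U [K [UN KC r]]].
pose K' w u v := if e u v then K w u v
                 else if u == x then xorb (K w x y) (K w y v)
                 else if v == x then xorb (K w x y) (K w y u) else false.
have KC' w u v : K' w u v = K' w v u.
  rewrite /K' (esym v u) (KC w v u).
  by case: (e u v) => //; case: (eqVneq u x) => [->|ux]; case: (eqVneq v x) => [?|vx];
    subst.
have kept p q w : e p q -> K' w p q = K w p q by rewrite /K' => ->.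
have new u w : ~~ e x u -> K' w x u = xorb (K w x y) (K w y u).
  by rewrite /K' eqxx => /negPf->.
have path_rel u p q : ~~ e x u -> e y u -> e p q -> uniq [:: x; u; p; q] ->
    p != y -> q != y -> u != y -> x != y -> van_kampen_sum U K' x u p q = false.
  move=> nxu eyu epq un py qy uy xy; rewrite /van_kampen_sum !(kept p q) // !new //.
  have := r x y p q exy epq; have := r y u p q eyu epq.
  rewrite /van_kampen_sum /= !inE.
  move: un; rewrite /= !inE !negb_or.
  move=> /and4P[/and3P[xu xp xq] /andP[up uq] pq _].
  rewrite (eq_sym y u) (eq_sym y p) (eq_sym y q).
  rewrite uy xy up uq xp xq pq py qy /= => /(_ isT) h1 /(_ isT) h2.
  transitivity (xorb false false); last by [].
  by rewrite -{1}h1 -{1}h2; btauto.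
have edge_rel u v p q : contract e x y u v -> e p q -> uniq [:: u; v; p; q] ->
    p != y -> q != y -> van_kampen_sum U K' u v p q = false.
  move=> /and4P[uy vy uv E] epq un py qy.
  case: (boolP (e u v)) => [euv|neuv].
    by rewrite /van_kampen_sum !kept //; apply: r.
  move: E; rewrite (negPf neuv) /=; case/orP => /andP[/eqP ? eyu]; subst.
    exact: path_rel.
  have := path_rel u p q; rewrite esym => /(_ neuv eyu epq).
  have perm : perm_eq [:: x; u; p; q] [:: u; x; p; q].
    by rewrite -[_ :: _]/([:: x] ++ [:: u] ++ [:: p; q]) perm_catCA.
  rewrite (perm_uniq perm) => /(_ un py qy uy vy).
  by rewrite /van_kampen_sum => h; rewrite -h !(KC' _ u x); btauto.
exists U, K'; split=> // a b c d /[dup] cab /and4P[ay by_ ab Eab].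
move=> /[dup] ccd /and4P[cy dy cd Ecd] un.
(* At most one of two disjoint edges is new, since all new edges contain x; otherwise the two edges
   exchange roles, which negates four values of [U]. *)
case: (boolP (e c d)) => [ecd|necd]; first exact: edge_rel.
have un' : uniq [:: c; d; a; b] by rewrite -[_ :: _]/([:: c; d] ++ [:: a; b]) uniq_catC.
have eab : e a b.
  case: (boolP (e a b)) => // neab.
  move: Eab Ecd un; rewrite (negPf necd) (negPf neab) /= !inE.
  by case/orP => /andP[/eqP-> _] /orP[] /andP[/eqP-> _]; rewrite eqxx ?orbT ?andbF.
have := edge_rel c d a b ccd eab un' ay by_; rewrite /van_kampen_sum => h.
rewrite -h.
have [UNca UNda UNcb UNdb] : [/\ U a c = negb (U c a), U a d = negb (U d a),
   U b c = negb (U c b) & U b d = negb (U d b)].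
  move: un'; rewrite /= !inE !negb_or => /and4P[/and3P[_ ca cb] /andP[da db] _ _].
  by split; apply: UN.
by rewrite UNca UNda UNcb UNdb; btauto.
Qed.
End Contract.

(** A vertex off an edge has exactly two edges disjoint from it, so every [K] term occurs twice in
    the sum. The [U] terms of a pair of vertices also occur evenly often, but for each of the three
    pairs of b's they come three times in either order; by antisymmetry each such pair contributes
    1, and the total is odd. *)
Lemma van_kampen_K33 (V : finType) (e : rel V) (a1 a2 a3 b1 b2 b3 : V) :
  van_kampen e -> uniq [:: a1; a2; a3; b1; b2; b3] ->
  {in [:: a1; a2; a3] & [:: b1; b2; b3], forall a b, e a b} -> False.
Proof.
move=> [U [K [UN KC r]]] un E.
(* All 18 pairs of disjoint edges of K_{3,3}. *)
pose quads := [::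
      ((a1, b1), (a2, b2)); ((a1, b1), (a2, b3)); ((a1, b2), (a2, b1));
      ((a1, b2), (a2, b3)); ((a1, b3), (a2, b1)); ((a1, b3), (a2, b2));
      ((a1, b1), (a3, b2)); ((a1, b1), (a3, b3)); ((a1, b2), (a3, b1));
      ((a1, b2), (a3, b3)); ((a1, b3), (a3, b1)); ((a1, b3), (a3, b2));
      ((a2, b1), (a3, b2)); ((a2, b1), (a3, b3)); ((a2, b2), (a3, b1));
      ((a2, b2), (a3, b3)); ((a2, b3), (a3, b1)); ((a2, b3), (a3, b2))].
have h p : p \in quads ->
    van_kampen_sum U K p.1.1 p.1.2 p.2.1 p.2.2 = false.
  have : all (fun p => [&& p.1.1 \in [:: a1; a2; a3], p.1.2 \in [:: b1; b2; b3],
      p.2.1 \in [:: a1; a2; a3], p.2.2 \in [:: b1; b2; b3] &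
      uniq [:: p.1.1; p.1.2; p.2.1; p.2.2]]) quads.
    move: un; rewrite /= !inE !eqxx !negb_or ?orbT -!andbA /=.
    do ![case/andP=> ?]; move=> *.
    repeat (apply/andP; split); try done; try (rewrite eq_sym; done).
  move=> /allP /[apply] /and5P[? ? ? ? ?].
  by apply: r => //; apply: E.
have z : foldr xorb false
    [seq van_kampen_sum U K p.1.1 p.1.2 p.2.1 p.2.2 | p <- quads] = false.
  by elim: quads h => //= p s IH h; rewrite h ?mem_head // IH // => q qs;
     apply: h; rewrite inE qs orbT.
move: un; rewrite /= !inE !negb_or -!andbA.
case/and5P=> a12 a13 ab11 ab12 /and5P[ab13 a23 ab21 ab22].
case/and5P=> ab23 ab31 ab32 ab33 /and4P[b12 b13 b23 _].
move: z; rewrite /van_kampen_sum /= ?(UN _ _ b12) ?(UN _ _ b13) ?(UN _ _ b23).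
rewrite ?(UN _ _ ab11) ?(UN _ _ ab12) ?(UN _ _ ab13) ?(UN _ _ ab21) ?(UN _ _ ab22).
rewrite ?(UN _ _ ab23) ?(UN _ _ ab31) ?(UN _ _ ab32) ?(UN _ _ ab33).
by move=> z; suff: true = false by []; rewrite -z; btauto.
Qed.

(** Again the [K] terms cancel, each vertex off an edge having two edges disjoint from it. With the
    edges listed in increasing order, each of the five sets of four vertices contributes three [U]
    terms in reversed order, so 15 in all, an odd number. *)
Lemma van_kampen_K5 (V : finType) (e : rel V) (v1 v2 v3 v4 v5 : V) :
  van_kampen e -> uniq [:: v1; v2; v3; v4; v5] ->
  {in [:: v1; v2; v3; v4; v5] &, forall u v, u != v -> e u v} -> False.
Proof.
move=> [U [K [UN KC r]]] un E.
pose quads := [::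
      ((v1, v2), (v3, v4)); ((v1, v2), (v3, v5)); ((v1, v2), (v4, v5));
      ((v1, v3), (v2, v4)); ((v1, v3), (v2, v5)); ((v1, v3), (v4, v5));
      ((v1, v4), (v2, v3)); ((v1, v4), (v2, v5)); ((v1, v4), (v3, v5));
      ((v1, v5), (v2, v3)); ((v1, v5), (v2, v4)); ((v1, v5), (v3, v4));
      ((v2, v3), (v4, v5)); ((v2, v4), (v3, v5)); ((v2, v5), (v3, v4))].
have h p : p \in quads ->
    van_kampen_sum U K p.1.1 p.1.2 p.2.1 p.2.2 = false.
  have : all (fun p => [&& p.1.1 \in [:: v1; v2; v3; v4; v5],
      p.1.2 \in [:: v1; v2; v3; v4; v5], p.2.1 \in [:: v1; v2; v3; v4; v5],
      p.2.2 \in [:: v1; v2; v3; v4; v5] &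
      uniq [:: p.1.1; p.1.2; p.2.1; p.2.2]]) quads.
    move: un; rewrite /= !inE !eqxx !negb_or ?orbT -!andbA /=.
    do ![case/andP=> ?]; move=> *.
    repeat (apply/andP; split); try done; try (rewrite eq_sym; done).
  move=> /allP /[apply] /and5P[? ? ? ? un4].
  move: (un4); rewrite /= !inE !negb_or => /and4P[/andP[? _] _ ? _].
  by apply: r => //; apply: E.
have z : foldr xorb false
    [seq van_kampen_sum U K p.1.1 p.1.2 p.2.1 p.2.2 | p <- quads] = false.
  by elim: quads h => //= p s IH h; rewrite h ?mem_head // IH // => q qs;
     apply: h; rewrite inE qs orbT.
move: un; rewrite /= !inE !negb_or -!andbA.
case/and5P=> v12 v13 v14 v15 /and5P[v23 v24 v25 v34] /and3P[v35 v45 _].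
move: z; rewrite /van_kampen_sum /= ?(UN _ _ v12) ?(UN _ _ v13) ?(UN _ _ v14).
rewrite ?(UN _ _ v15) ?(UN _ _ v23) ?(UN _ _ v24) ?(UN _ _ v25) ?(UN _ _ v34).
rewrite ?(UN _ _ v35) ?(UN _ _ v45).
rewrite ?(KC _ v2 v1) ?(KC _ v3 v1).
by move=> z; suff: true = false by []; rewrite -z; btauto.
Qed.

(** * Density of planar graphs *)

Definition nbrs (V : finType) (e : rel V) (W : {set V}) (u : V) : {set V} :=
  [set v in W | e u v].

(* Counts every edge inside W twice. *)
Definition degsum (V : finType) (e : rel V) (W : {set V}) : nat :=
  \sum_(u in W) #|nbrs e W u|.

Lemma card_nbrs (V : finType) (e : rel V) (W : {set V}) u :
  #|nbrs e W u| = \sum_(v in W) e u v.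
Proof.
rewrite -sum1_card (eq_bigl (fun v => (v \in W) && e u v)); last first.
  by move=> v; rewrite inE.
by rewrite big_mkcondr; apply: eq_bigr => v _; case: (e u v).
Qed.

Lemma sub_rel_degsum (V : finType) (e e' : rel V) (W : {set V}) :
  {in W &, subrel e e'} -> degsum e W <= degsum e' W.
Proof.
move=> sub; apply: leq_sum => u uW; apply: subset_leq_card.
by apply/subsetP => v; rewrite !inE => /andP[vW /sub->] //; rewrite vW.
Qed.

Section PlanarDensity.
Variable V : finType.
Implicit Types (e : rel V) (W S T : {set V}) (x y u v : V).

Lemma degsum_rem e W x : symmetric e -> irreflexive e -> x \in W ->
  degsum e W = degsum e (W :\ x) + 2 * #|nbrs e (W :\ x) x|.
Proof.
move=> es ei xW; rewrite /degsum (big_setD1 x) //=.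
have -> : #|nbrs e W x| = #|nbrs e (W :\ x) x|.
  by rewrite !card_nbrs (big_setD1 x) //= ei.
have -> : \sum_(u in W :\ x) #|nbrs e W u| =
          \sum_(u in W :\ x) (e u x + #|nbrs e (W :\ x) u|).
  by apply: eq_bigr => u _; rewrite !card_nbrs (big_setD1 x).
rewrite big_split /= (eq_bigr (fun u => e x u : nat)) => [|u _]; last by rewrite es.
by rewrite -card_nbrs; lia.
Qed.

(** Only the edge xy disappears and, for each common neighbour, two edges become one; [degsum]
    counts each loss twice. *)
Lemma degsum_contract e W x y : symmetric e -> irreflexive e -> e x y ->
    x \in W -> y \in W ->
  degsum e W <= degsum (contract e x y) (W :\ y)
                + 2 + 2 * #|nbrs e (nbrs e W x) y|.
Proof.
move=> es ei exy xW yW.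
have xy : x != y by apply/eqP => h; rewrite h ei in exy.
have xW' : x \in W :\ y by rewrite !inE xy.
pose e' := contract e x y.
have es' : symmetric e' := contract_sym es x y.
have ei' : irreflexive e' := @contract_irr _ e x y.
rewrite (degsum_rem es ei yW) (degsum_rem es' ei' xW') (degsum_rem es ei xW').
set W2 := W :\ y :\ x.
have -> : #|nbrs e (W :\ y) y| = 1 + #|nbrs e W2 y|.
  by rewrite !card_nbrs (big_setD1 x) //= es exy.
have le2 : degsum e W2 <= degsum e' W2.
  apply: sub_rel_degsum => u v; rewrite !inE => /and3P[_ uy _] /and3P[_ vy _] euv.
  exact: contract_keep.
have : #|nbrs e W2 x| + #|nbrs e W2 y| <= #|nbrs e' W2 x| + #|nbrs e (nbrs e W x) y|.
  rewrite -(cardsUI (nbrs e W2 x)); apply: leq_add; apply: subset_leq_card.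
    apply/subsetP => v; rewrite !inE => /orP[] /andP[/and3P[vx vy ->] h].
      by rewrite vx vy; apply: contract_keep.
    by rewrite vx vy /=; apply: contract_new.
  by apply/subsetP => v; rewrite !inE => /andP[/andP[/and3P[_ _ ->] ->] /andP[_ ->]].
rewrite -/e'; lia.
Qed.

Lemma pairwise_sym_in e (s : seq V) : symmetric e -> pairwise e s ->
  {in s &, forall u v, u != v -> e u v}.
Proof.
move=> es; elim: s => //= a s IH /andP[/allP as_ /IH{}IH] u v.
rewrite !inE => /orP[/eqP->|us] /orP[/eqP->|vs]; first by rewrite eqxx.
- by move=> _; apply: as_.
- by move=> _; rewrite es; apply: as_.
exact: IH.
Qed.

Definition apexed e (s : seq V) W :=
  pairwise e s /\ {in s & W, forall a w, e a w}.

(* With three pairwise adjacent apexes an edge of W would complete a K_5. Going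
   from k + 1 to k apexes: contract an edge of W with at most 2c common
   neighbours, if there is one; otherwise, with x in W as an additional apex,
   the neighbourhood of x in W is too dense. *)
Lemma apexed_degsum (k c : nat) :
  (k, c) \in [:: (3, 0); (2, 1); (1, 3); (0, 7)] ->
  forall e (s : seq V) W, symmetric e -> irreflexive e -> van_kampen e ->
    size s = k -> apexed e s W -> degsum e W <= 2 * c * #|W|.-1.
Proof.
suff step k' c' : (forall e (s : seq V) W, symmetric e -> irreflexive e ->
      van_kampen e -> size s = k'.+1 -> apexed e s W ->
      degsum e W <= 2 * c' * #|W|.-1) ->
    forall e (s : seq V) W, symmetric e -> irreflexive e ->
      van_kampen e -> size s = k' -> apexed e s W ->
      degsum e W <= 2 * (2 * c' + 1) * #|W|.-1.
  have b3 : forall e (s : seq V) W, symmetric e -> irreflexive e ->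
      van_kampen e -> size s = 3 -> apexed e s W -> degsum e W <= 2 * 0 * #|W|.-1.
    move=> e s W es ei vk; case: s => [|a [|b [|c' [|]]]] // _.
    case=> /=; rewrite !andbT -!andbA => /and3P[ab ac bc] sW.
    rewrite leqn0 sum_nat_eq0; apply/forall_inP => u uW.
    rewrite cards_eq0; apply/eqP/setP => v; rewrite !inE; apply/negP => /andP[vW euv].
    have [aW bW cW] : [/\ {in W, forall w, e a w}, {in W, forall w, e b w} &
        {in W, forall w, e c' w}].
      by split=> w wW; apply: sW => //; rewrite !inE eqxx ?orbT.
    have cl : pairwise e [:: a; b; c'; u; v].
      by rewrite /= ab ac bc !aW ?bW ?cW ?euv.
    exact: van_kampen_K5 vk (pairwise_uniq ei cl) (pairwise_sym_in es cl).
  have b2 := step _ _ b3; have b1 := step _ _ b2; have b0 := step _ _ b1.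
  by rewrite !inE => /or4P[] /eqP[-> ->].
move=> L e s W es ei vk sk; have [m] := ubnP #|W|.
elim: m e W es ei vk => // m IH e W es ei vk Wm ap.
have [ap1 ap2] := ap.
have [/existsP[x /existsP[y /and4P[xW yW exy small]]]|] :=
  boolP [exists x, [exists y, [&& x \in W, y \in W, e x y &
                     #|nbrs e (nbrs e W x) y| <= 2 * c']]].
  have xy : x != y by apply/eqP => h; rewrite h ei in exy.
  have cW : #|W| = #|W :\ y|.+1 by rewrite (cardsD1 y W) yW.
  have : 0 < #|W :\ y| by apply/card_gt0P; exists x; rewrite !inE xy.
  have : degsum (contract e x y) (W :\ y) <= 2 * (2 * c' + 1) * #|W :\ y|.-1.
    have nsW a : a \in s -> a \notin W.
      by move=> sa; apply/negP => aW; have := ap2 a a sa aW; rewrite ei.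
    have nsy a : a \in s -> a != y.
      by move=> sa; apply/eqP => ay; have := nsW _ sa; rewrite ay yW.
    apply: IH; [exact: contract_sym|exact: contract_irr|
      exact: van_kampen_contract|by lia|split].
      apply: (sub_in_pairwise (P := [in s])) ap1; last exact/allP.
      by move=> a b sa sb ab; apply: contract_keep => //; apply: nsy.
    move=> a w sa; rewrite !inE => /andP[wy wW].
    by apply: contract_keep => //; [apply: ap2|apply: nsy].
  (* The loss is at most 2 + 2 * (2 * c'), which is exactly the new coefficient 2 * (2 * c' + 1) and
     is paid for by [W] losing one vertex. Hence the sequence 0, 1, 3, 7. *)
  have := degsum_contract es ei exy xW yW; nia.
move=> /existsPn nex.
have [W0|[x]] := set_0Vmem [set x in W | nbrs e W x != set0].
  suff -> : degsum e W = 0 by [].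
  rewrite /degsum big1 // => x xW; apply/eqP; rewrite cards_eq0.
  by apply/negPn; move/setP/(_ x): W0; rewrite !inE xW /= => ->.
rewrite inE => /andP[xW N0]; set N := nbrs e W x in N0.
have : degsum e N <= 2 * c' * #|N|.-1.
  apply: (L e (x :: s)) => //=; first by rewrite sk.
  split=> /=; first by rewrite ap1 andbT; apply/allP => a sa; rewrite es ap2.
  move=> a w; rewrite !inE => /orP[/eqP->|sa] /andP[wW exw] //.
  exact: ap2.
(* The common neighbours of x and y are the neighbours of y inside N. All degrees in N therefore
   exceed 2c', whereas the extra apex x forces their average below 2c'. *)
have : (2 * c' + 1) * #|N| <= degsum e N.
  rewrite mulnC -sum_nat_const; apply: leq_sum => y; rewrite inE => /andP[yW exy].
  by have /existsPn/(_ y) := nex x; rewrite xW yW exy -ltnNge addn1.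
have : 0 < #|N| by rewrite card_gt0.
nia.
Qed.

Lemma planar_degsum e W : symmetric e -> irreflexive e -> van_kampen e ->
  degsum e W <= 14 * #|W|.
Proof.
move=> es ei vk; apply: leq_trans (_ : 14 * #|W|.-1 <= _); last by lia.
exact: (@apexed_degsum 0 7 _ e [::] W).
Qed.

Lemma planar_min_degree e W : symmetric e -> irreflexive e -> van_kampen e ->
  W != set0 -> exists2 x, x \in W & #|nbrs e W x| <= 14.
Proof.
move=> es ei vk W0; apply/exists_inP; rewrite -[X in is_true X]negbK negb_exists_in.
apply/negP => /forall_inP big.
have := planar_degsum W es ei vk.
have : 15 * #|W| <= degsum e W.
  by rewrite mulnC -sum_nat_const; apply: leq_sum => x /big; rewrite -ltnNge.
have : 0 < #|W| by rewrite card_gt0.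
lia.
Qed.

Lemma common_nbrs3 e x y z : symmetric e -> irreflexive e -> van_kampen e ->
  uniq [:: x; y; z] -> #|[set v | [&& e x v, e y v & e z v]]| <= 2.
Proof.
move=> es ei vk un; rewrite leqNgt; apply/negP => /card_gt2P.
move=> [b1 [b2 [b3 [[h1 h2 h3] [b12 b23 b31]]]]].
move: h1 h2 h3; rewrite !inE => /and3P[x1 y1 z1] /and3P[x2 y2 z2] /and3P[x3 y3 z3].
have neq p q : e p q -> p != q by move=> h; apply/eqP => pq; rewrite pq ei in h.
move: un; rewrite /= !inE negb_or => /and3P[/andP[xy xz] yz _].
apply: (@van_kampen_K33 _ e x y z b1 b2 b3 vk).
  by rewrite /= !inE !negb_or b12 b23 (eq_sym b1 b3) b31 xy xz yz !neq.
by move=> a b; rewrite !inE => /or3P[] /eqP-> /or3P[] /eqP->.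
Qed.

Definition triangles e S : {set V * V * V} :=
  [set p | [&& p.1.1 \in S, p.1.2 \in S, p.2 \in S,
               e p.1.1 p.1.2, e p.1.2 p.2 & e p.1.1 p.2]].

(** Deleting a vertex of degree at most 14 destroys at most 3 * 14^2 = 588 ordered triangles,
    according to its position in the triple. *)
Lemma planar_triangles e S : symmetric e -> irreflexive e -> van_kampen e ->
  #|triangles e S| <= 588 * #|S|.
Proof.
move=> es ei vk; have [m] := ubnP #|S|; elim: m S => // m IH S Sm.
have [->|S0] := eqVneq S set0.
  by rewrite eq_card0 // => p; rewrite !inE.
have [x xS dx] := planar_min_degree es ei vk S0.
have cS : #|S| = #|S :\ x|.+1 by rewrite (cardsD1 x S) xS.
have := IH (S :\ x); rewrite -ltnS -cS => /(_ Sm) IHx.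
pose N := nbrs e S x.
pose T1 := [set ((x, p.1), p.2) | p in setX N N].
pose T2 := [set ((p.1, x), p.2) | p in setX N N].
pose T3 := [set ((p.1, p.2), x) | p in setX N N].
have sub : triangles e S \subset triangles e (S :\ x) :|: (T1 :|: T2 :|: T3).
  apply/subsetP => -[[a b] c]; rewrite !inE /= => /and5P[aS bS cS' ab /andP[bc ac]].
  rewrite ab bc ac aS bS cS' !andbT.
  case: (eqVneq a x) => [ax|_] /=.
    by apply/orP; left; apply/orP; left; apply/imsetP; exists (b, c);
       rewrite ?inE /= ?bS ?cS' -?ax ?ab ?ac.
  case: (eqVneq b x) => [bx|_] /=.
    by apply/orP; left; apply/orP; right; apply/imsetP; exists (a, c);
       rewrite ?inE /= ?aS ?cS' -?bx ?bc ?(es b a) ?ab.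
  case: (eqVneq c x) => [cx|_] //=.
  by apply/orP; right; apply/imsetP; exists (a, b);
     rewrite ?inE /= ?aS ?bS -?cx ?(es c a) ?(es c b) ?ac ?bc.
have cN (f : V * V -> V * V * V) : #|[set f p | p in setX N N]| <= 14 * 14.
  by apply: leq_trans (leq_imset_card _ _) _; rewrite cardsX leq_mul.
have le1 : #|triangles e S| <= #|triangles e (S :\ x)| + (196 + 196 + 196).
  apply: leq_trans (subset_leq_card sub) _.
  apply: leq_trans (leq_of_leqif (leq_card_setU _ _)) _; rewrite leq_add2l.
  apply: leq_trans (leq_of_leqif (leq_card_setU _ _)) _; apply: leq_add (cN _).
  by apply: leq_trans (leq_of_leqif (leq_card_setU _ _)) _; apply: leq_add; apply: cN.
by apply: leq_trans le1 _; rewrite cS; lia.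
Qed.

(* Contract t in T whenever two of its neighbours in S are not adjacent: this
   creates a new edge inside S. Once all neighbourhoods are cliques, each t sits
   on a triangle of S, and by K_{3,3} at most two of them on the same one. *)
Lemma three_nbrs_card e S T : symmetric e -> irreflexive e -> van_kampen e ->
  [disjoint S & T] -> {in T, forall t, 2 < #|nbrs e S t|} ->
  #|T| <= 1183 * #|S|.
Proof.
move=> es ei vk dST hT.
(* A contraction removes one t and creates an edge inside S, which adds 2 to [degsum], so this
   quantity does not decrease. At the end it is at most 2 * 2 * 588 * #|S| + 14 * #|S|, whence
   2366. *)
suff : 2 * #|T| + degsum e S <= 2366 * #|S| by lia.
have [m] := ubnP #|T|; elim: m T e es ei vk dST hT => // m IH T e es ei vk dST hT Tm.
have [/existsP[t /existsP[x /existsP[y /and5P[tT xS yS xy /and3P[tx ty nxy]]]]]|nex] :=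
  boolP [exists t, exists x, exists y, [&& t \in T, x \in S, y \in S, x != y &
           [&& e t x, e t y & ~~ e x y]]].
  have nT u : u \in S -> u \notin T by move=> uS; rewrite (disjointFr dST).
  have ext : e x t by rewrite es.
  have xt : x != t by apply/eqP => h; rewrite h ei in ext.
  have neqt u : u \in S -> u != t by move=> /nT; apply: contraNneq => ->.
  pose e' := contract e x t.
  have keep : {in S &, subrel e e'}.
    by move=> u v uS vS euv; apply: contract_keep; rewrite ?neqt.
  have : 2 * #|T :\ t| + degsum e' S <= 2366 * #|S|.
    apply: IH.
    - exact: contract_sym.
    - exact: contract_irr.
    - exact: van_kampen_contract.
    - by apply: disjointWr dST; apply: subD1set.
    - move=> u; rewrite !inE => /andP[ut uT]; apply: leq_trans (hT u uT) _.
      apply: subset_leq_card; apply/subsetP => v; rewrite !inE => /andP[vS euv].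
      by rewrite vS; apply: contract_keep => //; apply: neqt.
    - by move: Tm; rewrite (cardsD1 t T) tT; clear; lia.
  have : degsum e S + 2 <= degsum e' S.
    have es' : symmetric e' := contract_sym es x t.
    have ei' : irreflexive e' := @contract_irr _ e x t.
    rewrite (degsum_rem es ei xS) (degsum_rem es' ei' xS).
    have : degsum e (S :\ x) <= degsum e' (S :\ x).
      by apply: sub_rel_degsum => u v /setD1P[_ uS] /setD1P[_ vS]; apply: keep.
    have : #|nbrs e (S :\ x) x| < #|nbrs e' (S :\ x) x|.
      apply: proper_card; apply/properP; split.
        apply/subsetP => v; rewrite !inE => /andP[/andP[-> vS] exv].
        by rewrite vS keep.
      exists y; rewrite !inE ?(negPf nxy) ?andbF // (eq_sym y) xy yS /=.
      by apply: contract_new; rewrite ?(eq_sym y) ?(eq_sym t).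
    by clear; lia.
  by rewrite (cardsD1 t T) tT; clear; lia.
have cliq t x y : t \in T -> x \in S -> y \in S -> x != y -> e t x -> e t y -> e x y.
  move=> tT xS yS xy tx ty; apply: contraNT nex => nxy.
  by apply/existsP; exists t; apply/existsP; exists x; apply/existsP; exists y;
     apply/and5P; split=> //; apply/and3P.
pose f t : V * V * V :=
  if [pick p in triangles e S | [&& e t p.1.1, e t p.1.2 & e t p.2]] is Some p
  then p else (t, t, t).
have fP t : t \in T -> f t \in triangles e S /\
    [&& e t (f t).1.1, e t (f t).1.2 & e t (f t).2].
  move=> tT; rewrite /f; case: pickP => [p /andP[]//|no].
  have /card_gt2P[b1 [b2 [b3 [[h1 h2 h3] [b12 b23 b31]]]]] := hT t tT.
  move: h1 h2 h3; rewrite !inE => /andP[S1 t1] /andP[S2 t2] /andP[S3 t3].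
  have := no ((b1, b2), b3); rewrite !inE /= S1 S2 S3 t1 t2 t3.
  by rewrite (cliq t b1 b2) ?(cliq t b2 b3) ?(cliq t b1 b3) // eq_sym.
have : #|T| <= #|triangles e S| * 2.
  rewrite -sum1_card (partition_big f (mem (triangles e S))) /=; last first.
    by move=> t /fP[].
  rewrite -sum_nat_const; apply: leq_sum => p pS.
  rewrite sum1_card.
  apply: leq_trans (_ : #|[set v | [&& e p.1.1 v, e p.1.2 v & e p.2 v]]| <= _).
    apply: subset_leq_card; apply/subsetP => t; rewrite unfold_in => /andP[/fP[_ h]
      /eqP ft].
    by move: h; rewrite ft inE !(es t).
  apply: common_nbrs3 => //; move: pS; rewrite !inE => /and5P[_ _ _ h12 /andP[h23 h13]].
  have neq a b : e a b -> a != b by move=> h; apply/eqP => ab; rewrite ab ei in h.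
  by rewrite /= !inE !negb_or !neq.
have := planar_triangles S es ei vk; have := planar_degsum S es ei vk.
by clear; lia.
Qed.
End PlanarDensity.

(** * Stability of the weighted triangle polynomial *)

Local Open Scope ring_scope.

Lemma amgm3 (F : realFieldType) (a b c : F) : 0 <= a -> 0 <= b -> 0 <= c ->
  27 * (a * b * c) <= (a + b + c) ^+ 3.
Proof.
move=> a0 b0 c0; rewrite -subr_ge0.
have -> : (a + b + c) ^+ 3 - 27 * (a * b * c) =
  (a + b + c) / 2 * ((a - b) ^+ 2 + (b - c) ^+ 2 + (a - c) ^+ 2) +
  3 * (a * (b - c) ^+ 2 + b * (a - c) ^+ 2 + c * (a - b) ^+ 2) by field.
by do ?[apply: sqr_ge0 | apply: addr_ge0 | apply: mulr_ge0]; rewrite ?invr_ge0.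
Qed.

Section LinearTripleSystem.
Variables (F : realFieldType) (I : finType) (L : {set {set I}}) (D : {set I}).
Hypothesis card_line : {in L, forall t : {set I}, #|t| = 3%N}.
Hypothesis linear_lines : {in L &, forall (t t' : {set I}) i j, i != j ->
  i \in t -> j \in t -> i \in t' -> j \in t' -> t = t'}.
(** The intended points are the pairs of vertices and the lines are the triples of pairs inside
    three vertices. Since the index type will be that of all vertex sets, [D] singles out the
    genuine pairs. *)
Hypothesis far_point : {in L & D, forall (t : {set I}) g, g \notin t ->
  exists2 e, e \in t & {in L, forall t' : {set I}, ~~ ((e \in t') && (g \in t'))}}.
Implicit Types (w : I -> F) (t : {set I}).

(** The Lagrangian polynomial of the triple system. *)
Definition line_poly w : F := \sum_(t in L) \prod_(i in t) w i.

Lemma line_split t a : t \in L -> a \in t ->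
  exists b c, [/\ a != b, a != c, b != c & t = [set a; b; c]].
Proof.
move=> tL at_; have : #|t :\ a| == 2%N.
  by have := card_line tL; rewrite (cardsD1 a) at_ add1n => -[->].
move=> /cards2P[b [c [bc tE]]].
have : b \in t :\ a by rewrite tE !inE eqxx.
have : c \in t :\ a by rewrite tE !inE eqxx orbT.
rewrite !inE => /andP[ca _] /andP[ba _]; exists b, c.
split; rewrite // 1?eq_sym //; rewrite -(setD1K at_) tE.
by rewrite setUA.
Qed.

Lemma prod_set3 (a b c : I) w : a != b -> a != c -> b != c ->
  \prod_(i in [set a; b; c]) w i = w a * w b * w c.
Proof.
move=> ab ac bc; rewrite -setUA big_setU1 ?inE ?negb_or ?ab //=.
by rewrite big_setU1 ?inE //= big_set1 mulrA.
Qed.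

Lemma sum_set3 (a b c : I) w : a != b -> a != c -> b != c ->
  \sum_(i in [set a; b; c]) w i = w a + w b + w c.
Proof.
move=> ab ac bc; rewrite -setUA big_setU1 ?inE ?negb_or ?ab //=.
by rewrite big_setU1 ?inE //= big_set1 addrA.
Qed.

Section Weight.
Variable w : I -> F.
Hypotheses (w0 : forall i, 0 <= w i) (w1 : \sum_i w i <= 1).

Lemma sum_in_le1 (A : {set I}) : \sum_(i in A) w i <= 1.
Proof.
apply: le_trans w1; rewrite [leRHS](bigID (mem A)) /= lerDl.
exact: sumr_ge0.
Qed.

Lemma weight_le1 i : w i <= 1.
Proof. by have := sum_in_le1 [set i]; rewrite big_set1. Qed.

(* Two points determine the line, and the third weight is at most 1. *)
Lemma lines_pair_bound (M : {set {set I}}) (B C : {set I}) : M \subset L ->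
  {in M, forall t : {set I}, exists b c, [/\ b \in B, c \in C, b != c, b \in t & c \in
    t]} ->
  \sum_(t in M) \prod_(i in t) w i <= (\sum_(b in B) w b) * (\sum_(c in C) w c).
Proof.
move=> /subsetP ML pairs.
pose on b c t := [&& b != c, b \in t & c \in t].
have key b c : \sum_(t in M) (if on b c t then w b * w c else 0) <= w b * w c.
  have [t /andP[tM tbc]|none] := pickP (fun t => (t \in M) && on b c t); last first.
    rewrite big1 ?mulr_ge0 // => t tM; case: ifP => // tbc.
    by have := none t; rewrite tM tbc.
  rewrite (bigD1 t) //= tbc big1 ?addr0 // => t' /andP[t'M].
  case: ifP => // t'bc /eqP[]; move: tbc t'bc => /and3P[bc bt ct] /and3P[_ bt' ct'].
  exact: (linear_lines (ML _ t'M) (ML _ tM) bc).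
apply: (@le_trans _ _ (\sum_(t in M) \sum_(b in B) \sum_(c in C)
    (if on b c t then w b * w c else 0))).
  apply: ler_sum => t tM; have [b [c [bB cC bc bt ct]]] := pairs t tM.
  have pos b' c' : 0 <= (if on b' c' t then w b' * w c' else 0).
    by case: ifP => // _; rewrite mulr_ge0.
  have onbc : on b c t by rewrite /on bc bt ct.
  rewrite [leRHS](bigD1 b) //= [X in _ <= X + _](bigD1 c) //= onbc.
  apply: (@le_trans _ _ (w b * w c)); last first.
    rewrite -addrA lerDl addr_ge0 //; first exact: sumr_ge0.
    by apply: sumr_ge0 => b' _; apply: sumr_ge0.
  have [x [y [bx by_ xy tE]]] := line_split (ML t tM) bt.
  rewrite {1}tE prod_set3 //; have := ct; rewrite tE !inE eq_sym (negPf bc) /=.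
  by case/orP=> /eqP->; [|rewrite mulrAC]; rewrite ler_piMr ?mulr_ge0 ?weight_le1.
rewrite exchange_big big_distrl /=; apply: ler_sum => b bB.
rewrite exchange_big big_distrr /=; apply: ler_sum => c cC.
exact: key.
Qed.

Lemma line_prod_le t : t \in L ->
  27 * \prod_(i in t) w i <= (\sum_(i in t) w i) ^+ 3.
Proof.
move=> tL; have /card_gt0P[a at_] : (0 < #|t|)%N by rewrite card_line.
have [b [c [ab ac bc ->]]] := line_split tL at_.
by rewrite prod_set3 // sum_set3 //; apply: amgm3.
Qed.

Lemma outside_pair t t' : t \in L -> t' \in L -> t' != t ->
  exists b c, [/\ b \notin t, c \notin t, b != c, b \in t' & c \in t'].
Proof.
move=> tL t'L ne; have : (1 < #|t' :\: t|)%N.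
  rewrite cardsD card_line // ltn_subRL addn1 ltnS.
  rewrite leqNgt; apply: contra ne => /card_gt1P[x [y [+ + xy]]].
  rewrite !inE => /andP[xt' xt] /andP[yt' yt].
  by apply/eqP; apply: (linear_lines t'L tL xy).
move=> /card_gt1P[b [c [+ + bc]]]; rewrite !inE => /andP[? ?] /andP[? ?].
by exists b, c.
Qed.

Lemma line_polyD1 t : t \in L ->
  line_poly w = \prod_(i in t) w i + \sum_(t' in L :\ t) \prod_(i in t') w i.
Proof. by move=> tL; rewrite /line_poly (big_setD1 t). Qed.

Lemma outside_mass t : \sum_(i in ~: t) w i <= 1 - \sum_(i in t) w i.
Proof.
rewrite lerBrDr addrC -[leLHS]addr0; apply: le_trans w1.
rewrite [leRHS](bigID (mem t)) /= addr0 lerD2l le_eqVlt; apply/orP; left.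
by apply/eqP; apply: eq_bigl => i; rewrite inE.
Qed.

(** A line other than t meets t in at most one point, so it has two points outside t, and these
    determine it. *)
Lemma line_poly_outside t : t \in L ->
  line_poly w <= \prod_(i in t) w i + (\sum_(i in ~: t) w i) ^+ 2.
Proof.
move=> tL; rewrite (line_polyD1 tL) lerD2l expr2.
apply: lines_pair_bound; first exact: subD1set.
move=> t' /setD1P[ne t'L]; have [b [c [bt ct bc bt' ct']]] := outside_pair tL t'L ne.
by exists b, c; rewrite !inE bt ct.
Qed.

Lemma line_poly_near t : t \in L ->
  line_poly w <= \prod_(i in t) w i + (1 - \sum_(i in t) w i) ^+ 2.
Proof.
move=> tL; apply: le_trans (line_poly_outside tL) _; rewrite lerD2l.
have out0 : 0 <= \sum_(i in ~: t) w i by apply: sumr_ge0.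
by rewrite ler_sqr ?nnegrE ?outside_mass // (le_trans out0) ?outside_mass.
Qed.

(** On the interval from 19/20 to 1 the upper bound s^3 + 27 (1 - s)^2 is at most s. Hence a rough
    lower bound on the mass of t improves to the sharp one, and nothing is lost in the induction on
    the support. *)
Lemma near_extremal_gap (eta : F) t : t \in L ->
  (1 - eta) <= 27 * line_poly w -> 19 / 20 <= \sum_(i in t) w i ->
  1 - eta <= \sum_(i in t) w i.
Proof.
move=> tL big.
have := line_prod_le tL; have := line_poly_near tL; have := sum_in_le1 t.
move: (\sum_(i in t) w i) => s s1 le1 le2 ge.
apply: (@le_trans _ _ (s ^+ 3 + 27 * (1 - s) ^+ 2)); first by lra.
rewrite -subr_ge0.
have -> : s - (s ^+ 3 + 27 * (1 - s) ^+ 2) = (1 - s) * (s * (1 + s) - 27 * (1 - s)).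
  by ring.
by rewrite mulr_ge0; nra.
Qed.

(** A weight below 1/20 on t would make the product on t at most 1/80, since the other two weights
    multiply to at most 1/4, and the remaining lines add at most 1/400. *)
Lemma line_weights_large t : t \in L -> 26 / 27 <= 27 * line_poly w ->
  19 / 20 <= \sum_(i in t) w i -> {in t, forall i, 1 / 20 <= w i}.
Proof.
move=> tL big ge i it.
have [b [c [ib ic bc tE]]] := line_split tL it.
have := line_poly_near tL; have := sum_in_le1 t; move: ge.
move: (\sum_(i in t) w i) => s ge s1; rewrite tE prod_set3 //.
have sum1 : w i + w b + w c <= 1 by rewrite -sum_set3 ?sum_in_le1.
have sq : (1 - s) ^+ 2 <= 1 / 400.
  have -> : 1 / 400 = (1 / 20 : F) ^+ 2 by field.
  by rewrite ler_sqr ?nnegrE; lra.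
have : w b * w c <= 1 / 4.
  have := sqr_ge0 (w b - w c); have := w0 i; have := w0 b; have := w0 c.
  by move: sum1; move: (w i) (w b) (w c) => x y z; nra.
move: (w0 i) (mulr_ge0 (w0 b) (w0 c)) (w0 b) (w0 c).
rewrite -mulrA; move: (w b * w c) (w i) => x y *.
rewrite leNgt; apply/negP => small.
have : y * x <= 1 / 20 * (1 / 4) by apply: ler_pM; lra.
lra.
Qed.
End Weight.

(** Symmetrization in the manner of Motzkin and Straus: for two points on no common line the
    polynomial has no mixed term in their weights, so one of them can give all its weight to the
    other without decreasing the value. The support shrinks until any two of its points are
    collinear. *)
Lemma line_poly_stability (eta : F) : 0 < eta -> eta <= 1 / 1200 ->
  forall w, (forall i, 0 <= w i) -> \sum_i w i <= 1 ->
    (forall i, w i != 0 -> i \in D) -> 1 - eta <= 27 * line_poly w ->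
  exists2 t, t \in L & 1 - eta <= \sum_(i in t) w i.
Proof.
move=> eta0 eta1 w; have [m] := ubnP #|[set i | w i != 0]|.
elim: m w => // m IH w supp w0 w1 wD big.
have [/existsP[e /existsP[f /and5P[we wf ef /forall_inP noef _]]]|] :=
  boolP [exists e, exists f, [&& w e != 0, w f != 0, e != f,
     [forall t in L, ~~ ((e \in t) && (f \in t))] & true]].
  (* The partial derivative of the polynomial in the weight of g; the point with the larger one
     receives the weight. *)
  pose link g := \sum_(t in L | g \in t) \prod_(i in t :\ g) w i.
  wlog lef : e f we wf ef noef / link f <= link e.
    move=> H; have [le|/ltW le] := leP (link f) (link e); first exact: (H e f).
    apply: (H f e) => //; first by rewrite eq_sym.
    by move=> t /noef; rewrite andbC.
  pose w' i := if i == e then w e + w f else if i == f then 0 else w i.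
  have fe : f != e by rewrite eq_sym.
  have w'e : w' e = w e + w f by rewrite /w' eqxx.
  have w'f : w' f = 0 by rewrite /w' (negPf fe) eqxx.
  have w'i i : i != e -> i != f -> w' i = w i.
    by rewrite /w' => /negPf-> /negPf->.
  have split_poly (v : I -> F) : (forall i, i != e -> i != f -> v i = w i) ->
      line_poly v = v e * link e + v f * link f +
        \sum_(t in L | (e \notin t) && (f \notin t)) \prod_(i in t) w i.
    move=> vw; rewrite /line_poly (bigID (fun t => e \in t)) /= -addrA.
    rewrite [X in _ + X](bigID (fun t => f \in t)) /= !big_distrr /=.
    congr (_ + (_ + _)).
    - apply: eq_bigr => t /andP[tL et]; rewrite (big_setD1 e) //=.
      congr (_ * _); apply: eq_bigr => i; rewrite !inE => /andP[ie it].
      by apply: vw => //; apply: contraTneq it => ->; have := noef t tL; rewrite et.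
    - apply: eq_big => [t|t /andP[/andP[tL et] ft]].
        case: (boolP (t \in L)) => //= tL; have := noef t tL.
        by case: (e \in t); case: (f \in t).
      rewrite (big_setD1 f) //=; congr (_ * _); apply: eq_bigr => i.
      rewrite !inE => /andP[i_f it].
      by apply: vw => //; apply: contraNneq et => <-.
    apply: eq_big => [t|t /andP[/andP[tL et] ft]]; first by rewrite andbA.
    apply: eq_bigr => i it; apply: vw.
      by apply: contraNneq et => <-.
    by apply: contraNneq ft => <-.
  have sumE (v : I -> F) : \sum_i v i = v e + v f + \sum_(i | (i != e) && (i != f)) v i.
    by rewrite (bigD1 e) //= (bigD1 f) //= addrA.
  have w'0 i : 0 <= w' i.
    by rewrite /w'; case: ifP => _; [rewrite addr_ge0|case: ifP].
  have w'1 : \sum_i w' i <= 1.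
    apply: le_trans w1; rewrite !sumE w'e w'f addr0 lerD2l le_eqVlt.
    by apply/orP; left; apply/eqP; apply: eq_bigr => i /andP[]; apply: w'i.
  have w'D i : w' i != 0 -> i \in D.
    have [-> _|ie] := eqVneq i e; first exact: wD.
    have [->|i_f] := eqVneq i f; first by rewrite w'f eqxx.
    by rewrite w'i //; exact: wD.
  have big' : 1 - eta <= 27 * line_poly w'.
    apply: le_trans big _; rewrite ler_pM2l ?ltr0n //.
    rewrite (split_poly w) // (split_poly w') // w'e w'f mul0r addr0 lerD2r mulrDl.
    by rewrite lerD2l ler_wpM2l.
  have [|t tL near'] := IH w' _ w'0 w'1 w'D big'.
    rewrite -ltnS; apply: leq_trans supp; rewrite ltnS; apply: proper_card.
    apply/properP; split; last by exists f; rewrite !inE ?w'f ?eqxx.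
    apply/subsetP => i; rewrite !inE.
    have [->|ie] := eqVneq i e; first by [].
    by have [->|i_f] := eqVneq i f; [rewrite w'f eqxx|rewrite w'i].
  exists t => //; apply: near_extremal_gap => //.
  (* The emptied point cannot lie on t: the product on t would vanish, and the other lines give at
     most the square of the mass outside t. *)
  have [ft|ft] := boolP (f \in t).
    have := line_poly_near w'0 w'1 tL; rewrite (big_setD1 f) //= w'f mul0r add0r.
    have := sum_in_le1 w'0 w'1 t; move: (\sum_(i in t) w' i) near' => s h1 h2 h3.
    have : (1 - s) ^+ 2 <= 1 * eta by rewrite expr2; apply: ler_pM; lra.
    lra.
  have sub_t i : i \in t -> i != f by apply: contraTneq => ->.
  have [et|et] := boolP (e \in t); last first.
    rewrite (eq_bigr w') => [|i it]; first by apply: le_trans near'; lra.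
    by rewrite w'i ?sub_t //; apply: contraTneq it => ->.
  (* Outside t only f may carry much of the original weight. Every other line has two points outside
     t, one of which is not f, so these lines contribute at most eta. This gives a mass of at least
     1 - 28 eta on t, enough for [near_extremal_gap]. *)
  have out : \sum_(i in ~: t :\ f) w i <= eta.
    apply: (@le_trans _ _ (\sum_(i in ~: t) w' i)).
      rewrite [leRHS](big_setD1 f) ?inE //= w'f add0r le_eqVlt; apply/orP; left;
        apply/eqP.
      apply: eq_bigr => i; rewrite !inE => /andP[i_f it]; rewrite w'i //.
      by apply: contraNneq it => ->.
    by apply: le_trans (outside_mass w'1 t) _; lra.
  have : \sum_(t' in L :\ t) \prod_(i in t') w i <= 1 * eta.
    apply: le_trans (ler_pM _ _ (sum_in_le1 w0 w1 (~: t)) out); try exact: sumr_ge0.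
    apply: lines_pair_bound => //; first exact: subD1set.
    move=> t' /setD1P[ne t'L].
    have [b [c [bt ct bc bt' ct']]] := outside_pair tL t'L ne.
    have [cf|cf] := eqVneq c f.
      by exists c, b; rewrite !inE bt ct -cf bc eq_sym bc.
    by exists b, c; rewrite !inE bt ct cf.
  have := line_prod_le w0 tL; have := line_polyD1 w tL.
  have := sum_in_le1 w0 w1 t; have : 0 <= \sum_(i in t) w i by exact: sumr_ge0.
  move: (\sum_(i in t) w i) => s s0 s1 h1 h2 h3.
  have : s ^+ 3 <= s by rewrite exprS ler_piMr // expr_le1.
  lra.
(* Now any two points of the support are collinear, so by [far_point] a line with nonzero product
   carries the whole weight. *)
move=> none.
have cohab e f : w e != 0 -> w f != 0 -> e != f ->
    exists2 t, t \in L & (e \in t) && (f \in t).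
  move=> we wf ef; apply/exists_inP; apply: contraNT none => noef.
  apply/existsP; exists e; apply/existsP; exists f; rewrite we wf ef andbT /=.
  by rewrite -negb_exists_in.
have [t /andP[tL tw]] : exists t, (t \in L) && (\prod_(i in t) w i != 0).
  apply/existsP; rewrite -[X in is_true X]negbK; apply/negP => /existsPn no.
  have P0 : line_poly w = 0.
    apply: big1 => t tL; apply/eqP; have := no t; rewrite tL /=.
    by rewrite negbK.
  by move: big; rewrite P0 mulr0; lra.
exists t => //.
have wt i : i \in t -> w i != 0.
  by move=> it; apply: contraNneq tw => wi0; rewrite (big_setD1 i) //= wi0 mul0r.
have out0 : \sum_(i in ~: t) w i = 0.
  apply: big1 => g; rewrite inE => gt; apply/eqP; apply/negPn/negP => wg.
  have [e et far] := far_point tL (wD g wg) gt.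
  have eg : e != g by apply: contraNneq gt => <-.
  have [t' t'L] := cohab e g (wt e et) wg eg.
  exact/negP/far.
have := line_poly_outside w0 w1 tL; rewrite out0 expr0n addr0 => h1.
have := line_prod_le w0 tL; have := sum_in_le1 w0 w1 t.
have : 0 <= \sum_(i in t) w i by exact: sumr_ge0.
move: (\sum_(i in t) w i) => s s0 s1 h2.
have : s ^+ 3 <= s by rewrite exprS ler_piMr // expr_le1.
lra.
Qed.
End LinearTripleSystem.

Local Close Scope ring_scope.

(** * Hexagons and the leading term *)

Lemma card_cover_sum (S T : finType) (X : {set S}) (P : {set T}) (F : T -> {set S}) :
  (forall x, x \in X -> exists2 t, t \in P & x \in F t) ->
  #|X| <= \sum_(t in P) #|F t|.
Proof.
move=> cover.
have sub : X \subset \bigcup_(t in P) F t.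
  by apply/subsetP => x /cover[t tP xF]; apply/bigcupP; exists t.
apply: leq_trans (subset_leq_card sub) _.
elim/big_rec2: _ => [|t m A _ IH]; first by rewrite cards0.
by apply: leq_trans (leq_of_leqif (leq_card_setU _ _)) _; rewrite leq_add2l.
Qed.

Lemma card_cover (S T : finType) (X : {set S}) (P : {set T}) (F : T -> {set S}) k :
  (forall x, x \in X -> exists2 t, t \in P & x \in F t) ->
  (forall t, t \in P -> #|F t| <= k) -> #|X| <= #|P| * k.
Proof.
move=> cover bound; apply: leq_trans (card_cover_sum cover) _.
by rewrite -sum_nat_const; apply: leq_sum.
Qed.

Section Hexagons.
Variables (V : finType) (e : rel V).

Definition hex (v0 v1 v2 v3 v4 v5 : V) : bool :=
  [&& uniq [:: v0; v1; v2; v3; v4; v5],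
      [&& e v0 v1, e v1 v2, e v2 v3, e v3 v4, e v4 v5 & e v5 v0] &
      [&& ~~ e v0 v2, ~~ e v0 v3, ~~ e v0 v4, ~~ e v1 v3, ~~ e v1 v4,
          ~~ e v1 v5, ~~ e v2 v4, ~~ e v2 v5 & ~~ e v3 v5]].

Definition set6 (v0 v1 v2 v3 v4 v5 : V) : {set V} :=
  [set x in [:: v0; v1; v2; v3; v4; v5]].

Definition hexes : {set {set V}} :=
  [set S | [exists v0, exists v1, exists v2, exists v3, exists v4, exists v5,
     hex v0 v1 v2 v3 v4 v5 && (S == set6 v0 v1 v2 v3 v4 v5)]].

Lemma hexesP S : reflect
  (exists v0 v1 v2 v3 v4 v5, hex v0 v1 v2 v3 v4 v5 /\ S = set6 v0 v1 v2 v3 v4 v5)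
  (S \in hexes).
Proof.
rewrite inE; apply: (iffP idP).
  case/existsP=> v0 /existsP[v1 /existsP[v2 /existsP[v3 /existsP[v4 /existsP[v5]]]]].
  by move=> /andP[h /eqP E]; exists v0, v1, v2, v3, v4, v5.
case=> v0 [v1 [v2 [v3 [v4 [v5 [h ->]]]]]].
apply/existsP; exists v0; apply/existsP; exists v1; apply/existsP; exists v2.
apply/existsP; exists v3; apply/existsP; exists v4; apply/existsP; exists v5.
by rewrite h eqxx.
Qed.

Lemma set6_rot v0 v1 v2 v3 v4 v5 :
  set6 v0 v1 v2 v3 v4 v5 = set6 v1 v2 v3 v4 v5 v0.
Proof.
apply/setP => x; rewrite !inE.
by case: (x == v0); case: (x == v1); case: (x == v2); rewrite ?orbT //=;
  rewrite !orbA orbF.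
Qed.

Hypothesis esym : symmetric e.

Lemma hex_rot v0 v1 v2 v3 v4 v5 :
  hex v0 v1 v2 v3 v4 v5 -> hex v1 v2 v3 v4 v5 v0.
Proof.
move=> /and3P[un /and5P[e01 e12 e23 e34 /andP[e45 e50]]].
move=> /and5P[n02 n03 n04 n13 /and5P[n14 n15 n24 n25 n35]].
rewrite /hex -(rot_uniq 5) un e12 e23 e34 e45 e50 e01 n13 n14 n15 n24 n25.
by rewrite (esym v2) n02 n35 (esym v3) n03 (esym v4) n04.
Qed.

Lemma hex_rev v0 v1 v2 v3 v4 v5 :
  hex v0 v1 v2 v3 v4 v5 -> hex v5 v4 v3 v2 v1 v0.
Proof.
move=> /and3P[un /and5P[e01 e12 e23 e34 /andP[e45 e50]]].
move=> /and5P[n02 n03 n04 n13 /and5P[n14 n15 n24 n25 n35]].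
rewrite /hex -(rev_uniq [:: v0; v1; v2; v3; v4; v5]) in un *; rewrite un.
rewrite (esym v5 v4) (esym v4 v3) (esym v3 v2) (esym v2 v1) (esym v1 v0) (esym v0 v5).
rewrite (esym v5 v3) (esym v5 v2) (esym v5 v1) (esym v4 v2) (esym v4 v1) (esym v4 v0).
rewrite (esym v3 v1) (esym v3 v0) (esym v2 v0).
rewrite e01 e12 e23 e34 e45 e50.
by rewrite n02 n03 n04 n13 n14 n15 n24 n25 n35.
Qed.
End Hexagons.

Section MainTerm.
Variables (V : finType) (e : rel V) (D : nat).
Hypotheses (es : symmetric e) (ei : irreflexive e) (vk : van_kampen e).

Definition big_vertices : {set V} := [set v | D <= #|nbrs e [set: V] v|].
Local Notation B := big_vertices.

Definition small_over (f : {set V}) : {set V} :=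
  [set v in ~: B | nbrs e B v == f].

Definition pairs_in (Z : {set V}) : {set {set V}} :=
  [set f : {set V} | (#|f| == 2) && (f \subset Z)].

Definition arcs (W : {set V}) : {set V * V} :=
  [set p | [&& p.1 \in W, p.2 \in W & e p.1 p.2]].

Lemma card_arcs W : #|arcs W| <= 14 * #|W|.
Proof.
apply: leq_trans (planar_degsum W es ei vk).
pose F (u : V) : {set V * V} := [set (u, v) | v in nbrs e W u].
rewrite /degsum; apply: leq_trans (card_cover_sum (P := W) (F := F) _) _.
  move=> [u v]; rewrite inE /= => /and3P[uW vW euv]; exists u => //.
  by apply/imsetP; exists v; rewrite // inE vW.
by apply: leq_sum => u _; apply: leq_imset_card.
Qed.

Lemma card_big : #|B| * D <= 14 * #|V|.
Proof.
rewrite -cardsT; apply: leq_trans (planar_degsum [set: V] es ei vk).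
rewrite -sum_nat_const [leqRHS](bigID (mem B)) /=.
apply: leq_trans (leq_addr _ _); rewrite [leqRHS](eq_bigl (fun v => v \in B)) => [|v];
  last by rewrite in_setT.
by apply: leq_sum => v; rewrite inE.
Qed.

Lemma pairs_in3 x y z : uniq [:: x; y; z] ->
  pairs_in [set x; y; z] = [set [set x; y]; [set y; z]; [set x; z]].
Proof.
rewrite /= !inE negb_or => /and3P[/andP[xy xz] yz _].
apply/setP => f; rewrite !inE; apply/andP/idP.
  move=> [/cards2P[a [b [ab ->]]]]; rewrite subUset !sub1set !inE.
  move=> /andP[/orP[/orP[]|] /eqP Ea /orP[/orP[]|] /eqP Eb]; subst a b;
    rewrite ?eqxx ?orbT // ?(setUC [set z]) ?(setUC [set y] [set x]) ?eqxx ?orbT //;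
    by rewrite eqxx in ab.
move=> /orP[/orP[]|] /eqP->; rewrite cards2 ?xy ?yz ?xz;
  by split=> //; rewrite subUset !sub1set !inE !eqxx ?orbT.
Qed.

Lemma pairs3_neq (x y z : V) : uniq [:: x; y; z] ->
  [/\ [set x; y] != [set y; z], [set x; y] != [set x; z] & [set y; z] != [set x; z]].
Proof.
rewrite /= !inE negb_or => /and3P[/andP[xy xz] yz _]; split; apply/eqP.
- by move=> /setP/(_ x); rewrite !inE eqxx (negPf xy) (negPf xz).
- by move=> /setP/(_ y); rewrite !inE eqxx orbT eq_sym (negPf xy) (negPf yz).
- by move=> /setP/(_ x); rewrite !inE eqxx (negPf xy) (negPf xz).
Qed.

Lemma disjoint_small_over f g v :
  v \in small_over f -> v \in small_over g -> f = g.
Proof. by rewrite !inE => /andP[_ /eqP <-] /andP[_ /eqP]. Qed.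

Lemma sum_small_over : \sum_(f : {set V}) #|small_over f| <= #|V|.
Proof.
rewrite -cardsT -sum1_card (partition_big (nbrs e B) predT) //=.
apply: leq_sum => f _; rewrite sum1_card; apply: subset_leq_card.
by apply/subsetP => v; rewrite inE => /andP[_ vf]; rewrite unfold_in /= in_setT.
Qed.

Definition main_hexes (Z : {set V}) : {set {set V}} :=
  [set S in hexes e | (S :&: B == Z) &&
                      [forall f in pairs_in Z, S :&: small_over f != set0]].

(** The classes of the three pairs are disjoint from each other and from [Z], so one vertex from
    each of them together with [Z] already makes six vertices: the hexagon is determined by its
    small vertices. *)
Lemma card_main_hexes (Z : {set V}) : #|Z| = 3 ->
  #|main_hexes Z| <= \prod_(f in pairs_in Z) #|small_over f|.
Proof.
move=> Z3; have /card_gt0P[x xZ] : 0 < #|Z| by rewrite Z3.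
have : #|Z :\ x| == 2 by move: Z3; rewrite (cardsD1 x) xZ add1n => -[->].
move=> /cards2P[y [z [yz ZE]]].
have yZ : y \in Z :\ x by rewrite ZE !inE eqxx.
have zZ : z \in Z :\ x by rewrite ZE !inE eqxx orbT.
have un : uniq [:: x; y; z].
  move: yZ zZ; rewrite !inE => /andP[yx _] /andP[zx _].
  by rewrite /= !inE negb_or yz (eq_sym x) yx eq_sym zx.
have {ZE} ZE : Z = [set x; y; z] by rewrite -(setD1K xZ) ZE setUA.
have [n1 n2 n3] := pairs3_neq un.
have pairsE := pairs_in3 un; rewrite -ZE in pairsE.
rewrite pairsE -setUA big_setU1 ?inE ?negb_or ?n1 ?n2 //=.
rewrite big_setU1 ?inE //= big_set1.
pose g (p : V * (V * V)) : {set V} := Z :|: [set p.1; p.2.1; p.2.2].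
rewrite -!cardsX; apply: leq_trans (leq_imset_card g _).
apply: subset_leq_card; apply/subsetP => S; rewrite inE.
move=> /and3P[/hexesP[v0 [v1 [v2 [v3 [v4 [v5 [/and3P[unv _ _] SE]]]]]]]].
move=> /eqP SB /forall_inP meet.
have S6 : #|S| = 6 by rewrite SE cardsE (card_uniqP unv).
have pick_small f : f \in pairs_in Z -> exists2 a, a \in S & a \in small_over f.
  by move=> /meet/set0Pn[a]; rewrite inE => /andP[aS af]; exists a.
have [a aS am] : exists2 a, a \in S & a \in small_over [set x; y].
  by apply: pick_small; rewrite pairsE !inE eqxx.
have [b bS bm] : exists2 a, a \in S & a \in small_over [set y; z].
  by apply: pick_small; rewrite pairsE !inE eqxx ?orbT.
have [c cS cm] : exists2 a, a \in S & a \in small_over [set x; z].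
  by apply: pick_small; rewrite pairsE !inE eqxx ?orbT.
apply/imsetP; exists (a, (b, c)); first by rewrite !in_setX am bm cm.
apply/eqP; rewrite eq_sym eqEcard; apply/andP; split.
  rewrite subUset -{1}SB subsetIl /=; apply/subsetP => u.
  by rewrite !inE => /orP[/orP[]|] /eqP->.
have ab : a != b by apply: contraNneq n1 => ab; rewrite ab in am;
  rewrite (disjoint_small_over am bm).
have ac : a != c by apply: contraNneq n2 => ac; rewrite ac in am;
  rewrite (disjoint_small_over am cm).
have bc : b != c by apply: contraNneq n3 => bc; rewrite bc in bm;
  rewrite (disjoint_small_over bm cm).
rewrite S6 /g /= cardsU Z3 (_ : Z :&: _ = set0) ?cards0 ?subn0.
  by rewrite -setUA !cardsU1 !inE cards1 negb_or ab ac bc.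
apply/setP => u; rewrite !inE; apply/negP => /andP[uZ].
have uB : u \in B by move: uZ; rewrite -SB inE => /andP[].
have notB v f : v \in small_over f -> v \notin B by rewrite inE in_setC => /andP[].
by move=> /orP[/orP[]|] /eqP ?; subst u; [move: am|move: bm|move: cm] => /notB;
  rewrite uB.
Qed.

(* A hexagon with two consecutive small vertices falls under the second term; one
   with two consecutive big vertices, or with a small vertex having three big
   neighbours, under the third; the others are counted by the sum. *)
Lemma card_hexes_le :
  #|hexes e| <= \sum_(Z : {set V} | #|Z| == 3) \prod_(f in pairs_in Z) #|small_over f|
    + (14 * #|V|) ^ 2 * D ^ 2 + 14 * 1185 * #|B| * (14 * #|V|) ^ 2.
Proof.
pose T := [set v in ~: B | 2 < #|nbrs e B v|].
pose A := arcs [set: V].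
have cA : #|A| <= 14 * #|V| by rewrite -cardsT; apply: card_arcs.
(* Given an arc of two small vertices and the opposite arc, the other two vertices are neighbours of
   the small ones, with fewer than [D] choices each. *)
pose F1 (t : (V * V) * (V * V)) : {set {set V}} :=
  [set set6 t.1.1 t.1.2 p.1 t.2.1 t.2.2 p.2 |
     p in setX (nbrs e [set: V] t.1.2) (nbrs e [set: V] t.1.1)].
pose X1 := \bigcup_(t in setX (arcs (~: B)) A) F1 t.
pose f3 (t : (V * V) * ((V * V) * (V * V))) : {set V} :=
  set6 t.1.1 t.1.2 t.2.1.1 t.2.1.2 t.2.2.1 t.2.2.2.
pose X2 := f3 @: setX (arcs B) (setX A A).
pose X3 := f3 @: setX (arcs (B :|: T)) (setX A A).
pose X4 := \bigcup_(Z : {set V} | #|Z| == 3) main_hexes Z.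
have cX1 : #|X1| <= (14 * #|V|) ^ 2 * D ^ 2.
  have h := @card_cover _ _ X1 (setX (arcs (~: B)) A) F1 (D ^ 2).
  apply: leq_trans (h _ _) _.
  - by move=> S /bigcupP[t tP SF]; exists t.
  - move=> [[v0 v1] [v3 v4]]; rewrite !inE /= => /andP[/and3P[v0B v1B _] _].
    apply: leq_trans (leq_imset_card _ _) _; rewrite cardsX -mulnn.
    by rewrite -!ltnNge in v0B v1B; apply: leq_mul; apply: ltnW.
  rewrite leq_mul2r cardsX -mulnn; apply/orP; right; apply: leq_mul => //.
  by apply: leq_trans (card_arcs _) _; rewrite leq_mul2l max_card orbT.
(* A hexagon is covered by three disjoint arcs, each with linearly many choices, and the first lies
   in a set of size linear in [#|B|]. The sets B and B :|: T together give the factor 1 + (1 + 1183)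
   = 1185. *)
have cf3 (W : {set V}) : #|f3 @: setX (arcs W) (setX A A)| <= 14 * #|W| * (14 * #|V|) ^ 2.
  apply: leq_trans (leq_imset_card _ _) _; rewrite !cardsX -mulnn.
  by apply: leq_mul; [exact: card_arcs|exact: leq_mul].
have cT : #|T| <= 1183 * #|B|.
  apply: (three_nbrs_card es ei vk) => [|t]; last by rewrite inE => /andP[].
  rewrite disjoint_subset; apply/subsetP => v vB.
  by rewrite 3!inE vB.
have cX4 : #|X4| <= \sum_(Z : {set V} | #|Z| == 3) \prod_(f in pairs_in Z) #|small_over
  f|.
  have h := @card_cover_sum _ _ X4 [set Z : {set V} | #|Z| == 3] main_hexes.
  apply: leq_trans (h _) _.
    by move=> S /bigcupP[Z Z3 SZ]; exists Z => //; rewrite in_set.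
  rewrite (eq_bigl (fun Z : {set V} => #|Z| == 3)) => [|Z]; last by rewrite in_set.
  by apply: leq_sum => Z /eqP; apply: card_main_hexes.
suff sub : hexes e \subset X4 :|: X1 :|: (X2 :|: X3).
  apply: leq_trans (subset_leq_card sub) _.
  apply: leq_trans (leq_of_leqif (leq_card_setU _ _)) _; apply: leq_add.
    by apply: leq_trans (leq_of_leqif (leq_card_setU _ _)) _; apply: leq_add.
  apply: leq_trans (leq_of_leqif (leq_card_setU _ _)) _.
  apply: leq_trans (leq_add (cf3 _) (cf3 _)) _; rewrite -mulnDl leq_mul2r.
  apply/orP; right; rewrite -mulnDr -mulnA leq_mul2l /=.
  have : #|B :|: T| <= #|B| + #|T| := leq_of_leqif (leq_card_setU _ _).
  by move: cT; clear; lia.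
apply/subsetP => S SH; have /hexesP[v0 [v1 [v2 [v3 [v4 [v5 [hx SE]]]]]]] := SH.
have inA a b : (a, b) \in A = e a b by rewrite !inE.
have same u0 u1 u2 u3 u4 u5 : hex e u0 u1 u2 u3 u4 u5 -> S = set6 u0 u1 u2 u3 u4 u5 ->
    (u0 \in B) = (u1 \in B) -> S \in X4 :|: X1 :|: (X2 :|: X3).
  move=> /and3P[_ /and5P[e01 e12 e23 e34 /andP[e45 e50]] _] SE' bb.
  have [b0|b0] := boolP (u0 \in B); rewrite ?b0 ?(negPf b0) in bb.
    rewrite 3!inE; apply/orP; right; apply/orP; left; apply/imsetP.
    exists ((u0, u1), ((u2, u3), (u4, u5))); last exact: SE'.
    by rewrite !in_setX !inA e23 e45 inE /= b0 -bb e01.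
  rewrite 2!inE; apply/orP; left; apply/orP; right; apply/bigcupP.
  exists ((u0, u1), (u3, u4)).
    by rewrite in_setX inA e34 inE /= !in_setC b0 -bb e01.
  apply/imsetP; exists (u2, u5); last exact: SE'.
  by rewrite in_setX !inE /= e12 es e50.
have alternate u0 u1 u2 u3 u4 u5 : hex e u0 u1 u2 u3 u4 u5 ->
    S = set6 u0 u1 u2 u3 u4 u5 ->
    [&& u0 \in B, u1 \notin B, u2 \in B, u3 \notin B, u4 \in B & u5 \notin B] ->
    S \in X4 :|: X1 :|: (X2 :|: X3).
  move=> hu SU /and5P[b0 b1 b2 b3 /andP[b4 b5]].
  have three w0 w1 w2 w3 w4 w5 : hex e w0 w1 w2 w3 w4 w5 ->
      S = set6 w0 w1 w2 w3 w4 w5 -> w0 \in B -> w1 \in T ->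
      S \in X4 :|: X1 :|: (X2 :|: X3).
    move=> /and3P[_ /and5P[e01 e12 e23 e34 /andP[e45 e50]] _] SE' w0B w1T.
    rewrite 3!inE; apply/orP; right; apply/orP; right; apply/imsetP.
    exists ((w0, w1), ((w2, w3), (w4, w5))); last exact: SE'.
    by rewrite !in_setX !inA e23 e45 inE /= !in_setU w0B w1T orbT e01.
  have h2 := hex_rot es (hex_rot es hu).
  have h4 := hex_rot es (hex_rot es h2).
  have S2 : S = set6 u2 u3 u4 u5 u0 u1 by rewrite SU !(set6_rot u0) (set6_rot u1).
  have S4 : S = set6 u4 u5 u0 u1 u2 u3 by rewrite S2 !(set6_rot u2) (set6_rot u3).
  have [t1|t1] := boolP (u1 \in T); first exact: (three _ _ _ _ _ _ hu SU).
  have [t3|t3] := boolP (u3 \in T); first exact: (three _ _ _ _ _ _ h2 S2).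
  have [t5|t5] := boolP (u5 \in T); first exact: (three _ _ _ _ _ _ h4 S4).
  have over a b c : a \in B -> c \in B -> b \notin B -> b \notin T -> a != c ->
      e a b -> e b c -> b \in small_over [set a; c].
    move=> aB cB bB; rewrite inE in_setC bB /= -leqNgt => le ac eab ebc.
    rewrite inE in_setC bB /= eq_sym eqEcard cards2 ac le andbT.
    by rewrite subUset !sub1set ![_ \in nbrs _ _ _]in_set aB cB (es b a) eab ebc.
  have uS : [/\ u1 \in S, u3 \in S & u5 \in S] by rewrite SU !inE !eqxx !orbT.
  have [u1S u3S u5S] := uS.
  move: (hu) => /and3P[un /and5P[e01 e12 e23 e34 /andP[e45 e50]] _].
  have [n02 n24 n04] : [/\ u0 != u2, u2 != u4 & u0 != u4].
    by move: un; rewrite /= !inE !negb_or -!andbA; do ![case/andP=> ?]; move=> *; split.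
  have m1 : u1 \in small_over [set u0; u2] by apply: over.
  have m3 : u3 \in small_over [set u2; u4] by apply: over.
  have m5 : u5 \in small_over [set u0; u4] by apply: over; rewrite // es.
  rewrite 2!inE; apply/orP; left; apply/orP; left; apply/bigcupP.
  have un3 : uniq [:: u0; u2; u4] by rewrite /= !inE negb_or n02 n04 n24.
  exists [set u0; u2; u4].
    by rewrite -setUA !cardsU1 !inE cards1 negb_or n02 n04 n24.
  rewrite in_set SH /=; apply/andP; split.
    rewrite eqEsubset; apply/andP; split; apply/subsetP => v.
      rewrite SU in_setI in_set !in_cons in_nil orbF => /andP[vu vB].
      move: vu; do 5?[case/predU1P => [vE|]]; try move/eqP=> vE;
        by subst v; rewrite ?in_setU ?in_set1 ?eqxx ?orbT //; move: vB;
          rewrite ?(negPf b1) ?(negPf b3) ?(negPf b5).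
    rewrite !in_setU !in_set1 SU in_setI in_set !in_cons.
    by case/orP=> [/orP[]|] /eqP->; rewrite eqxx ?orbT ?b0 ?b2 ?b4.
  apply/forall_inP => f; rewrite pairs_in3 // !inE.
  by move=> /orP[/orP[]|] /eqP->; apply/set0Pn; [exists u1|exists u3|exists u5];
    apply/setIP.
have [b01|b01] := eqVneq (v0 \in B) (v1 \in B); first exact: (same _ _ _ _ _ _ hx SE).
have h1 := hex_rot es hx; have S1 : S = set6 v1 v2 v3 v4 v5 v0 by rewrite SE set6_rot.
have [b12|b12] := eqVneq (v1 \in B) (v2 \in B); first exact: (same _ _ _ _ _ _ h1 S1).
have h2 := hex_rot es h1; have S2 : S = set6 v2 v3 v4 v5 v0 v1 by rewrite S1 set6_rot.
have [b23|b23] := eqVneq (v2 \in B) (v3 \in B); first exact: (same _ _ _ _ _ _ h2 S2).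
have h3 := hex_rot es h2; have S3 : S = set6 v3 v4 v5 v0 v1 v2 by rewrite S2 set6_rot.
have [b34|b34] := eqVneq (v3 \in B) (v4 \in B); first exact: (same _ _ _ _ _ _ h3 S3).
have h4 := hex_rot es h3; have S4 : S = set6 v4 v5 v0 v1 v2 v3 by rewrite S3 set6_rot.
have [b45|b45] := eqVneq (v4 \in B) (v5 \in B); first exact: (same _ _ _ _ _ _ h4 S4).
have [v0B|v0B] := boolP (v0 \in B).
  apply: (alternate _ _ _ _ _ _ hx SE); move: b01 b12 b23 b34 b45; rewrite v0B.
  by do 5!case: (_ \in B).
apply: (alternate _ _ _ _ _ _ h1 S1); move: b01 b12 b23 b34 b45; rewrite (negPf v0B).
by do 5!case: (_ \in B).
Qed.
End MainTerm.

Lemma pairs_in_union (V : finType) (Z f g : {set V}) : #|Z| = 3%N -> f != g ->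
  f \in pairs_in Z -> g \in pairs_in Z -> f :|: g = Z.
Proof.
move=> Z3 fg; rewrite !inE => /andP[/eqP f2 fZ] /andP[/eqP g2 gZ].
apply/eqP; rewrite eqEcard subUset fZ gZ Z3 /= cardsU f2 g2.
have : #|f :&: g| < 2.
  rewrite ltnNge; apply: contra fg => le.
  rewrite eqEcard f2 g2 andbT.
  have /eqP <- : f :&: g == f by rewrite eqEcard subsetIl f2.
  exact: subsetIr.
lia.
Qed.

Lemma set3_elements (V : finType) (Z : {set V}) : #|Z| = 3%N ->
  exists x y z, uniq [:: x; y; z] /\ Z = [set x; y; z].
Proof.
move=> Z3; have /card_gt0P[x xZ] : 0 < #|Z| by rewrite Z3.
have : #|Z :\ x| == 2 by move: Z3; rewrite (cardsD1 x) xZ add1n => -[->].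
move=> /cards2P[y [z [yz ZE]]]; exists x, y, z; split.
  have : y \in Z :\ x by rewrite ZE !inE eqxx.
  have : z \in Z :\ x by rewrite ZE !inE eqxx orbT.
  rewrite !inE => /andP[zx _] /andP[yx _].
  by rewrite /= !inE negb_or yz (eq_sym x) yx eq_sym zx.
by rewrite -(setD1K xZ) ZE setUA.
Qed.

Definition triads (V : finType) : {set {set {set V}}} :=
  [set pairs_in Z | Z : {set V} in [set Z : {set V} | #|Z| == 3]].

Section Triads.
Variable V : finType.

Lemma card_triad : {in triads V, forall t : {set {set V}}, #|t| = 3%N}.
Proof.
move=> t /imsetP[Z]; rewrite inE => /eqP/set3_elements[x [y [z [un ->]]]] ->.
have [n1 n2 n3] := pairs3_neq un.
by rewrite pairs_in3 // -setUA !cardsU1 !inE cards1 negb_or n1 n2 n3.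
Qed.

Lemma triads_linear : {in triads V &, forall (t t' : {set {set V}}) f g, f != g ->
  f \in t -> g \in t -> f \in t' -> g \in t' -> t = t'}.
Proof.
move=> t t' /imsetP[Z + ->] /imsetP[Z' + ->] f g fg fZ gZ fZ' gZ'.
rewrite !inE => /eqP Z3 /eqP Z'3.
by rewrite -(pairs_in_union Z3 fg fZ gZ) -(pairs_in_union Z'3 fg fZ' gZ').
Qed.

(** A pair not inside [Z] leaves two vertices of [Z] uncovered. They form a pair disjoint from it,
    and two disjoint pairs do not fit into three vertices. *)
Lemma triads_far : {in triads V & [set f : {set V} | #|f| == 2],
  forall (t : {set {set V}}) g, g \notin t ->
  exists2 f, f \in t & {in triads V, forall t' : {set {set V}}, ~~ ((f \in t') && (g
    \in t'))}}.
Proof.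
move=> t g /imsetP[Z + ->]; rewrite !inE => /eqP Z3 g2 gZ; rewrite g2 /= in gZ.
have gZ1 : #|g :&: Z| < 2.
  rewrite ltnNge; apply: contra gZ => le.
  have /eqP <- : g :&: Z == g by rewrite eqEcard subsetIl (eqP g2).
  exact: subsetIr.
have /card_gt1P[x [y [xD yD xy]]] : 1 < #|Z :\: g|.
  by rewrite cardsD Z3 setIC; lia.
move: xD yD; rewrite !inE => /andP[xg xZ] /andP[yg yZ].
exists [set x; y]; first by rewrite inE cards2 xy subUset !sub1set xZ yZ.
move=> t' /imsetP[Z' + ->]; rewrite !inE => /eqP Z'3; apply/negP.
move=> /andP[/andP[_ +] /andP[_ gZ']]; rewrite subUset !sub1set => /andP[xZ' yZ'].
have : #|[set x; y] :|: g| <= #|Z'|.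
  by apply: subset_leq_card; rewrite !subUset !sub1set xZ' yZ'.
rewrite Z'3 cardsU cards2 xy (eqP g2).
have -> : [set x; y] :&: g = set0; last by rewrite cards0.
apply/setP => v; rewrite !inE; apply/negP => /andP[/orP[] /eqP-> vg].
  by rewrite vg in xg.
by rewrite vg in yg.
Qed.
End Triads.

Local Open Scope ring_scope.

Lemma triads_poly (V : finType) (F : realFieldType) (w : {set V} -> F) :
  line_poly (triads V) w = \sum_(Z : {set V} | #|Z| == 3%N) \prod_(f in pairs_in Z) w f.
Proof.
rewrite /line_poly /triads big_imset /=.
  by apply: eq_bigl => Z; rewrite in_set.
move=> Z Z'; rewrite !in_set => /eqP Z3 /eqP Z'3 E.
have [x [y [z [un ZE]]]] := set3_elements Z3; have [n1 _ _] := pairs3_neq un.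
have f1 : [set x; y] \in pairs_in Z by rewrite ZE pairs_in3 // !inE eqxx.
have f2 : [set y; z] \in pairs_in Z by rewrite ZE pairs_in3 // !inE eqxx orbT.
rewrite -(pairs_in_union Z3 n1 f1 f2); apply: pairs_in_union; by rewrite // -E.
Qed.

Local Close Scope ring_scope.

(** In contrast to [small_over], this depends only on the three hubs and not on a degree threshold.
    The vertex z is excluded explicitly because it may itself be adjacent to x and y. *)
Definition between (V : finType) (e : rel V) (x y z : V) : {set V} :=
  [set v | [&& v != z, e v x, e v y & ~~ e v z]].

Lemma hexes_leading_bound : exists c : nat, forall (V : finType) (e : rel V) D,
  symmetric e -> irreflexive e -> van_kampen e ->
  #|hexes e| <= \sum_(Z : {set V} | #|Z| == 3)
                  \prod_(f in pairs_in Z) #|small_over e D f|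
     + 196 * #|V| ^ 2 * D ^ 2 + c * #|big_vertices e D| * #|V| ^ 2.
Proof.
exists (14 * 1185 * 14 ^ 2) => V e D es ei vk.
apply: leq_trans (card_hexes_le D es ei vk) _.
rewrite !expnMn -[14 ^ 2]/196 leq_add2l.
by move: (14 * 1185) => c; rewrite -!mulnA leq_mul2l; nia.
Qed.

(** Multiplied by 27 K, the term with b and the terms with n^2 cost at most n^3 / 2 each, so
    together they use up one of the K copies of n^3. *)
Lemma leading_arith (n h P b c d K : nat) :
  n ^ 3 <= 27 * h + 27 * n ^ 2 -> h <= P + 196 * n ^ 2 * d ^ 2 + c * b * n ^ 2 ->
  2 * (27 * K * c * b) <= n -> 2 * (27 * K * (196 * d ^ 2 + 1)) <= n ->
  (K - 1) * n ^ 3 <= 27 * K * P.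
Proof.
case: K => [|k]; first by rewrite mul0n.
rewrite subn1 /= => many lead c1 c2.
have c3 : 2 * (27 * k.+1 * c * b) * n ^ 2 <= n * n ^ 2 by rewrite leq_mul2r c1 orbT.
have c4 : 2 * (27 * k.+1 * (196 * d ^ 2 + 1)) * n ^ 2 <= n * n ^ 2.
  by rewrite leq_mul2r c2 orbT.
have c5 : k.+1 * n ^ 3 <= k.+1 * (27 * h + 27 * n ^ 2) by rewrite leq_mul2l many orbT.
have c6 : k.+1 * h <= k.+1 * (P + 196 * n ^ 2 * d ^ 2 + c * b * n ^ 2).
  by rewrite leq_mul2l lead orbT.
rewrite (expnS n 2) in c5 *; move: (n ^ 2) (d ^ 2) c3 c4 c5 c6 => m d2; clear; nia.
Qed.

(** Stability is applied to the weights [#|M f|] / n with eta = 1/K. The assumed number of hexagons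
    is the extremal one up to a quadratic error. *)
Lemma hub_structure (K : nat) : 1200 <= K -> exists n0 : nat,
  forall (V : finType) (e : rel V),
  symmetric e -> irreflexive e -> van_kampen e -> n0 <= #|V| ->
  #|V| ^ 3 <= 27 * #|hexes e| + 27 * #|V| ^ 2 ->
  exists x y z,
   [/\ uniq [:: x; y; z],
       K * #|V| <= #|V| + K * (#|between e x y z| + #|between e y z x| + #|between e z
         x y|) &
       [/\ #|V| <= 20 * #|between e x y z|, #|V| <= 20 * #|between e y z x| &
           #|V| <= 20 * #|between e z x y|]].
Proof.
move=> K1200; have [c lead] := hexes_leading_bound.
have [F _] : exists F : realFieldType, True by exists rat.
(* With [card_big] this makes 27 K c times the number of big vertices at most n / 2. *)
pose D := 2 * 27 * 14 * c * K.
exists (2 * (27 * K * (196 * D ^ 2 + 1)) + 1) => V e es ei vk.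
set n := #|V| => nlarge many.
pose M := small_over e D; pose B := big_vertices e D.
have bD : #|B| * D <= 14 * n := card_big D es ei vk.
have n0 : 0 < n by apply: leq_trans nlarge; rewrite addn1.
pose P := \sum_(Z : {set V} | #|Z| == 3) \prod_(f in pairs_in Z) #|M f|.
have lead1 : #|hexes e| <= P + 196 * n ^ 2 * D ^ 2 + c * #|B| * n ^ 2 := lead V e D es
  ei vk.
have big : (K - 1) * n ^ 3 <= 27 * K * P.
  have c1 : 2 * (27 * K * c * #|B|) <= n.
    move: bD; rewrite /D; move: #|B| => b; clear; nia.
  have c2 : 2 * (27 * K * (196 * D ^ 2 + 1)) <= n by clear -nlarge; lia.
  exact: leading_arith many lead1 c1 c2.
have sumM : \sum_(f : {set V}) #|M f| <= n := sum_small_over e D.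
pose w (f : {set V}) : F := (if #|f| == 2 then #|M f|%:R / n%:R else 0)%R.
have nR : (0 < n%:R :> F)%R by rewrite ltr0n.
have w0 f : (0 <= w f)%R by rewrite /w; case: ifP => // _; rewrite divr_ge0.
have w1 : (\sum_f w f <= 1)%R.
  apply: (@le_trans _ _ (\sum_(f : {set V}) #|M f|%:R / n%:R)%R).
    by apply: ler_sum => f _; rewrite /w; case: ifP => // _; rewrite divr_ge0.
  by rewrite -mulr_suml -natr_sum ler_pdivrMr // mul1r ler_nat.
have wD f : (w f != 0)%R -> f \in [set f : {set V} | #|f| == 2].
  by rewrite inE /w; case: ifP => //; rewrite eqxx.
have polyE : (line_poly (triads V) w = P%:R / n%:R ^+ 3)%R.
  rewrite triads_poly natr_sum mulr_suml; apply: eq_bigr => Z /eqP Z3.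
  have [x [y [z [un ->]]]] := set3_elements Z3; have [d1 d2 d3] := pairs3_neq un.
  rewrite pairs_in3 // prod_set3 //.
  rewrite -[in RHS]setUA big_setU1 ?inE ?negb_or ?d1 ?d2 //= big_setU1 ?inE //= big_set1.
  move: un; rewrite /= !inE negb_or => /and3P[/andP[xy xz] yz _].
  rewrite /w !cards2 xy xz yz /= !natrM.
  by field; rewrite gt_eqF.
have K0 : (0 < K%:R :> F)%R by rewrite ltr0n; lia.
have eta1 : (K%:R^-1 <= 1 / 1200 :> F)%R.
  have : (1200%:R * K%:R^-1 <= K%:R * K%:R^-1 :> F)%R.
    by rewrite ler_pM2r ?invr_gt0 // ler_nat.
  rewrite divff ?gt_eqF //; lra.
have bigP : (1 - K%:R^-1 <= 27 * (line_poly (triads V) w : F) :> F)%R.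
  rewrite polyE mulrA ler_pdivlMr ?exprn_gt0 //.
  rewrite -(ler_pM2l K0) mulrA mulrBr mulr1 divff ?gt_eqF //.
  rewrite -natrX -[1%R]/(1%:R)%R -natrB; last by lia.
  by rewrite -!natrM ler_nat mulnA [K * 27]mulnC.
have eta0 : (0 < K%:R^-1 :> F)%R by rewrite invr_gt0.
have [t tL near] := line_poly_stability (@card_triad V) (@triads_linear V)
  (@triads_far V) eta0 eta1 w0 w1 wD bigP.
have large : {in t, forall f, (1 / 20 <= w f)%R}.
  by apply: (line_weights_large (@card_triad V) (@triads_linear V)) => //; lra.
have Mlarge f : f \in t -> n <= 20 * #|M f|.
  move=> /large; rewrite /w; case: ifP => _; last by lra.
  rewrite ler_pdivlMr // => le; rewrite -(ler_nat F) natrM; lra.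
case/imsetP: tL near large Mlarge => Z; rewrite in_set => /eqP Z3 ->.
have [x [y [z [un ZE]]]] := set3_elements Z3; have [d1 d2 d3] := pairs3_neq un.
rewrite ZE pairs_in3 // sum_set3 // => near _ Mlarge.
have neB f u : n <= 20 * #|M f| -> u \in f -> u \in B.
  move=> le uf; have /card_gt0P[v] : 0 < #|M f| by move: le n0; clear; lia.
  by rewrite in_set => /andP[_ /eqP E]; move: uf; rewrite -E in_set => /andP[].
have Mxy : n <= 20 * #|M [set x; y]| by apply: Mlarge; rewrite !inE eqxx.
have Myz : n <= 20 * #|M [set y; z]| by apply: Mlarge; rewrite !inE eqxx orbT.
have Mxz : n <= 20 * #|M [set x; z]| by apply: Mlarge; rewrite !inE eqxx !orbT.
have xB : x \in B by apply: neB Mxy _; rewrite !inE eqxx.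
have yB : y \in B by apply: neB Mxy _; rewrite !inE eqxx orbT.
have zB : z \in B by apply: neB Mxz _; rewrite !inE eqxx orbT.
have sub a b c' : a \in B -> b \in B -> c' \in B -> c' != a -> c' != b ->
    #|M [set a; b]| <= #|between e a b c'|.
  move=> aB bB cB ca cb; apply: subset_leq_card; apply/subsetP => v.
  rewrite !in_set => /andP[vB /eqP E].
  have memE u : u \in B -> e v u = (u \in [set a; b]).
    by move=> uB; rewrite -E in_set uB.
  rewrite !memE // !inE !eqxx orbT (negPf ca) (negPf cb) /= andbT.
  by apply: contraNneq vB => ->; move: cB; rewrite in_set.
move: un near; rewrite /= !inE negb_or => /and3P[/andP[xy xz] yz _].
rewrite /w !cards2 xy xz yz /= -!mulrDl ler_pdivlMr // => near.
have s1 := sub x y z xB yB zB; rewrite !(eq_sym z) xz yz in s1.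
have s2 := sub y z x yB zB xB xy xz.
have s3 := sub z x y zB xB yB yz; rewrite eq_sym xy setUC in s3.
exists x, y, z; split.
- by rewrite /= !inE negb_or xy xz yz.
- have : K * n <= n + K * (#|M [set x; y]| + #|M [set y; z]| + #|M [set x; z]|).
    rewrite -(ler_pM2l K0) mulrA mulrBr mulr1 divff ?gt_eqF // in near.
    by rewrite -(ler_nat F) natrD !natrM !natrD; lra.
  by move: (s1 isT isT) (s2) (s3 isT); clear; nia.
by split; [move: (s1 isT isT) Mxy|move: s2 Myz|move: (s3 isT) Mxz]; clear; lia.
Qed.

(** * Counting hexagons around three hubs *)

Lemma card_subU (T : finType) (A B C : {set T}) m k :
  A \subset B :|: C -> #|B| <= m -> #|C| <= k -> #|A| <= m + k.
Proof.
move=> sub Bm Ck; apply: leq_trans (subset_leq_card sub) _.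
by apply: leq_trans (leq_of_leqif (leq_card_setU _ _)) _; apply: leq_add.
Qed.

Section Between.
Variables (V : finType) (e : rel V).
Hypotheses (es : symmetric e) (ei : irreflexive e) (vk : van_kampen e).
Implicit Types (x y z v : V).

Lemma adj_neq x y : e x y -> x != y.
Proof. by apply: contraTneq => ->; rewrite ei. Qed.

Lemma card_nbrs_between x y z v : x != y -> v != x -> v != y ->
  #|nbrs e (between e x y z) v| <= 2.
Proof.
move=> xy vx vy; apply: leq_trans (common_nbrs3 es ei vk (x := x) (y := y) (z := v) _).
  apply: subset_leq_card; apply/subsetP => w; rewrite !inE => /andP[/and4P[_ wx wy _] vw].
  by rewrite es wx es wy vw.
by rewrite /= !inE negb_or xy (eq_sym x) vx (eq_sym y) vy.
Qed.

Lemma card_between_nbrs x y z v : x != y -> v != x -> v != y ->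
  #|[set w in between e x y z | e w v]| <= 2.
Proof.
move=> xy vx vy; rewrite (_ : [set w in _ | _] = nbrs e (between e x y z) v).
  exact: card_nbrs_between.
by apply/setP => w; rewrite !inE (es v w).
Qed.

Definition arcs_between (A B : {set V}) : {set V * V} :=
  [set p | [&& p.1 \in A, p.2 \in B & e p.1 p.2]].

(* Contracting three disjoint edges between the two sets gives a K_{3,3} whose
   other side is x, y, z. *)
Lemma no_matching3 x y z a1 a2 a3 b1 b2 b3 : uniq [:: x; y; z] ->
  {subset [:: a1; a2; a3] <= between e x y z} ->
  {subset [:: b1; b2; b3] <= between e y z x} ->
  uniq [:: a1; a2; a3] -> uniq [:: b1; b2; b3] ->
  e a1 b1 -> e a2 b2 -> e a3 b3 -> False.
Proof.
move=> unx sA sB una unb e1 e2 e3.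
have inA a : a \in [:: a1; a2; a3] -> [/\ a != z, e a x, e a y & ~~ e a z].
  by move/sA; rewrite inE => /and4P[].
have inB b : b \in [:: b1; b2; b3] -> [/\ b != x, e b y, e b z & ~~ e b x].
  by move/sB; rewrite inE => /and4P[].
have ab a b : a \in [:: a1; a2; a3] -> b \in [:: b1; b2; b3] -> a != b.
  move=> /inA[_ ax _ _] /inB[_ _ _ nbx]; apply: contraNneq nbx => <-.
  exact: ax.
have ub u b : u \in [:: x; y; z] -> b \in [:: b1; b2; b3] -> u != b.
  move=> + /inB[bx by_ bz _]; rewrite !inE => /or3P[] /eqP->.
  - by rewrite eq_sym.
  - by rewrite eq_sym adj_neq.
  - by rewrite eq_sym adj_neq.
have ua u a : u \in [:: x; y; z] -> a \in [:: a1; a2; a3] -> u != a.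
  move=> + /inA[az ax ay _]; rewrite !inE => /or3P[] /eqP->.
  - by rewrite eq_sym adj_neq.
  - by rewrite eq_sym adj_neq.
  - by rewrite eq_sym.
have m1 (s1 s2 s3 : V) : s1 \in [:: s1; s2; s3] by rewrite inE eqxx.
have m2 (s1 s2 s3 : V) : s2 \in [:: s1; s2; s3] by rewrite !inE eqxx orbT.
have m3 (s1 s2 s3 : V) : s3 \in [:: s1; s2; s3] by rewrite !inE eqxx !orbT.
have a1A := m1 a1 a2 a3; have a2A := m2 a1 a2 a3; have a3A := m3 a1 a2 a3.
have b1B := m1 b1 b2 b3; have b2B := m2 b1 b2 b3; have b3B := m3 b1 b2 b3.
pose f1 := contract e a1 b1; pose f2 := contract f1 a2 b2; pose f3 := contract f2 a3 b3.
have f1s : symmetric f1 := contract_sym es a1 b1.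
have f1i : irreflexive f1 := @contract_irr _ e a1 b1.
have f2s : symmetric f2 := contract_sym f1s a2 b2.
have f2i : irreflexive f2 := @contract_irr _ f1 a2 b2.
have [b12 [b13 b23]] : b1 != b2 /\ b1 != b3 /\ b2 != b3.
  by move: unb; rewrite /= !inE negb_or => /and3P[/andP[-> ->] -> _].
have [a12 [a13 a23]] : a1 != a2 /\ a1 != a3 /\ a2 != a3.
  by move: una; rewrite /= !inE negb_or => /and3P[/andP[-> ->] -> _].
have k1 u v : u != b1 -> v != b1 -> e u v -> f1 u v by move=> ? ? ?; apply: contract_keep.
have k2 u v : u != b2 -> v != b2 -> f1 u v -> f2 u v by move=> ? ? ?;
  apply: contract_keep.
have k3 u v : u != b3 -> v != b3 -> f2 u v -> f3 u v by move=> ? ? ?;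
  apply: contract_keep.
have e2' : f1 a2 b2 by apply: k1 => //; [exact: ab|rewrite eq_sym].
have e3' : f2 a3 b3.
  apply: k2; [exact: ab|by rewrite eq_sym|].
  by apply: k1 => //; [exact: ab|rewrite eq_sym].
have v1 : van_kampen f1 by apply: van_kampen_contract.
have v2 : van_kampen f2 by apply: van_kampen_contract.
have v3 : van_kampen f3 by apply: van_kampen_contract.
have kk1 u v : u \in [:: x; y; z] -> v \in [:: a1; a2; a3] -> e u v -> f1 u v.
  by move=> uU vA euv; apply: k1 => //; [exact: ub|exact: ab].
have kk2 u v : u \in [:: x; y; z] -> v \in [:: a1; a2; a3] -> f1 u v -> f2 u v.
  by move=> uU vA euv; apply: k2 => //; [exact: ub|exact: ab].
have kk3 u v : u \in [:: x; y; z] -> v \in [:: a1; a2; a3] -> f2 u v -> f3 u v.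
  by move=> uU vA euv; apply: k3 => //; [exact: ub|exact: ab].
have kk u v : u \in [:: x; y; z] -> v \in [:: a1; a2; a3] -> e u v -> f3 u v.
  by move=> uU vA euv; apply: kk3 => //; apply: kk2 => //; apply: kk1.
have xU := m1 x y z; have yU := m2 x y z; have zU := m3 x y z.
have z1 : f3 z a1.
  apply: kk3 => //; apply: kk2 => //; rewrite f1s.
  apply: contract_new; [by []|by have [_ _ + _] := inB b1 b1B|exact: ua|exact: ab].
have z2 : f3 z a2.
  apply: kk3 => //; rewrite f2s.
  apply: contract_new; [by []| |exact: ua|exact: ab].
  apply: k1; [by rewrite eq_sym|exact: ub|by have [_ _ + _] := inB b2 b2B].
have z3 : f3 z a3.
  rewrite (contract_sym f2s a3 b3 : symmetric f3); apply: contract_new;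
    [by []| |exact: ua|exact: ab].
  apply: k2; [by rewrite eq_sym|exact: ub|].
  apply: k1; [by rewrite eq_sym|exact: ub|by have [_ _ + _] := inB b3 b3B].
apply: (@van_kampen_K33 _ f3 x y z a1 a2 a3 v3).
  rewrite -[_ :: _]/([:: x; y; z] ++ [:: a1; a2; a3]) cat_uniq unx una andbT.
  by apply/hasPn => a aA; apply/negP => aU; have := ua _ _ aU aA; rewrite eqxx.
move=> u a uU aA; move: (uU); rewrite !inE => /or3P[] /eqP uE; subst u.
- by apply: kk => //; have [_ ax _ _] := inA a aA; rewrite es.
- by apply: kk => //; have [_ _ ay _] := inA a aA; rewrite es.
by move: aA; rewrite !inE => /or3P[] /eqP->.
Qed.

(** Every vertex has at most two neighbours in the opposite class, so an arc shares an end with at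
    most four arcs, itself included. Among nine arcs a greedy choice would find a matching of size
    three. *)
Lemma card_arcs_between x y z : uniq [:: x; y; z] ->
  #|arcs_between (between e x y z) (between e y z x)| <= 8.
Proof.
move=> unx; set A := between _ _ _ _; set B := between _ _ _ _; set P := arcs_between A B.
have [xy xz yz] : [/\ x != y, x != z & y != z].
  by move: unx; rewrite /= !inE negb_or => /and3P[/andP[-> ->] -> _].
have touch p : p \in P -> #|[set q in P | (q.1 == p.1) || (q.2 == p.2)]| <= 4.
  case: p => a b; rewrite inE /= => /and3P[aA bB eab].
  apply: (@card_subU _ _ [set (a, b') | b' in nbrs e B a] [set (a', b) | a' in [set a'
    in A | e a' b]] 2 2).
  - apply/subsetP => -[a' b']; rewrite in_set in_set in_setU /= => /andP[/and3P[a'A b'B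
    eab']].
    case/orP=> /eqP ?; subst; apply/orP; [left|right]; apply/imsetP.
      by exists b'; rewrite // in_set b'B.
    by exists a'; rewrite // in_set a'A.
  - apply: leq_trans (leq_imset_card _ _) _; apply: card_nbrs_between => //.
      by move: aA; rewrite inE => /and4P[_ _ /adj_neq].
    by move: aA; rewrite inE => /and4P[].
  apply: leq_trans (leq_imset_card _ _) _; apply: card_between_nbrs => //.
    by move: bB; rewrite inE => /and4P[].
  by move: bB; rewrite inE => /and4P[_ /adj_neq].
rewrite leqNgt; apply/negP => big.
have shrink (Q : {set V * V}) p k : p \in P -> Q \subset P -> 4 + k < #|Q| ->
    k < #|[set q in Q | (q.1 != p.1) && (q.2 != p.2)]|.
  move=> pP QP Qk; have := touch p pP.
  suff : #|Q| <= 4 + #|[set q in Q | (q.1 != p.1) && (q.2 != p.2)]| by lia.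
  apply: (card_subU _ (touch p pP) (leqnn _)); apply/subsetP => q qQ.
  rewrite in_setU; apply/orP.
  have [h|h] := boolP ((q.1 == p.1) || (q.2 == p.2)); [left|right].
    by rewrite in_set h andbT; apply: (subsetP QP).
  by rewrite in_set qQ -negb_or.
have /card_gt0P[p1 p1P] : 0 < #|P| by lia.
have s1 := shrink P p1 4 p1P (subxx _) big.
set P1 := [set q in P | _] in s1.
have P1P : P1 \subset P by apply/subsetP => q; rewrite in_set => /andP[].
have /card_gt0P[p2 p2P1] : 0 < #|P1| by lia.
have p2P := subsetP P1P _ p2P1.
have s2 := shrink P1 p2 0 p2P P1P s1.
have /card_gt0P[p3] := s2; rewrite in_set => /andP[p3P1 /andP[p32 p32']].
have p3P := subsetP P1P _ p3P1.
move: p2P1 p3P1; rewrite in_set => /andP[_ /andP[p21 p21']];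
  rewrite in_set => /andP[_ /andP[p31 p31']].
have inP q : q \in P -> [/\ q.1 \in A, q.2 \in B & e q.1 q.2].
  by rewrite in_set => /and3P[].
have [[A1 B1 E1] [A2 B2 E2] [A3 B3 E3]] := And3 (inP _ p1P) (inP _ p2P) (inP _ p3P).
apply: (no_matching3 unx _ _ _ _ E1 E2 E3).
- by move=> v; rewrite 3!in_cons in_nil orbF => /or3P[] /eqP->.
- by move=> v; rewrite 3!in_cons in_nil orbF => /or3P[] /eqP->.
- by rewrite /= !inE negb_or (eq_sym p1.1) p21 (eq_sym p1.1) p31 (eq_sym p2.1) p32.
by rewrite /= !inE negb_or (eq_sym p1.2) p21' (eq_sym p1.2) p31' (eq_sym p2.2) p32'.
Qed.

(* Contracting the path through z makes x and y adjacent apexes over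
   between e x y z. *)
Lemma between_forest x y z (W : {set V}) : uniq [:: x; y; z] ->
  between e y z x != set0 -> between e z x y != set0 ->
  W \subset between e x y z -> degsum e W <= 2 * #|W|.-1.
Proof.
move=> unx /set0Pn[b +] /set0Pn[c +] WA; rewrite !inE.
move=> /and4P[bx bby bz nbx] /and4P[cy cz cx ncy].
have [xy xz yz] : [/\ x != y, x != z & y != z].
  by move: unx; rewrite /= !inE negb_or => /and3P[/andP[-> ->] -> _].
have bc : b != c by apply: contraNneq nbx => ->.
have inW w : w \in W -> [/\ e w x, e w y & ~~ e w z].
  by move=> /(subsetP WA); rewrite inE => /and4P[].
have Wz w : w \in W -> w != z.
  by move=> /(subsetP WA); rewrite inE => /and4P[].
have Wb w : w \in W -> w != b.
  by move=> /inW[_ _]; apply: contraNneq => ->.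
have Wc w : w \in W -> w != c.
  by move=> /inW[_ _]; apply: contraNneq => ->.
pose f1 := contract e x c; pose f2 := contract f1 x z; pose f3 := contract f2 x b.
have f1s : symmetric f1 := contract_sym es x c.
have f1i : irreflexive f1 := @contract_irr _ e x c.
have f2s : symmetric f2 := contract_sym f1s x z.
have f2i : irreflexive f2 := @contract_irr _ f1 x z.
have f3s : symmetric f3 := contract_sym f2s x b.
have f3i : irreflexive f3 := @contract_irr _ f2 x b.
have xc : x != c by rewrite eq_sym adj_neq.
have zc : z != c by rewrite eq_sym adj_neq.
have yb : y != b by rewrite eq_sym adj_neq.
have zb : z != b by rewrite eq_sym adj_neq.
have f1xz : f1 x z by apply: contract_new => //; rewrite eq_sym.
have f1zb : f1 z b by apply: contract_keep => //; rewrite // es.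
have f2xb : f2 x b by apply: contract_new.
have f1by : f1 b y by apply: contract_keep => //; rewrite eq_sym.
have f2by : f2 b y by apply: contract_keep => //; rewrite eq_sym.
have f3xy : f3 x y.
  by apply: contract_new => //; rewrite eq_sym.
have keep u v : u != c -> u != z -> u != b -> v != c -> v != z -> v != b -> e u v -> f3
  u v.
  by move=> uc uz ub vc vz vb euv; do 3!(apply: contract_keep => //).
have v1 : van_kampen f1 by apply: van_kampen_contract; rewrite // es.
have v2 : van_kampen f2 by apply: van_kampen_contract.
have v3 : van_kampen f3 by apply: van_kampen_contract.
apply: leq_trans (_ : degsum f3 W <= _).
  by apply: sub_rel_degsum => u v uW vW; apply: keep; rewrite ?Wb ?Wc ?Wz.
apply: (@apexed_degsum V 2 1 _ f3 [:: x; y]) => //; split; first by rewrite /= f3xy.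
move=> a w; rewrite !inE => /orP[] /eqP-> wW; have [wx wy _] := inW w wW.
  by apply: keep; [|exact: xz|rewrite eq_sym|exact: Wc|exact: Wz|exact: Wb|rewrite es].
by apply: keep; [rewrite eq_sym| | |exact: Wc|exact: Wz|exact: Wb|rewrite es].
Qed.
End Between.

Section Hubs.
Variables (V : finType) (e : rel V).
Hypotheses (es : symmetric e) (ei : irreflexive e) (vk : van_kampen e).
Variables u1 u2 u3 : V.
Hypothesis unu : uniq [:: u1; u2; u3].

Local Notation A := (between e u1 u2 u3).
Local Notation B := (between e u2 u3 u1).
Local Notation C := (between e u3 u1 u2).

Definition hub_set : {set V} := [set u1; u2; u3].
Definition blown_up : {set V} := A :|: B :|: C.
Definition outside : {set V} := ~: (hub_set :|: blown_up).
(** Formulated by adjacency to hubs, which treats the three classes symmetrically and is what a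
    hexagon exhibits directly: one end sees a hub that the other does not. Each edge occurs in both
    directions. *)
Definition cross_edges : {set V * V} :=
  [set p | [&& p.1 \in blown_up, p.2 \in blown_up, e p.1 p.2 &
               [exists u in hub_set, e p.1 u != e p.2 u]]].

Local Notation U := hub_set.
Local Notation Y := blown_up.
Local Notation X := outside.

Lemma hubs_neq : [/\ u1 != u2, u2 != u3 & u3 != u1].
Proof.
by move: unu; rewrite /= !inE negb_or => /and3P[/andP[-> h] -> _]; rewrite eq_sym h.
Qed.

Lemma hub_uniq_rot : uniq [:: u2; u3; u1] /\ uniq [:: u3; u1; u2].
Proof.
have [h1 h2 h3] := hubs_neq.
by rewrite /= !inE !negb_or h1 h2 h3 (eq_sym u2 u1) h1 (eq_sym u3 u2) h2.
Qed.

Lemma hub_setP u : reflect [\/ u = u1, u = u2 | u = u3] (u \in U).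
Proof.
rewrite !inE; apply: (iffP idP) => [|[] ->]; rewrite ?eqxx ?orbT //.
by move=> /orP[/orP[]|] /eqP->; [constructor 1|constructor 2|constructor 3].
Qed.

Lemma blown_upP y : reflect [\/ y \in A, y \in B | y \in C] (y \in Y).
Proof.
rewrite /blown_up !in_setU -orbA; exact: or3P.
Qed.

Lemma card_hub_set : #|U| = 3.
Proof.
have [h1 h2 h3] := hubs_neq.
by rewrite /hub_set -setUA !cardsU1 !inE cards1 negb_or h1 h2 eq_sym h3.
Qed.

Lemma in_between x y z v :
  (v \in between e x y z) = [&& v != z, e v x, e v y & ~~ e v z].
Proof. by rewrite inE. Qed.

Lemma blown_two y p q : y \in Y -> p \in U -> q \in U -> p != q -> e y p || e y q.
Proof.
move=> /blown_upP yY /hub_setP pU /hub_setP qU pq.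
case: yY; rewrite in_between => /and4P[_ h1 h2 _];
 case: pU pq => ->; case: qU => ->; by rewrite ?eqxx ?h1 ?h2 ?orbT.
Qed.

Lemma blown_not_all y : y \in Y -> ~~ [&& e y u1, e y u2 & e y u3].
Proof.
by move=> /blown_upP[]; rewrite in_between => /and4P[_ h1 h2 /negPf->];
  rewrite ?andbF.
Qed.

Lemma blown_not_hub y : y \in Y -> y \notin U.
Proof.
move=> /blown_upP yY; apply/negP => /hub_setP yU.
by case: yY; rewrite in_between => /and4P[h0 h1 h2 h3]; case: yU => yE; subst y;
   rewrite ?ei ?eqxx // in h0 h1 h2.
Qed.

Lemma between_blown x y z v : [:: x; y; z] \in [:: [:: u1; u2; u3]; [:: u2; u3; u1];
  [:: u3; u1; u2]] ->
  v \in Y -> e v x -> e v y -> v \in between e x y z.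
Proof.
move=> h vY vx vy; rewrite in_between vx vy /=.
have vU := blown_not_hub vY; have nall := blown_not_all vY.
move: h; rewrite !inE => /or3P[] /eqP[? ? ?]; subst x y z.
- move: nall; rewrite vx vy => ->; rewrite andbT.
  by apply: contraNneq vU => ->; rewrite !inE eqxx orbT.
- move: nall; rewrite vx vy !andbT => ->; rewrite andbT.
  by apply: contraNneq vU => ->; rewrite !inE eqxx.
move: nall; rewrite vx vy !andbT => ->; rewrite andbT.
by apply: contraNneq vU => ->; rewrite !inE eqxx orbT.
Qed.

Lemma card_nbrs_blown v : v \notin U -> #|nbrs e Y v| <= 6.
Proof.
rewrite !inE !negb_or -andbA => /and3P[v1 v2 v3].
have [h1 h2 h3] := hubs_neq.
apply: (@card_subU _ _ (nbrs e A v :|: nbrs e B v) (nbrs e C v) 4 2).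
- by apply/subsetP => w; rewrite !inE -!orbA; case: (e v w); rewrite ?andbT ?andbF.
- apply: (@card_subU _ _ (nbrs e A v) (nbrs e B v) 2 2) => //.
    exact: card_nbrs_between.
  exact: card_nbrs_between.
exact: card_nbrs_between.
Qed.

Lemma card_nbrs_inner v : v \notin U -> #|nbrs e (U :|: Y) v| <= 9.
Proof.
move=> vU; apply: (@card_subU _ _ (nbrs e U v) (nbrs e Y v) 3 6).
- by apply/subsetP => w; rewrite !in_set => /andP[/orP[->|->] ->] //; rewrite orbT.
- rewrite -card_hub_set; apply: subset_leq_card; apply/subsetP => w.
  by rewrite in_set => /andP[].
exact: card_nbrs_blown.
Qed.

Lemma card_arcs_between_sym (S T : {set V}) k :
  #|arcs_between e S T| <= k -> #|arcs_between e T S| <= k.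
Proof.
move=> h; apply: leq_trans h; pose f (p : V * V) := (p.2, p.1).
apply: leq_trans (_ : #|f @: arcs_between e S T| <= _); last exact: leq_imset_card.
apply: subset_leq_card; apply/subsetP => -[a b]; rewrite inE /= => /and3P[aT bS eab].
by apply/imsetP; exists (b, a); rewrite // inE /= bS aT es.
Qed.

Lemma cross_edges_parts p : p \in cross_edges ->
  [\/ p \in arcs_between e A B \/ p \in arcs_between e B A,
      p \in arcs_between e B C \/ p \in arcs_between e C B |
      p \in arcs_between e C A \/ p \in arcs_between e A C].
Proof.
rewrite inE => /and4P[/blown_upP p1 /blown_upP p2 ep /exists_inP[u /hub_setP uU ne]].
have same x y z : p.1 \in between e x y z -> p.2 \in between e x y z ->
    u \in [:: x; y; z] -> False.
  rewrite !in_between => /and4P[_ a1 a2 /negPf a3] /and4P[_ b1 b2 /negPf b3].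
  by rewrite !inE => /or3P[] /eqP uE; move: ne; rewrite uE ?a1 ?a2 ?a3 ?b1 ?b2 ?b3 eqxx.
have uin : [/\ u \in [:: u1; u2; u3], u \in [:: u2; u3; u1] & u \in [:: u3; u1; u2]].
  by split; rewrite !inE; case: uU => ->; rewrite eqxx ?orbT.
have [i1 i2 i3] := uin.
have mem (S T : {set V}) : p.1 \in S -> p.2 \in T -> p \in arcs_between e S T.
  by move=> pS pT; rewrite inE pS pT.
case: p1 => p1; case: p2 => p2.
- by case: (same _ _ _ p1 p2 i1).
- by constructor 1; left; apply: mem.
- by constructor 3; right; apply: mem.
- by constructor 1; right; apply: mem.
- by case: (same _ _ _ p1 p2 i2).
- by constructor 2; left; apply: mem.
- by constructor 3; left; apply: mem.
- by constructor 2; right; apply: mem.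
by case: (same _ _ _ p1 p2 i3).
Qed.

Lemma card_cross_edges : #|cross_edges| <= 48.
Proof.
have [un2 un3] := hub_uniq_rot.
have h1 := card_arcs_between es ei vk unu.
have h2 := card_arcs_between es ei vk un2.
have h3 := card_arcs_between es ei vk un3.
apply: (@card_subU _ _ (arcs_between e A B :|: arcs_between e B A :|:
   (arcs_between e B C :|: arcs_between e C B))
   (arcs_between e C A :|: arcs_between e A C) 32 16).
- by apply/subsetP => p /cross_edges_parts h; rewrite !in_setU;
    case: h => [] [->|->]; rewrite ?orbT.
- apply: (card_subU (m := 16) (k := 16) (subxx _)).
    by apply: (card_subU (m := 8) (k := 8) (subxx _)) => //; apply: card_arcs_between_sym.
  by apply: (card_subU (m := 8) (k := 8) (subxx _)) => //; apply: card_arcs_between_sym.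
by apply: (card_subU (m := 8) (k := 8) (subxx _)) => //; apply: card_arcs_between_sym.
Qed.

Lemma outsideP x : x \in X -> [/\ x \notin U, x \notin Y &
  forall p q r, p \in U -> q \in U -> r \in U -> p != q -> e x p -> e x q -> e x r].
Proof.
rewrite in_setC in_setU negb_or => /andP[xU xY]; split=> //.
have nb : ~~ (x \in A) /\ ~~ (x \in B) /\ ~~ (x \in C).
  by move: xY; rewrite /blown_up !in_setU !negb_or -andbA => /and3P[-> -> ->].
move: nb (xU); rewrite !in_between !inE !negb_or -andbA => -[nA [nB nC]] /and3P[x1 x2 x3].
rewrite x1 x2 x3 /= in nA nB nC.
move=> p q r /hub_setP pU /hub_setP qU /hub_setP rU pq xp xq.
move: nA nB nC.
by case: pU pq xp => ->; case: qU xq => ->; case: rU => ->;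
  rewrite ?eqxx // => -> _ -> //=;
  rewrite ?negbK // => *; repeat match goal with H : is_true (~~ ~~ _) |- _ => rewrite
    negbK in H end.
Qed.

Lemma card_dep (S T : finType) (P : {set S}) (Q : S -> {set T}) k :
  (forall s, s \in P -> #|Q s| <= k) ->
  #|[set p : S * T | (p.1 \in P) && (p.2 \in Q p.1)]| <= #|P| * k.
Proof.
move=> Qk; pose F (s : S) : {set S * T} := [set (s, t) | t in Q s].
apply: (card_cover (F := F)) => [[s t]|s sP].
  by rewrite inE /= => /andP[sP tQ]; exists s => //; apply/imsetP; exists t.
by apply: leq_trans (leq_imset_card _ _) (Qk s sP).
Qed.

Lemma hub4 a b c d : uniq [:: a; b; c; d] -> a \in U -> b \in U -> c \in U ->
  d \in U -> False.
Proof.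
move=> un aU bU cU dU; have : #|[set w in [:: a; b; c; d]]| <= #|U|.
  apply: subset_leq_card; apply/subsetP => w; rewrite in_set !in_cons in_nil orbF.
  by case/or4P => /eqP->.
by rewrite card_hub_set cardsE (card_uniqP un).
Qed.

Lemma in_inner v : v \in U :|: Y -> v \notin U -> v \in Y.
Proof. by rewrite in_setU => /orP[->|]. Qed.

Lemma hub_or_blown p q v : v \in U :|: Y -> p \in U -> q \in U -> p != q ->
  ~~ e v p -> ~~ e v q -> v \in U.
Proof.
rewrite in_setU => /orP[//|vY] pU qU pq vp vq.
by have := blown_two vY pU qU pq; rewrite (negPf vp) (negPf vq).
Qed.

Definition base_triples : {set V * (V * V)} :=
  [set p | [&& p.1 \in A, p.2.1 \in B, p.2.2 \in C,
               ~~ e p.1 p.2.1, ~~ e p.2.1 p.2.2 & ~~ e p.2.2 p.1]].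

Definition base_set (p : V * (V * V)) : {set V} := U :|: [set p.1; p.2.1; p.2.2].

Definition hubs_adjacent : bool := [exists p in U, exists q in U, e p q].

Section CleanHexagon.
Variables v0 v1 v2 v3 v4 v5 : V.
Hypothesis hx : hex e v0 v1 v2 v3 v4 v5.
Hypothesis inner : set6 v0 v1 v2 v3 v4 v5 \subset U :|: Y.

Lemma inner_mem : [/\ v0 \in U :|: Y, v1 \in U :|: Y, v2 \in U :|: Y &
  [/\ v3 \in U :|: Y, v4 \in U :|: Y & v5 \in U :|: Y]].
Proof.
have h v : v \in [:: v0; v1; v2; v3; v4; v5] -> v \in U :|: Y.
  by move=> hv; apply: (subsetP inner); rewrite in_set.
by do 2?split; apply: h; rewrite !in_cons eqxx ?orbT.
Qed.

(** A blown-up vertex misses only one hub. If v0 and v1 were hubs, v3 and v4 would miss both and so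
    would be hubs too, which makes four. *)
Lemma clean_hubs_not_adjacent : v0 \in U -> v1 \notin U.
Proof.
move=> v0U; apply/negP => v1U; have [_ _ _ [i3 i4 _]] := inner_mem.
have /and3P[un _ /and5P[n02 n03 n04 n13 /and5P[n14 _ _ _ _]]] := hx.
have un4 : uniq [:: v0; v1; v3; v4].
  by apply: subseq_uniq un; apply/subseqP; exists [:: true; true; false; true; true;
    false].
have v01 : v0 != v1 by move: un4; rewrite /= inE negb_or => /andP[/andP[->]].
apply: (hub4 un4 v0U v1U); apply: hub_or_blown v0U v1U v01 _ _ => //; by rewrite es.
Qed.

(** The vertex v4 misses the hubs v0 and v2, so it is the third hub. The odd vertices then lie one
    in each class, and an edge between hubs or between odd vertices would be a chord. *)
Lemma clean_base : v0 \in U -> v2 \in U ->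
  ~~ hubs_adjacent /\ set6 v0 v1 v2 v3 v4 v5 \in base_set @: base_triples.
Proof.
move=> v0U v2U; have [i0 i1 i2 [i3 i4 i5]] := inner_mem.
have /and3P[un /and5P[e01 e12 e23 e34 /andP[e45 e50]]] := hx.
move=> /and5P[n02 n03 n04 n13 /and5P[n14 n15 n24 n25 n35]].
have d02 : v0 != v2.
  by move: un; rewrite /= !inE !negb_or -!andbA; do ![case/andP=> ?]; move=> *.
have v4U : v4 \in U by apply: hub_or_blown i4 v0U v2U d02 _ _; rewrite es.
have un3 : uniq [:: v0; v2; v4].
  by apply: subseq_uniq un; apply/subseqP; exists [:: true; false; true; false; true;
    false].
have hubE u : u \in U -> u \in [:: v0; v2; v4].
  move=> uU; apply/negPn/negP => nu.
  by apply: (@hub4 u v0 v2 v4) => //; rewrite cons_uniq nu.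
have evenE u : u \in [:: v0; v2; v4] -> u \in U.
  by rewrite !in_cons in_nil orbF => /or3P[] /eqP->.
have oddY w : w \in [:: v1; v3; v5] -> w \in Y.
  move=> wo; apply: in_inner; first by move: wo; rewrite !in_cons in_nil orbF =>
    /or3P[] /eqP->.
  apply/negP => /hubE; move: wo un; rewrite /= !in_cons !in_nil !orbF !negb_or -!andbA.
  by move=> /or3P[] /eqP-> + /or3P[] /eqP ?; subst;
    rewrite ?eqxx ?andbF // => /and5P[]; rewrite ?eqxx ?andbF.
have nodd w w' : w \in [:: v1; v3; v5] -> w' \in [:: v1; v3; v5] -> ~~ e w w'.
  rewrite !in_cons !in_nil !orbF.
  by move=> /or3P[] /eqP-> /or3P[] /eqP->; rewrite ?ei // es.
have neven w w' : w \in U -> w' \in U -> ~~ e w w'.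
  move=> /hubE + /hubE; rewrite !in_cons !in_nil !orbF.
  by move=> /or3P[] /eqP-> /or3P[] /eqP->; rewrite ?ei // es.
have common p q : p \in U -> q \in U -> p != q ->
    exists w, [/\ w \in [:: v1; v3; v5], e w p & e w q].
  move=> /hubE + /hubE; rewrite !in_cons !in_nil !orbF.
  move=> /or3P[] /eqP-> /or3P[] /eqP->; rewrite ?eqxx // => _.
  - by exists v1; rewrite in_cons eqxx es e01 e12.
  - by exists v5; rewrite !in_cons eqxx !orbT e50 es e45.
  - by exists v1; rewrite in_cons eqxx e12 es e01.
  - by exists v3; rewrite !in_cons eqxx !orbT e34 es e23.
  - by exists v5; rewrite !in_cons eqxx !orbT e50 es e45.
  by exists v3; rewrite !in_cons eqxx !orbT e34 es e23.
split.
  apply/negP => /exists_inP[p pU /exists_inP[q qU]].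
  by rewrite (negPf (neven p q pU qU)).
have [h12 h23 h31] := hubs_neq.
have [U1 [U2 U3]] : u1 \in U /\ u2 \in U /\ u3 \in U.
  by rewrite !inE !eqxx !orbT.
have [a [ao a1 a2]] := common _ _ U1 U2 h12.
have [b [bo b2 b3]] := common _ _ U2 U3 h23.
have [c [co c3 c1]] := common _ _ U3 U1 h31.
have aA : a \in A by apply: between_blown => //; [rewrite !inE eqxx|exact: oddY].
have bB : b \in B by apply: between_blown => //; [rewrite !inE eqxx ?orbT|exact: oddY].
have cC : c \in C by apply: between_blown => //; [rewrite !inE eqxx ?orbT|exact: oddY].
apply/imsetP; exists (a, (b, c)).
  by rewrite in_set /= aA bB cC !nodd.
have [ab [bc ac]] : a != b /\ b != c /\ a != c.
  have no3 x y z v : v \in between e x y z -> ~~ e v z by rewrite in_between => /and4P[].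
  split; first by apply: contraTneq b3 => <-; apply: no3 aA.
  split; first by apply: contraTneq c1 => <-; apply: no3 bB.
  by apply: contraTneq c3 => <-; apply: no3 aA.
have S6 : #|set6 v0 v1 v2 v3 v4 v5| = 6 by rewrite cardsE (card_uniqP un).
apply/eqP; rewrite eq_sym eqEcard S6; apply/andP; split.
  have oddS w : w \in [:: v1; v3; v5] -> w \in set6 v0 v1 v2 v3 v4 v5.
    by rewrite in_set !in_cons !in_nil !orbF => /or3P[] /eqP->; rewrite eqxx ?orbT.
  apply/subsetP => w; rewrite in_setU => /orP[/hubE|].
    by rewrite in_set !in_cons !in_nil !orbF => /or3P[] /eqP->; rewrite eqxx ?orbT.
  by rewrite in_setU in_setU !in_set1 => /orP[/orP[]|] /eqP->; apply: oddS.
rewrite /base_set cardsU card_hub_set /= (_ : U :&: _ = set0) ?cards0 ?subn0.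
  by rewrite -setUA !cardsU1 !inE cards1 negb_or ab ac bc.
apply/setP => w; rewrite in_setI [RHS]in_set0; apply/negP => /andP[wU wabc].
have wY : w \in Y.
  by move: wabc; rewrite in_setU in_setU !in_set1 => /orP[/orP[]|] /eqP->; apply: oddY.
by move: (blown_not_hub wY); rewrite wU.
Qed.

Lemma clean_cross_pair p w w' : p \in U -> w \in Y -> w' \in Y -> e w w' ->
  e w p -> ~~ e w' p -> (w, w') \in cross_edges.
Proof.
move=> pU wY w'Y ww' wp w'p; rewrite in_set /= wY w'Y ww' /=.
by apply/exists_inP; exists p; rewrite // wp (negPf w'p).
Qed.

(** The neighbours v1 and v5 of the hub v0 are attached to it while v2 and v4 are not. *)
Lemma clean_cross : v0 \in U -> v1 \in Y -> v2 \in Y -> v4 \in Y -> v5 \in Y ->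
  (v1, v2) \in cross_edges /\ (v5, v4) \in cross_edges.
Proof.
move=> v0U y1 y2 y4 y5.
have /and3P[un /and5P[e01 e12 e23 e34 /andP[e45 e50]]] := hx.
move=> /and5P[n02 n03 n04 n13 /and5P[n14 n15 n24 n25 n35]].
by split; apply: (clean_cross_pair v0U) => //; rewrite es.
Qed.
End CleanHexagon.

Local Notation Cr := cross_edges.

(** An edge between hubs is a chord of every hexagon alternating between hubs and classes, hence the
    empty case. *)
Definition base_sets : {set {set V}} :=
  if hubs_adjacent then set0 else base_set @: base_triples.

Definition twohub_data := setX (setX U U) (setX Cr Cr).
Definition twohub_set (t : (V * V) * ((V * V) * (V * V))) : {set V} :=
  set6 t.1.1 t.2.1.1 t.2.1.2 t.1.2 t.2.2.2 t.2.2.1.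

Definition onehub_data : {set (V * ((V * V) * (V * V))) * V} :=
  [set t | (t.1 \in setX U (setX Cr Cr)) && (t.2 \in nbrs e Y t.1.2.1.2)].
Definition onehub_set (t : (V * ((V * V) * (V * V))) * V) : {set V} :=
  set6 t.1.1 t.1.2.1.1 t.1.2.1.2 t.2 t.1.2.2.2 t.1.2.2.1.

Definition path4_data : {set (V * V) * (V * V)} :=
  [set t | (t.1 \in Cr) && (t.2 \in setX (nbrs e Y t.1.2) (nbrs e Y t.1.1))].
Definition nohub_data : {set ((V * V) * (V * V)) * (V * V)} :=
  [set t | (t.1 \in path4_data) &&
           (t.2 \in setX (nbrs e Y t.1.2.1) (nbrs e Y t.1.2.2))].
Definition nohub_set (t : ((V * V) * (V * V)) * (V * V)) : {set V} :=
  set6 t.1.1.1 t.1.1.2 t.1.2.1 t.2.1 t.2.2 t.1.2.2.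

(* The hexagons made of hubs and blown-up vertices that have two opposite hubs v0
   and v3, a single hub v0, or no hub: each of them contains a cross edge. *)
Definition crossed_sets : {set {set V}} :=
  twohub_set @: twohub_data :|: onehub_set @: onehub_data :|:
  nohub_set @: nohub_data.

Lemma in_nbrs (W : {set V}) v w : (w \in nbrs e W v) = (w \in W) && e v w.
Proof. by rewrite in_set. Qed.

Lemma cross_in_blown p : p \in Cr -> p.1 \in Y /\ p.2 \in Y.
Proof. by rewrite in_set => /and4P[]. Qed.

(** The bound is linear in the number of cross edges so that it vanishes with them; where a
    configuration uses two cross edges, one is estimated by 48. *)
Lemma card_crossed_sets : #|crossed_sets| <= 2592 * #|Cr|.
Proof.
have Cr48 := card_cross_edges.
have nb v : v \in Y -> #|nbrs e Y v| <= 6.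
  by move=> vY; apply: card_nbrs_blown; apply: blown_not_hub.
(* The shares are 3 * 3 * 48 with two opposite hubs, 3 * 48 * 6 = 864 with one hub, and 36 * 36 =
   1296 without hubs, where each further vertex is one of at most six neighbours. *)
apply: leq_trans (_ : (9 * 48 + 864) * #|Cr| + 1296 * #|Cr| <= _); last by lia.
apply: (card_subU (subxx _)).
  rewrite mulnDl; apply: (card_subU (subxx _)).
    apply: leq_trans (leq_imset_card _ _) _; rewrite !cardsX card_hub_set.
    by move: #|Cr| Cr48 => k; clear; nia.
  apply: leq_trans (leq_imset_card _ _) _.
  apply: leq_trans (card_dep (Q := fun s : V * ((V * V) * (V * V)) => nbrs e Y s.2.1.2)
    (k := 6) _) _ => [[p [a b]]|].
    rewrite !in_setX => /and3P[_ /cross_in_blown[_ ay] _]; exact: nb.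
  rewrite !cardsX card_hub_set.
  by move: #|Cr| Cr48 => k; clear; nia.
apply: leq_trans (leq_imset_card _ _) _.
apply: leq_trans (card_dep
    (Q := fun s : (V * V) * (V * V) => setX (nbrs e Y s.2.1) (nbrs e Y s.2.2))
    (k := 36) _) _ => [[a [b c]]|].
  rewrite inE /= in_setX !in_nbrs => /andP[_ /andP[/andP[bY _] /andP[cY _]]].
  by rewrite cardsX (_ : 36 = 6 * 6) // leq_mul ?nb.
rewrite (_ : 1296 * #|Cr| = #|Cr| * 36 * 36); last by move: #|Cr|; clear; lia.
rewrite leq_mul2r; apply/orP; right; apply: (card_dep (Q := fun s : V * V => setX (nbrs
  e Y s.2) (nbrs e Y s.1))) => -[a b] /cross_in_blown[aY bY].
by rewrite cardsX (_ : 36 = 6 * 6) // leq_mul ?nb.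
Qed.

Lemma base_setsP v0 v1 v2 v3 v4 v5 : hex e v0 v1 v2 v3 v4 v5 ->
  set6 v0 v1 v2 v3 v4 v5 \subset U :|: Y -> v0 \in U -> v2 \in U ->
  set6 v0 v1 v2 v3 v4 v5 \in base_sets.
Proof.
by move=> hx inner h0 h2; rewrite /base_sets; have [/negPf-> ->] := clean_base hx inner
  h0 h2.
Qed.

Hypotheses (B0 : B != set0) (C0 : C != set0) (A0 : A != set0).

Lemma part_forest x y z (W : {set V}) :
  [:: x; y; z] \in [:: [:: u1; u2; u3]; [:: u2; u3; u1]; [:: u3; u1; u2]] ->
  W \subset between e x y z -> degsum e W <= 2 * #|W|.-1.
Proof.
have [un2 un3] := hub_uniq_rot.
rewrite !inE => /or3P[] /eqP[? ? ?]; subst x y z; exact: between_forest.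
Qed.

(* Without a cross edge the hexagon would lie in one part, which spans a forest. *)
Lemma blown_hex_cross v0 v1 v2 v3 v4 v5 : hex e v0 v1 v2 v3 v4 v5 ->
  {subset [:: v0; v1; v2; v3; v4; v5] <= Y} ->
  ~~ [&& (v0, v1) \notin Cr, (v1, v2) \notin Cr, (v2, v3) \notin Cr,
         (v3, v4) \notin Cr & (v4, v5) \notin Cr].
Proof.
move=> hx sY; apply/negP => /and5P[c01 c12 c23 c34 c45].
have /and3P[un /and5P[e01 e12 e23 e34 /andP[e45 e50]] _] := hx.
have inY v : v \in [:: v0; v1; v2; v3; v4; v5] -> v \in Y by exact: sY.
have same v w : (v, w) \notin Cr -> v \in [:: v0; v1; v2; v3; v4; v5] ->
    w \in [:: v0; v1; v2; v3; v4; v5] -> e v w -> forall u, u \in U -> e w u = e v u.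
  move=> + /inY vY /inY wY evw u uU; rewrite in_set /= vY wY evw /=.
  by rewrite negb_exists_in => /forall_inP/(_ u uU); rewrite negbK => /eqP.
pose s := [:: v0; v1; v2; v3; v4; v5].
have [m0 m1 m2] : [/\ v0 \in s, v1 \in s & v2 \in s] by rewrite !in_cons !eqxx ?orbT.
have [m3 m4 m5] : [/\ v3 \in s, v4 \in s & v5 \in s] by rewrite !in_cons !eqxx ?orbT.
have s1 u : u \in U -> e v1 u = e v0 u by move=> uU; rewrite (same v0 v1).
have s2 u : u \in U -> e v2 u = e v0 u by move=> uU; rewrite (same v1 v2) // s1.
have s3 u : u \in U -> e v3 u = e v0 u by move=> uU; rewrite (same v2 v3) // s2.
have s4 u : u \in U -> e v4 u = e v0 u by move=> uU; rewrite (same v3 v4) // s3.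
have s5 u : u \in U -> e v5 u = e v0 u by move=> uU; rewrite (same v4 v5) // s4.
have all0 v u : v \in s -> u \in U -> e v u = e v0 u.
  rewrite !in_cons in_nil orbF; do 5!(case/predU1P => [->|]; [by auto|]).
  by move/eqP->; auto.
have [U1 [U2 U3]] : u1 \in U /\ u2 \in U /\ u3 \in U.
  by rewrite !inE !eqxx !orbT.
have contra x y z : [:: x; y; z] \in [:: [:: u1; u2; u3]; [:: u2; u3; u1]; [:: u3; u1;
  u2]] ->
    x \in U -> y \in U -> v0 \in between e x y z -> False.
  move=> xyz xU yU; rewrite in_between => /and4P[_ v0x v0y _].
  have sub : [set v in s] \subset between e x y z.
    apply/subsetP => v; rewrite in_set => vs.
    by apply: between_blown; rewrite ?all0 // inY.
  have := part_forest xyz sub.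
  rewrite cardsE (card_uniqP un) /= leqNgt => /negP[].
  apply: (@leq_trans (\sum_(v in [set v in s]) 2)).
    by rewrite sum_nat_const cardsE (card_uniqP un).
  have two v a b : v \in s -> a \in s -> b \in s -> a != b -> e v a -> e v b ->
      1 < #|nbrs e [set v in s] v|.
    move=> vs as_ bs ab va vb; apply/card_gt1P; exists a, b; split=> //.
      by rewrite in_set in_set as_.
    by rewrite in_set in_set bs.
  have neq (i j : nat) : i < 6 -> j < 6 -> i != j -> nth v0 s i != nth v0 s j.
    by move=> i6 j6 ij; rewrite nth_uniq.
  apply: leq_sum => v; rewrite in_set !in_cons in_nil orbF.
  case/predU1P => [->|]; first by apply: (two v0 v1 v5) => //;
    [exact: (neq 1 5)|rewrite es].
  case/predU1P => [->|]; first by apply: (two v1 v0 v2) => //;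
    [exact: (neq 0 2)|rewrite es].
  case/predU1P => [->|]; first by apply: (two v2 v1 v3) => //;
    [exact: (neq 1 3)|rewrite es].
  case/predU1P => [->|]; first by apply: (two v3 v2 v4) => //;
    [exact: (neq 2 4)|rewrite es].
  case/predU1P => [->|]; first by apply: (two v4 v3 v5) => //;
    [exact: (neq 3 5)|rewrite es].
  by move/eqP->; apply: (two v5 v4 v0) => //; [exact: (neq 4 0)|rewrite es].
by have /blown_upP[] := inY v0 m0; apply: contra; rewrite ?inE ?eqxx ?orbT.
Qed.

Local Notation all_arcs := (arcs e [set: V]).

Definition outside_arcs : {set V * V} :=
  [set p | e p.1 p.2 && ((p.1 \in X) || (p.2 \in X))].

(** Per outside vertex there are on average at most 14 arcs within the outside and at most 9 towards
    hubs and classes; the sum 23 is doubled for the two directions. *)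
Lemma card_outside_arcs : #|outside_arcs| <= 46 * #|X|.
Proof.
pose Q v := nbrs e (U :|: Y) v.
pose out := arcs e X :|: [set p : V * V | (p.1 \in X) && (p.2 \in Q p.1)].
have outP a b : a \in X -> e a b -> (a, b) \in out.
  move=> aX eab; rewrite in_setU; apply/orP.
  have [bX|bX] := boolP (b \in X); [left|right]; rewrite in_set /= aX ?bX ?eab //.
  by move: bX; rewrite in_setC negbK /Q in_nbrs eab andbT.
have out_card : #|out| <= 23 * #|X|.
  rewrite (_ : 23 = 14 + 9) // mulnDl; apply: (card_subU (subxx _)).
    exact: card_arcs.
  rewrite mulnC; apply: card_dep => v /outsideP[vU _ _].
  exact: card_nbrs_inner.
pose sw (p : V * V) := (p.2, p.1).
rewrite (_ : 46 = 23 + 23) // mulnDl; apply: (card_subU (B := out) (C := sw @: out)) =>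
  //.
  apply/subsetP => -[a b]; rewrite in_set in_setU /= => /andP[eab /orP[aX|bX]].
    by rewrite outP.
  apply/orP; right; apply/imsetP; exists (b, a) => //.
  by apply: outP; rewrite // es.
by apply: leq_trans (leq_imset_card _ _) _.
Qed.

Definition three_arcs_set (t : (V * V) * ((V * V) * (V * V))) : {set V} :=
  set6 t.1.1 t.1.2 t.2.1.1 t.2.1.2 t.2.2.1 t.2.2.2.
Definition two_outside_data := setX outside_arcs (setX outside_arcs all_arcs).

Definition short_paths (v : V) : {set V * V} :=
  [set t | (t.1 \in nbrs e Y v) && (t.2 \in nbrs e (U :|: Y) t.1)].
Definition side_data : {set V * ((V * V) * (V * (V * V)))} :=
  [set t | (t.1 \in X) &&
     (t.2 \in setX (short_paths t.1) (setX (nbrs e (U :|: Y) t.1) all_arcs))].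
Definition side_set (t : V * ((V * V) * (V * (V * V)))) : {set V} :=
  set6 t.1 t.2.1.1 t.2.1.2 t.2.2.2.1 t.2.2.2.2 t.2.2.1.

Definition opposite_data : {set ((V * V) * (V * V)) * (V * V)} :=
  [set t | (t.1 \in setX (setX X (~: U)) (setX U U)) &&
     (t.2 \in setX (nbrs e (U :|: Y) t.1.1.2) (nbrs e (U :|: Y) t.1.1.2))].
Definition opposite_set (t : ((V * V) * (V * V)) * (V * V)) : {set V} :=
  set6 t.1.1.1 t.1.2.1 t.2.1 t.1.1.2 t.2.2 t.1.2.2.

(* A hexagon with an outside vertex v0 either has two outside arcs in a perfect
   matching, or v0 is its only outside vertex; then v0 has a blown-up neighbour on
   it, or its two neighbours are hubs and the vertex opposite to v0 is not. *)
Definition outside_sets : {set {set V}} :=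
  three_arcs_set @: two_outside_data :|:
  (side_set @: side_data :|: opposite_set @: opposite_data).

(** Two outside arcs and an arbitrary third arc give the first term. With a blown-up neighbour, two
    steps (6 * 9), the other neighbour (9) and a free arc (14 n) remain; with two hub neighbours, 9
    pairs of hubs, the opposite vertex and 81 choices, 9 * 81 = 729. *)
Lemma card_outside_sets :
  #|outside_sets| <= (46 * 46 * 14) * (#|X| ^ 2 * #|V|) + (54 * 9 * 14 + 729) * (#|X| *
    #|V|).
Proof.
have cA : #|all_arcs| <= 14 * #|V| by rewrite -cardsT; apply: card_arcs.
have cX := card_outside_arcs.
apply: (card_subU (subxx _)).
  apply: leq_trans (leq_imset_card _ _) _; rewrite !cardsX.
  apply: leq_trans (leq_mul cX (leq_mul cX cA)) _.
  by move: #|X| #|V| => x n; clear; nia.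
rewrite mulnDl; apply: (card_subU (subxx _)).
  apply: leq_trans (leq_imset_card _ _) _.
  apply: leq_trans (card_dep (Q := fun v =>
     setX (short_paths v) (setX (nbrs e (U :|: Y) v) all_arcs))
     (k := 54 * (9 * (14 * #|V|))) _) _ => [v /outsideP[vU _ _]|].
    rewrite !cardsX; apply: leq_mul; last by apply: leq_mul => //; apply: card_nbrs_inner.
    apply: leq_trans (card_dep (Q := fun w => nbrs e (U :|: Y) w) (k := 9) _) _.
      by move=> w; rewrite in_nbrs => /andP[wY _]; apply: card_nbrs_inner;
        apply: blown_not_hub.
    by rewrite (_ : 54 = 6 * 9) // leq_mul2r card_nbrs_blown ?orbT.
  by move: #|X| #|V| => x n; clear; nia.
apply: leq_trans (leq_imset_card _ _) _.
apply: leq_trans (card_dep (Q := fun s : (V * V) * (V * V) =>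
   setX (nbrs e (U :|: Y) s.1.2) (nbrs e (U :|: Y) s.1.2))
   (k := 81) _) _ => [[[a b] [c d]]|].
  rewrite !in_setX /= => /andP[/andP[_ bU] _]; rewrite in_setC in bU.
  by rewrite cardsX (_ : 81 = 9 * 9) // leq_mul ?card_nbrs_inner.
rewrite !cardsX card_hub_set.
have : #|~: U| <= #|V| by apply: max_card.
by move: #|X| #|V| #|~: U| => x n m; clear; nia.
Qed.

Lemma hexes_cover : hexes e \subset base_sets :|: crossed_sets :|: outside_sets.
Proof.
apply/subsetP => S SH; have /hexesP[v0 [v1 [v2 [v3 [v4 [v5 [hx SE]]]]]]] := SH.
have rot w0 w1 w2 w3 w4 w5 : hex e w0 w1 w2 w3 w4 w5 -> S = set6 w0 w1 w2 w3 w4 w5 ->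
    hex e w1 w2 w3 w4 w5 w0 /\ S = set6 w1 w2 w3 w4 w5 w0.
  by move=> h ->; split; [exact: hex_rot|exact: set6_rot].
have rev w0 w1 w2 w3 w4 w5 : hex e w0 w1 w2 w3 w4 w5 -> S = set6 w0 w1 w2 w3 w4 w5 ->
    hex e w0 w5 w4 w3 w2 w1 /\ S = set6 w0 w5 w4 w3 w2 w1.
  move=> h SE'; have SE2 : S = set6 w5 w4 w3 w2 w1 w0.
    by apply/setP => w; rewrite SE' !in_set -[LHS]mem_rev.
  have [h1 S1] := rot _ _ _ _ _ _ (hex_rev es h) SE2.
  have [h2 S2] := rot _ _ _ _ _ _ h1 S1; have [h3 S3] := rot _ _ _ _ _ _ h2 S2.
  have [h4 S4] := rot _ _ _ _ _ _ h3 S3; exact: rot h4 S4.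
have [inner|notinner] := boolP (S \subset U :|: Y).
  apply/setUP; left.
  have two w0 w1 w2 w3 w4 w5 : hex e w0 w1 w2 w3 w4 w5 -> S = set6 w0 w1 w2 w3 w4 w5 ->
      w0 \in U -> w2 \in U -> S \in base_sets :|: crossed_sets.
    move=> h SE' w0U w2U; apply/setUP; left.
    by rewrite SE' in inner *; apply: base_setsP.
  have hub w0 w1 w2 w3 w4 w5 : hex e w0 w1 w2 w3 w4 w5 -> S = set6 w0 w1 w2 w3 w4 w5 ->
      w0 \in U -> S \in base_sets :|: crossed_sets.
    move=> h SE' w0U; have inner' := inner; rewrite SE' in inner'.
    have [i0 i1 i2 [i3 i4 i5]] := inner_mem inner'.
    have n1 := clean_hubs_not_adjacent h inner' w0U.
    have [h' SE2] := rev _ _ _ _ _ _ h SE'; have inner2 := inner; rewrite SE2 in inner2.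
    have n5 := clean_hubs_not_adjacent h' inner2 w0U.
    have [w2U|n2] := boolP (w2 \in U); first exact: (two _ _ _ _ _ _ h SE').
    have [w4U|n4] := boolP (w4 \in U); first exact: (two _ _ _ _ _ _ h' SE2).
    have [c12 c54] := clean_cross h w0U (in_inner i1 n1) (in_inner i2 n2)
      (in_inner i4 n4) (in_inner i5 n5).
    have /and3P[_ /and5P[e01 e12 e23 e34 /andP[e45 e50]] _] := h.
    apply/setUP; right; apply/setUP; left; apply/setUP.
    have [w3U|n3] := boolP (w3 \in U).
      left; apply/imsetP; exists ((w0, w3), ((w1, w2), (w5, w4))) => //.
      by rewrite !in_setX w0U w3U c12 c54.
    right; apply/imsetP; exists ((w0, ((w1, w2), (w5, w4))), w3) => //.
    by rewrite in_set /= !in_setX w0U c12 c54 in_nbrs e23 (in_inner i3 n3).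
  have [h0|n0] := boolP (v0 \in U); first exact: (hub _ _ _ _ _ _ hx SE).
  have [hx1 SE1] := rot _ _ _ _ _ _ hx SE.
  have [h1|n1] := boolP (v1 \in U); first exact: (hub _ _ _ _ _ _ hx1 SE1).
  have [hx2 SE2] := rot _ _ _ _ _ _ hx1 SE1.
  have [h2|n2] := boolP (v2 \in U); first exact: (hub _ _ _ _ _ _ hx2 SE2).
  have [hx3 SE3] := rot _ _ _ _ _ _ hx2 SE2.
  have [h3|n3] := boolP (v3 \in U); first exact: (hub _ _ _ _ _ _ hx3 SE3).
  have [hx4 SE4] := rot _ _ _ _ _ _ hx3 SE3.
  have [h4|n4] := boolP (v4 \in U); first exact: (hub _ _ _ _ _ _ hx4 SE4).
  have [hx5 SE5] := rot _ _ _ _ _ _ hx4 SE4.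
  have [h5|n5] := boolP (v5 \in U); first exact: (hub _ _ _ _ _ _ hx5 SE5).
  have SY w : w \in S -> w \in Y.
    move=> wS; apply: in_inner; first exact: (subsetP inner).
    move: wS; rewrite SE in_set !in_cons in_nil orbF.
    by do 5!(case/predU1P => [->//|]); move/eqP->.
  have start w0 w1 w2 w3 w4 w5 : hex e w0 w1 w2 w3 w4 w5 -> S = set6 w0 w1 w2 w3 w4 w5 ->
      (w0, w1) \in Cr -> S \in base_sets :|: crossed_sets.
    move=> h SE' c01; have /and3P[_ /and5P[e01 e12 e23 e34 /andP[e45 e50]] _] := h.
    have wY w : w \in [:: w0; w1; w2; w3; w4; w5] -> w \in Y.
      by move=> hw; apply: SY; rewrite SE' in_set.
    apply/setUP; right; apply/setUP; right; apply/imsetP.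
    exists ((((w0, w1), (w2, w5)), (w3, w4))) => //.
    rewrite in_set /= in_set /= c01 !in_setX !in_nbrs e12 e23 (es w0) e50 (es w5) e45.
    by rewrite !wY // !in_cons eqxx ?orbT.
  have sub : {subset [:: v0; v1; v2; v3; v4; v5] <= Y}.
    by move=> w hw; apply: SY; rewrite SE in_set.
  have := blown_hex_cross hx sub.
  have [c|_] := boolP ((v0, v1) \in Cr); first by move=> _;
    apply: (start _ _ _ _ _ _ hx SE).
  have [c|_] := boolP ((v1, v2) \in Cr); first by move=> _;
    apply: (start _ _ _ _ _ _ hx1 SE1).
  have [c|_] := boolP ((v2, v3) \in Cr); first by move=> _;
    apply: (start _ _ _ _ _ _ hx2 SE2).
  have [c|_] := boolP ((v3, v4) \in Cr); first by move=> _;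
    apply: (start _ _ _ _ _ _ hx3 SE3).
  by have [c|_] := boolP ((v4, v5) \in Cr); first by move=> _;
    apply: (start _ _ _ _ _ _ hx4 SE4).
apply/setUP; right.
have inA a b : (a, b) \in all_arcs = e a b by rewrite in_set !in_setT.
have twoX w0 w1 w2 w3 w4 w5 : hex e w0 w1 w2 w3 w4 w5 -> S = set6 w0 w1 w2 w3 w4 w5 ->
    (w0 \in X) || (w1 \in X) -> (w2 \in X) || (w3 \in X) -> S \in outside_sets.
  move=> h SE' x01 x23; have /and3P[_ /and5P[e01 e12 e23 e34 /andP[e45 e50]] _] := h.
  apply/setUP; left; apply/imsetP; exists ((w0, w1), ((w2, w3), (w4, w5))) => //.
  have inO a b : ((a, b) \in outside_arcs) = e a b && ((a \in X) || (b \in X)).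
    by rewrite in_set.
  by rewrite !in_setX inA e45 !inO e01 e23 x01 x23.
have side w0 w1 w2 w3 w4 w5 : hex e w0 w1 w2 w3 w4 w5 -> S = set6 w0 w1 w2 w3 w4 w5 ->
    w0 \in X -> w1 \in Y -> w2 \notin X -> w5 \notin X -> S \in outside_sets.
  move=> h SE' x0 y1; rewrite !in_setC !negbK => i2 i5.
  have /and3P[_ /and5P[e01 e12 e23 e34 /andP[e45 e50]] _] := h.
  apply/setUP; right; apply/setUP; left; apply/imsetP.
  exists (w0, ((w1, w2), (w5, (w3, w4)))) => //.
  by rewrite in_set /= x0 !in_setX in_set /= inA !in_nbrs y1 i2 i5 e01 e12 e34 es e50.
have start w0 w1 w2 w3 w4 w5 : hex e w0 w1 w2 w3 w4 w5 -> S = set6 w0 w1 w2 w3 w4 w5 ->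
    w0 \in X -> S \in outside_sets.
  move=> h SE' x0.
  have [h1 S1] := rot _ _ _ _ _ _ h SE'; have [h2 S2] := rot _ _ _ _ _ _ h1 S1.
  have [h3 S3] := rot _ _ _ _ _ _ h2 S2; have [h4 S4] := rot _ _ _ _ _ _ h3 S3.
  have [h5 S5] := rot _ _ _ _ _ _ h4 S4.
  have [x23|] := boolP ((w2 \in X) || (w3 \in X)).
    by apply: (twoX _ _ _ _ _ _ h SE'); rewrite ?x0.
  rewrite negb_or => /andP[nx2 nx3].
  have [x45|] := boolP ((w4 \in X) || (w5 \in X)).
    by apply: (twoX _ _ _ _ _ _ h4 S4); rewrite ?x0.
  rewrite negb_or => /andP[nx4 nx5].
  have [x1|nx1] := boolP (w1 \in X).
    by apply: (twoX _ _ _ _ _ _ h5 S5); rewrite ?x0 ?x1 ?orbT.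
  have [y1|ny1] := boolP (w1 \in Y); first exact: (side _ _ _ _ _ _ h SE').
  have [h' SE2] := rev _ _ _ _ _ _ h SE'.
  have [y5|ny5] := boolP (w5 \in Y); first exact: (side _ _ _ _ _ _ h' SE2).
  have inner w : w \notin X -> w \in U :|: Y by rewrite in_setC negbK.
  have hubw w : w \notin X -> w \notin Y -> w \in U.
    by move=> /inner; rewrite in_setU => /orP[//|->].
  have U1 := hubw _ nx1 ny1; have U5 := hubw _ nx5 ny5.
  have /and3P[un /and5P[e01 e12 e23 e34 /andP[e45 e50]]] := h.
  move=> /and5P[n02 n03 n04 n13 /and5P[n14 n15 n24 n25 n35]].
  have d15 : w1 != w5.
    by move: un; rewrite /= !inE !negb_or -!andbA; do ![case/andP=> ?]; move=> *.
  (* An outside vertex adjacent to two hubs is adjacent to all three, so a hub in this place would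
     give the chord w0 w3. *)
  have nU3 : w3 \notin U.
    apply/negP => U3; have [_ _ /(_ _ _ _ U1 U5 U3 d15 e01)] := outsideP x0.
    by rewrite es e50 (negPf n03) => /(_ isT).
  apply/setUP; right; apply/setUP; right; apply/imsetP.
  exists (((w0, w3), (w1, w5)), (w2, w4)) => //.
  by rewrite in_set /= !in_setX in_setC !in_nbrs x0 U1 U5 nU3 e34 (es w3) e23 !inner.
have [v vS vX] : exists2 v, v \in S & v \in X.
  by case/subsetPn: notinner => v vS vn; exists v; rewrite // in_setC.
move: vS; rewrite SE in_set !in_cons in_nil orbF -SE.
have [hx1 SE1] := rot _ _ _ _ _ _ hx SE; have [hx2 SE2] := rot _ _ _ _ _ _ hx1 SE1.
have [hx3 SE3] := rot _ _ _ _ _ _ hx2 SE2; have [hx4 SE4] := rot _ _ _ _ _ _ hx3 SE3.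
have [hx5 SE5] := rot _ _ _ _ _ _ hx4 SE4.
case/predU1P => [vE|]; first by subst v; apply: (start _ _ _ _ _ _ hx SE).
case/predU1P => [vE|]; first by subst v; apply: (start _ _ _ _ _ _ hx1 SE1).
case/predU1P => [vE|]; first by subst v; apply: (start _ _ _ _ _ _ hx2 SE2).
case/predU1P => [vE|]; first by subst v; apply: (start _ _ _ _ _ _ hx3 SE3).
case/predU1P => [vE|]; first by subst v; apply: (start _ _ _ _ _ _ hx4 SE4).
by move/eqP => vE; subst v; apply: (start _ _ _ _ _ _ hx5 SE5).
Qed.

Lemma card_hexes_hubs : #|hexes e| <= #|base_sets| + 2592 * #|Cr| +
  ((46 * 46 * 14) * (#|X| ^ 2 * #|V|) + (54 * 9 * 14 + 729) * (#|X| * #|V|)).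
Proof.
apply: (card_subU hexes_cover); last exact: card_outside_sets.
by apply: (card_subU (subxx _)); [|exact: card_crossed_sets].
Qed.
End Hubs.

(** * The extremal count *)

(** The three factors are the part sizes when m is split into three parts as equally as possible. *)
Definition even_split3 (m : nat) : nat := (m %/ 3) * ((m + 1) %/ 3) * ((m + 2) %/ 3).

Definition almost_equal3 (a b c : nat) : bool :=
  [&& a <= b.+1, a <= c.+1, b <= a.+1, b <= c.+1, c <= a.+1 & c <= b.+1].

Lemma almost_equal3_prod a b c : almost_equal3 a b c ->
  a * b * c = even_split3 (a + b + c).
Proof.
case/and5P=> ab ac ba bc /andP[ca cb]; rewrite /even_split3.
have [m [am bm cm]] : exists m, [/\ a = m \/ a = m.+1, b = m \/ b = m.+1 & c = m \/ c =
  m.+1].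
  by exists (minn a (minn b c)); split; lia.
have d0 : (3 * m + 0) %/ 3 = m by lia.
have d1 : (3 * m + 1) %/ 3 = m by lia.
have d2 : (3 * m + 2) %/ 3 = m by lia.
have d3 : (3 * m + 3) %/ 3 = m.+1 by lia.
have d4 : (3 * m + 4) %/ 3 = m.+1 by lia.
have d5 : (3 * m + 5) %/ 3 = m.+1 by lia.
have E k x y z : a + b + c = 3 * m + k -> (3 * m + k) %/ 3 = x ->
    (3 * m + k.+1) %/ 3 = y -> (3 * m + k.+2) %/ 3 = z ->
    (a + b + c) %/ 3 * ((a + b + c + 1) %/ 3) * ((a + b + c + 2) %/ 3) = x * y * z.
  by move=> -> <- <- <-; rewrite -!addnA addn1 addn2.
case: am => am; case: bm => bm; case: cm => cm;
  first [ rewrite (E 0 _ _ _ _ d0 d1 d2); [|by rewrite am bm cm; clear;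
    lia] | rewrite (E 1 _ _ _ _ d1 d2 d3); [|by rewrite am bm cm; clear; lia]
        | rewrite (E 2 _ _ _ _ d2 d3 d4); [|by rewrite am bm cm; clear;
          lia] | rewrite (E 3 _ _ _ _ d3 d4 d5); [|by rewrite am bm cm; clear; lia]];
  rewrite am bm cm; clear; lia.
Qed.

(** Moving a unit from x to y with y + 1 < x lowers the sum of squares and raises the product. The
    increase is strict only when the third factor is positive, hence the premise in the equality
    case. *)
Lemma even_split3_max m a b c : a + b + c = m ->
  a * b * c <= even_split3 m /\
  (0 < a * b * c -> a * b * c = even_split3 m -> almost_equal3 a b c).
Proof.
have [k] := ubnP (a ^ 2 + b ^ 2 + c ^ 2); elim: k a b c => // k IH a b c meas sum.
have [bal|nbal] := boolP (almost_equal3 a b c).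
  by rewrite almost_equal3_prod // sum leqnn.
have step x y z : x ^ 2 + y ^ 2 + z ^ 2 = a ^ 2 + b ^ 2 + c ^ 2 -> x + y + z = m ->
    x * y * z = a * b * c -> y.+1 < x -> a * b * c <= even_split3 m /\
    (0 < a * b * c -> a * b * c = even_split3 m -> false).
  move=> sq s prod yx.
  have [||le _] := IH x.-1 y.+1 z; [|lia|].
    by rewrite -ltnS; apply: leq_trans meas; rewrite ltnS -sq; nia.
  move: prod; case: z => [|z] in sq s le *; first by rewrite muln0 => <-.
  have lt : x * y * z.+1 < x.-1 * y.+1 * z.+1.
    by rewrite ltn_pmul2r //; move: yx; clear; case: x => //= x; nia.
  have := leq_trans lt le => lt2 <-.
  by split; [exact: ltnW|move=> _ E; rewrite E ltnn in lt2].
move: nbal; rewrite /almost_equal3 !negb_and -!ltnNge.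
by do 5?[case/orP]; move=> h; [apply: (step a b c)|apply: (step a c b)|apply: (step b a
  c)|
  apply: (step b c a)|apply: (step c a b)|apply: (step c b a)]; lia.
Qed.

Lemma even_split3_lower m : m ^ 3 <= 27 * even_split3 m + 27 * m.
Proof.
rewrite /even_split3; set q := m %/ 3.
have : m = 3 * q \/ m = 3 * q + 1 \/ m = 3 * q + 2 by rewrite /q; lia.
case=> [|[|]] ->.
- have -> : (3 * q + 1) %/ 3 = q by lia.
  have -> : (3 * q + 2) %/ 3 = q by lia.
  nia.
- have -> : (3 * q + 1 + 1) %/ 3 = q by lia.
  have -> : (3 * q + 1 + 2) %/ 3 = q + 1 by lia.
  nia.
have -> : (3 * q + 2 + 1) %/ 3 = q + 1 by lia.
have -> : (3 * q + 2 + 2) %/ 3 = q + 1 by lia.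
nia.
Qed.

Lemma amgm3_nat a b c : 27 * (a * b * c) <= (a + b + c) ^ 3.
Proof.
have [F _] : exists F : realFieldType, True by exists rat.
have := @amgm3 F a%:R%R b%:R%R c%:R%R (ler0n _ _) (ler0n _ _) (ler0n _ _).
by rewrite -!natrD -!natrM -natrX ler_nat.
Qed.

Section BaseCount.
Variables (V : finType) (e : rel V) (u1 u2 u3 : V).
Hypotheses (es : symmetric e) (ei : irreflexive e).
Local Notation A := (between e u1 u2 u3).
Local Notation B := (between e u2 u3 u1).
Local Notation C := (between e u3 u1 u2).

Lemma base_triples_sub :
  base_triples e u1 u2 u3 \subset setX A (setX B C).
Proof.
by apply/subsetP => -[a [b c]]; rewrite in_set !in_setX /= => /and5P[-> -> -> _ _].
Qed.

Lemma card_base_sets : #|base_sets e u1 u2 u3| <= #|A| * #|B| * #|C|.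
Proof.
rewrite /base_sets; case: ifP => _; first by rewrite cards0.
apply: leq_trans (leq_imset_card _ _) _.
by rewrite -mulnA -!cardsX; apply: subset_leq_card; apply: base_triples_sub.
Qed.

(** A cross edge spoils every triple containing both its ends, and the third entry of such a triple
    ranges over a whole class. *)
Lemma card_base_sets_cross : cross_edges e u1 u2 u3 != set0 ->
  #|base_sets e u1 u2 u3| + minn #|A| (minn #|B| #|C|) <= #|A| * #|B| * #|C|.
Proof.
have miss (W : {set V * (V * V)}) k : W \subset setX A (setX B C) ->
    [disjoint W & base_triples e u1 u2 u3] -> k <= #|W| ->
    #|base_sets e u1 u2 u3| + k <= #|A| * #|B| * #|C|.
  move=> sW dW kW; rewrite -mulnA -!cardsX.
  apply: leq_trans (_ : #|W :|: base_triples e u1 u2 u3| <= _); last first.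
    by apply: subset_leq_card; rewrite subUset sW base_triples_sub.
  move: dW; rewrite -setI_eq0 => /eqP dW; rewrite cardsU dW cards0 subn0 addnC leq_add //.
  rewrite /base_sets; case: ifP => _; first by rewrite cards0.
  exact: leq_imset_card.
move=> /set0Pn[p /cross_edges_parts h].
have case_AB a b : a \in A -> b \in B -> e a b ->
    #|base_sets e u1 u2 u3| + #|C| <= #|A| * #|B| * #|C|.
  move=> aA bB eab; apply: (miss (setX [set a] (setX [set b] C))).
  - by apply: setXS; rewrite ?sub1set // setXS // sub1set.
  - rewrite disjoint_subset; apply/subsetP => -[a' [b' c']].
    rewrite !in_setX !in_set1 /= => /and3P[/eqP-> /eqP-> _].
    by rewrite !inE /= eab !andbF.
  by rewrite !cardsX !cards1 !mul1n.
have case_BC b c : b \in B -> c \in C -> e b c ->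
    #|base_sets e u1 u2 u3| + #|A| <= #|A| * #|B| * #|C|.
  move=> bB cC ebc; apply: (miss (setX A (setX [set b] [set c]))).
  - by apply: setXS => //; apply: setXS; rewrite sub1set.
  - rewrite disjoint_subset; apply/subsetP => -[a' [b' c']].
    rewrite !in_setX !in_set1 /= => /and3P[_ /eqP-> /eqP->].
    by rewrite !inE /= ebc !andbF.
  by rewrite !cardsX !cards1 !muln1.
have case_CA c a : c \in C -> a \in A -> e c a ->
    #|base_sets e u1 u2 u3| + #|B| <= #|A| * #|B| * #|C|.
  move=> cC aA eca; apply: (miss (setX [set a] (setX B [set c]))).
  - by apply: setXS; rewrite ?sub1set // setXS // sub1set.
  - rewrite disjoint_subset; apply/subsetP => -[a' [b' c']].
    rewrite !in_setX !in_set1 /= => /and3P[/eqP-> _ /eqP->].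
    by rewrite !inE /= eca !andbF.
  by rewrite !cardsX !cards1 muln1 mul1n.
have mA := geq_minl #|A| (minn #|B| #|C|).
have mB : minn #|A| (minn #|B| #|C|) <= #|B| by rewrite !geq_min leqnn orbT.
have mC : minn #|A| (minn #|B| #|C|) <= #|C| by rewrite !geq_min leqnn !orbT.
have fin k : minn #|A| (minn #|B| #|C|) <= k ->
   #|base_sets e u1 u2 u3| + k <= #|A| * #|B| * #|C| ->
   #|base_sets e u1 u2 u3| + minn #|A| (minn #|B| #|C|) <= #|A| * #|B| * #|C|.
  by move=> le; apply: leq_trans; rewrite leq_add2l.
case: h => [] []; rewrite in_set => /and3P[h1 h2 h3].
- exact: fin mC (case_AB _ _ h1 h2 h3).
- by apply: fin mC (case_AB _ _ h2 h1 _); rewrite es.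
- exact: fin mA (case_BC _ _ h1 h2 h3).
- by apply: fin mA (case_BC _ _ h2 h1 _); rewrite es.
- exact: fin mB (case_CA _ _ h1 h2 h3).
by apply: fin mB (case_CA _ _ h2 h1 _); rewrite es.
Qed.

End BaseCount.

(** Adding the x outside vertices to the s vertices of the classes would raise s^3 by at least 3 s^2
    x, which is at least 3/4 of n^2 x because n <= 2 s. As 216 = 8 * 27, the assumptions bound the
    two groups of error terms by n^2 x / 8 each, with room for the rounding term 27 n. *)
Lemma outside_loses (n a b c x h c0 k1 k2 : nat) :
  n = 3 + (a + b + c) + x -> 0 < x -> 2 * (3 + x) <= n ->
  216 * k1 * x <= n -> 216 * (c0 + k2 + 1) <= n ->
  h <= a * b * c + c0 + (k1 * (x ^ 2 * n) + k2 * (x * n)) ->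
  h < even_split3 (n - 3).
Proof.
move=> nE x0 c1 c2 c3 hle.
have := amgm3_nat a b c; have := even_split3_lower (n - 3).
have {hle} : 27 * h <= 27 * (a * b * c) + 27 * c0 + (27 * k1 * (x ^ 2 * n) + 27 * k2 *
  (x * n)).
  by move: hle; clear; lia.
move: (a * b * c) (even_split3 _) => p g.
move sE : (a + b + c) => s in nE *.
have -> : n - 3 = s + x by move: nE; clear; lia.
have t1 : 8 * (27 * k1 * (x ^ 2 * n)) <= n ^ 2 * x.
  have : 216 * k1 * x * (x * n) <= n * (x * n) by rewrite leq_mul2r c2 orbT.
  by clear; nia.
have t2 : 216 * (c0 + k2 * (x * n) + n) <= n ^ 2 * x.
  have : 216 * (c0 + k2 + 1) * (n * x) <= n * (n * x) by rewrite leq_mul2r c3 orbT.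
  have : c0 <= c0 * (n * x) by rewrite -[X in X <= _]muln1 leq_mul2l muln_gt0 x0 andbT;
    move: c1; clear; lia.
  have : n <= n * x by rewrite -[X in X <= _]muln1 leq_mul2l x0 orbT.
  by clear; nia.
have ns : n <= 2 * s by move: nE c1; clear; lia.
have t3 : 3 * (n ^ 2 * x) <= 12 * (s ^ 2 * x).
  have : n ^ 2 <= (2 * s) ^ 2 by rewrite leq_sqr.
  move: (n ^ 2) => m; rewrite expnMn -[2 ^ 2]/4 => le.
  have : m * x <= 4 * s ^ 2 * x by rewrite leq_mul2r le orbT.
  by clear; lia.
have t4 : (s + x) ^ 3 = s ^ 3 + 3 * (s ^ 2 * x) + (3 * (s * x ^ 2) + x ^ 3) by clear; nia.
have t5 : 0 < n ^ 2 * x by rewrite muln_gt0 x0 andbT expn_gt0; move: c1; clear; lia.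
rewrite t4; have : s + x <= n by move: nE; clear; lia.
move: t1 t2 t3 t5; clear.
move: (n ^ 2 * x) (s ^ 2 * x) (s ^ 3) (3 * _ + _) (x ^ 2 * n) (x * n) => P1 P2 P3 P4 P5
  P6.
nia.
Qed.

Lemma card_parts (V : finType) (e : rel V) (u1 u2 u3 : V) :
  uniq [:: u1; u2; u3] -> symmetric e -> irreflexive e ->
  #|V| = 3 + (#|between e u1 u2 u3| + #|between e u2 u3 u1| + #|between e u3 u1 u2|)
         + #|outside e u1 u2 u3|.
Proof.
move=> un es ei; rewrite -(cardsC (hub_set u1 u2 u3 :|: blown_up e u1 u2 u3)).
congr (_ + _).
have disj (S T : {set V}) : (forall v, v \in S -> v \in T -> False) -> #|S :|: T| =
  #|S| + #|T|.
  move=> ST; rewrite cardsU (_ : S :&: T = set0) ?cards0 ?subn0 //.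
  by apply/setP => v; rewrite in_setI in_set0; apply/negP => /andP[/ST].
rewrite disj => [|v vU /(blown_not_hub ei)]; last by rewrite vU.
rewrite card_hub_set //; congr (_ + _); rewrite /blown_up !disj //.
- move=> v; rewrite !in_between => /and4P[_ v1 v2 v3] /and4P[_ _ v3' _].
  by rewrite v3' in v3.
move=> v; rewrite in_setU !in_between => /orP[]/and4P[_ h1 h2 h3] /and4P[_ h4 h5 h6].
  by rewrite h4 in h3.
by rewrite h5 in h3.
Qed.

Definition hexagon_blowup (V : finType) (e : rel V) (u1 u2 u3 : V) : Prop :=
  [/\ outside e u1 u2 u3 = set0, cross_edges e u1 u2 u3 = set0,
      ~~ hubs_adjacent e u1 u2 u3 &
      [/\ between e u1 u2 u3 != set0, between e u2 u3 u1 != set0,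
          between e u3 u1 u2 != set0 &
          almost_equal3 #|between e u1 u2 u3| #|between e u2 u3 u1| #|between e u3 u1
            u2|]].

Theorem planar_hexes_upper : exists n0 : nat, forall (V : finType) (e : rel V),
  symmetric e -> irreflexive e -> van_kampen e -> n0 <= #|V| ->
  #|hexes e| <= even_split3 (#|V| - 3) /\
  (#|hexes e| = even_split3 (#|V| - 3) ->
   exists u1 u2 u3, uniq [:: u1; u2; u3] /\ hexagon_blowup e u1 u2 u3).
Proof.
have [c0 [k1 [k2 hexes_bound]]] : exists c0 k1 k2, forall (V : finType) (e : rel V) u1
  u2 u3,
    symmetric e -> irreflexive e -> van_kampen e -> uniq [:: u1; u2; u3] ->
    between e u1 u2 u3 != set0 -> between e u2 u3 u1 != set0 -> between e u3 u1 u2 !=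
      set0 ->
    #|hexes e| <= #|base_sets e u1 u2 u3| + c0 * #|cross_edges e u1 u2 u3| +
                  (k1 * (#|outside e u1 u2 u3| ^ 2 * #|V|)
                   + k2 * (#|outside e u1 u2 u3| * #|V|)).
  exists 2592, (46 * 46 * 14), (54 * 9 * 14 + 729) => V e u1 u2 u3 es ei vk un A0 B0 C0.
  exact: card_hexes_hubs.
(* Covering all but n / K vertices bounds the number x of outside vertices; the summand 216 * k1
   gives 216 k1 x <= n, as [outside_loses] requires, and 1200 is the demand of stability. *)
have [n1 stable] := @hub_structure (1200 + 216 * k1) (leq_addr _ _).
(* The last summand makes each class, having at least n / 20 vertices, larger than c0 * 48, the most
   that cross edges can gain. *)
exists (n1 + 216 * (c0 * 48 + k2 + 1) + 20 * (c0 * 48 + 1)) => V e es ei vk nlarge.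
have [few|many] := ltnP #|hexes e| (even_split3 (#|V| - 3)).
  by split=> [|E]; [exact: ltnW|rewrite E ltnn in few].
have n1le : n1 <= #|V| by apply: leq_trans nlarge; rewrite -addnA leq_addr.
have c3 : 216 * (c0 * 48 + k2 + 1) <= #|V|.
  by apply: leq_trans nlarge; apply: leq_trans (leq_addl n1 _) (leq_addr _ _).
have c4 : 20 * (c0 * 48 + 1) <= #|V| by apply: leq_trans nlarge; rewrite leq_addl.
have big : #|V| ^ 3 <= 27 * #|hexes e| + 27 * #|V| ^ 2.
  have := even_split3_lower (#|V| - 3); move: many c4; clear.
  move: #|V| #|hexes e| (even_split3 _) => n h g many c4 le.
  have [m nE] : exists m, n = m + 3 by exists (n - 3); lia.
  rewrite nE addnK in le *; move: many le; clear; nia.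
have [u1 [u2 [u3 [un Kn [nA nB nC]]]]] := stable V e es ei vk n1le big.
have part := card_parts un es ei.
have cross48 := card_cross_edges es ei vk un.
have ne0 (S : {set V}) : #|V| <= 20 * #|S| -> S != set0.
  move=> le; rewrite -card_gt0; move: le c4; clear; lia.
have A0 := ne0 _ nA; have B0 := ne0 _ nB; have C0 := ne0 _ nC.
have bound := hexes_bound V e u1 u2 u3 es ei vk un A0 B0 C0.
have base := card_base_sets e u1 u2 u3.
have base_cross := card_base_sets_cross (e := e) (u1 := u1) (u2 := u2) (u3 := u3) es.
have [X0|Xn0] := eqVneq (outside e u1 u2 u3) set0; last first.
  suff : #|hexes e| < even_split3 (#|V| - 3) by rewrite ltnNge many.
  rewrite -card_gt0 in Xn0.
  apply: (outside_loses (c0 := c0 * 48) (k1 := k1) (k2 := k2) part Xn0) => //.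
  - by move: Kn part; clear; nia.
  - by move: Kn part; clear; nia.
  apply: leq_trans bound _; rewrite leq_add2r; apply: leq_add base _.
  by rewrite leq_mul2l cross48 orbT.
rewrite X0 cards0 exp0n // !mul0n !muln0 !addn0 in bound.
rewrite X0 cards0 addn0 in part.
have [le_max eq_max] := even_split3_max (erefl (#|between e u1 u2 u3| +
   #|between e u2 u3 u1| + #|between e u3 u1 u2|)).
have partE : #|between e u1 u2 u3| + #|between e u2 u3 u1| + #|between e u3 u1 u2| =
  #|V| - 3.
  by rewrite part addKn.
rewrite partE in le_max eq_max.
have prod_pos : 0 < #|between e u1 u2 u3| * #|between e u2 u3 u1| * #|between e u3 u1 u2|.
  by rewrite !muln_gt0 !card_gt0 A0 B0 C0.
have [Cr0|Crn0] := eqVneq (cross_edges e u1 u2 u3) set0; last first.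
  suff : #|hexes e| < even_split3 (#|V| - 3) by rewrite ltnNge many.
  have small : c0 * #|cross_edges e u1 u2 u3| <= c0 * 48 by rewrite leq_mul2l cross48
    orbT.
  have := base_cross Crn0; move: bound small le_max c4 nA nB nC; clear.
  move: (c0 * #|_|) (c0 * 48) (_ * _ * _) #|base_sets _ _ _ _| => p q r b.
  move: #|hexes _| #|V| #|between _ _ _ _| #|between _ _ _ _| #|between _ _ _ _|
    (even_split3 _).
  move=> *; lia.
rewrite Cr0 cards0 !muln0 !addn0 in bound.
have hexle : #|hexes e| <= even_split3 (#|V| - 3).
  exact: leq_trans bound (leq_trans base le_max).
split=> // hexE; exists u1, u2, u3; split=> //; split=> //.
  apply/negP => adj; move: bound; rewrite /base_sets adj cards0 leqn0 => /eqP h0.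
  by move: prod_pos; rewrite ltnNge; rewrite h0 in hexE; rewrite -hexE in le_max;
    rewrite le_max.
split=> //; apply: eq_max => //; apply/eqP; rewrite eqn_leq le_max -hexE /=.
exact: leq_trans bound base.
Qed.

(** * Linear arrangements and membership in the extremal family *)

Lemma infix_pair_cat (T : eqType) (x y : T) (l r : seq T) :
  infix [:: x; y] (l ++ r) ->
  infix [:: x; y] l \/ infix [:: x; y] r \/
  (exists l' r', l = rcons l' x /\ r = y :: r').
Proof.
move=> /infixP[p [s E]]; have [le|gt] := leqP (size p + 2) (size l).
  left; apply/infixP; exists p, (drop (size p + 2) l).
  rewrite -{1}(cat_take_drop (size p + 2) l) catA; congr (_ ++ _).
  have := congr1 (take (size p + 2)) E; rewrite takel_cat // => ->.
  by rewrite catA take_size_cat // size_cat.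
have [le|gt2] := leqP (size l) (size p).
  right; left; apply/infixP; exists (drop (size l) p), s.
  have := congr1 (drop (size l)) E; rewrite drop_size_cat // => ->.
  by rewrite drop_cat; case: ltngtP le => // sE _; rewrite sE subnn drop0 drop_size.
right; right; exists p, s.
have sl : size l = (size p).+1 by lia.
have := congr1 (take (size p).+1) E; rewrite -{1}sl take_size_cat // => ->.
have := congr1 (drop (size p).+1) E; rewrite -{1}sl drop_size_cat // => ->.
have -> : p ++ [:: x; y] ++ s = rcons p x ++ y :: s by rewrite cat_rcons.
by rewrite take_size_cat ?size_rcons // drop_size_cat ?size_rcons.
Qed.

Lemma infix_pair_insert (T : eqType) (x y v : T) (l r : seq T) :
  infix [:: x; y] (l ++ r) ->
  infix [:: x; y] (l ++ v :: r) \/ (exists l' r', l = rcons l' x /\ r = y :: r').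
Proof.
case/infix_pair_cat => [h|[h|h]]; [left|left|right] => //.
  exact: infix_catr.
by apply: infix_catl; apply: infix_trans h (infix_cons _ _).
Qed.

(* Remove a vertex v of degree at most one; when v has a neighbour w, insert v
   right before or right after w in the arrangement of the other vertices: as w
   has degree at most two, one of the two positions separates no edge. *)
Lemma linear_forest (V : finType) (e : rel V) (W : {set V}) :
  symmetric e -> irreflexive e ->
  {in W, forall v, #|nbrs e W v| <= 2} ->
  (forall W' : {set V}, W' \subset W -> degsum e W' <= 2 * #|W'|.-1) ->
  exists s : seq V, perm_eq s (enum W) /\
    {in W &, forall x y, e x y -> infix [:: x; y] s \/ infix [:: y; x] s}.
Proof.
move=> es ei; have [m] := ubnP #|W|; elim: m W => // m IH W Wm deg2 forest.
have [W0|W0] := eqVneq W set0.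
  by exists [::]; rewrite W0 enum_set0; split=> // x y; rewrite in_set0.
have [v vW dv] : exists2 v, v \in W & #|nbrs e W v| <= 1.
  apply/exists_inP; apply: contraT; rewrite negb_exists_in => /forall_inP big.
  have : 2 * #|W| <= degsum e W.
    by rewrite mulnC -sum_nat_const; apply: leq_sum => v /big; rewrite -ltnNge.
  have := forest W (subxx _); have : 0 < #|W| by rewrite card_gt0.
  by clear; lia.
have sub : W :\ v \subset W by apply: subD1set.
have nsub w : nbrs e (W :\ v) w \subset nbrs e W w.
  by apply/subsetP => z; rewrite !in_set => /andP[/andP[_ ->] ->].
have [|w wW|W' W'W|s [sW se]] := IH (W :\ v).
- by move: Wm; rewrite (cardsD1 v W) vW.
- by apply: leq_trans (subset_leq_card (nsub w)) (deg2 w (subsetP sub _ wW)).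
- by apply: forest; apply: subset_trans W'W sub.
have memS x : x \in s = (x \in W :\ v) by rewrite (perm_mem sW) mem_enum.
have us : uniq s by rewrite (perm_uniq sW) enum_uniq.
have permW s' : perm_eq s' (v :: s) -> perm_eq s' (enum W).
  move=> h; apply: perm_trans h _; apply: uniq_perm; rewrite ?enum_uniq //=.
    by rewrite us memS !inE eqxx.
  by move=> x; rewrite in_cons memS mem_enum in_setD1; case: eqP => // ->.
have extend s' : perm_eq s' (v :: s) ->
    (forall x y, x \in W :\ v -> y \in W :\ v -> e x y ->
       infix [:: x; y] s -> infix [:: x; y] s') ->
    (forall w, w \in W -> e v w -> infix [:: v; w] s' \/ infix [:: w; v] s') ->
    exists s : seq V, perm_eq s (enum W) /\
      {in W &, forall x y, e x y -> infix [:: x; y] s \/ infix [:: y; x] s}.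
  move=> ps keep new; exists s'; split; first exact: permW.
  move=> x y xW yW exy; have [xv|xv] := eqVneq x v.
    by rewrite xv in exy *; apply: new.
  have [yv|yv] := eqVneq y v.
    rewrite yv in exy *; have [||] := new x xW; [by rewrite es|by right|by left].
  have xW' : x \in W :\ v by rewrite in_setD1 xv.
  have yW' : y \in W :\ v by rewrite in_setD1 yv.
  have [h|h] := se x y xW' yW' exy; [left|right]; apply: keep => //.
  by rewrite es.
have [/eqP|] := boolP (nbrs e W v == set0).
  move=> N0; apply: (extend (v :: s)) => // [x y _ _ _ h|w wW evw].
    exact: infix_trans h (infix_cons _ _).
  by have := in_set0 w; rewrite -N0 in_set wW evw.
move=> /set0Pn[w]; rewrite in_set => /andP[wW evw].
have only z : z \in W -> e v z -> z = w.
  move=> zW evz; apply/eqP; apply: contraTT dv => zw; rewrite -ltnNge.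
  by apply/card_gt1P; exists z, w; rewrite !in_set zW wW evz evw.
have wv : w != v by apply: contraTneq evw => ->; rewrite ei.
have wS : w \in s by rewrite memS in_setD1 wv.
have [s1 [s2 sE]] : exists s1 s2, s = s1 ++ w :: s2.
  by case/splitPr: wS => s1 s2; exists s1, s2.
subst s.
have third z z' : z \in W :\ v -> z' \in W :\ v -> z != z' -> e w z -> e w z' -> False.
  rewrite !in_setD1 => /andP[zv zW] /andP[zv' zW'] zz ez ez'.
  have := deg2 w wW; rewrite leqNgt => /negP[]; apply/card_gt2P.
  exists z, z', v; rewrite !in_set zW zW' vW ez ez' (es w v) evw.
  by split; split; rewrite // eq_sym.
have [right_ok|] := boolP [forall z, ~~ (e w z && (ohead s2 == Some z))].
  apply: (extend (rcons s1 w ++ v :: s2)).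
  - by rewrite -(cat_rcons w s1 s2) -[v :: s2]/([:: v] ++ s2) perm_catCA perm_refl.
  - move=> x y xW yW exy; rewrite -(cat_rcons w s1 s2) => /(infix_pair_insert v)[//|].
    move=> [l' [r' [/rcons_inj[_ wE] s2E]]]; have /forallP/(_ y) := right_ok.
    by rewrite s2E /= eqxx andbT wE exy.
  move=> z zW evz; right; rewrite (only z zW evz); apply/infixP; exists s1, s2.
  by rewrite cat_rcons.
rewrite negb_forall => /existsP[z]; rewrite negbK => /andP[ewz /eqP hz].
apply: (extend (s1 ++ v :: w :: s2)).
- by rewrite -[v :: w :: s2]/([:: v] ++ (w :: s2)) perm_catCA perm_refl.
- move=> x y xW yW exy /(infix_pair_insert v)[//|].
  move=> [l' [r' [s1E [yE _]]]]; exfalso; subst y.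
  have zs2 : z \in s2 by move: hz; clear; case: s2 => //= a l [->]; rewrite mem_head.
  apply: (third z x) => //; last by rewrite es.
    by rewrite -memS mem_cat in_cons zs2 !orbT.
  move: us; rewrite s1E cat_uniq => /and3P[_ /hasPn h _].
  have := h z; rewrite in_cons zs2 orbT mem_rcons in_cons negb_or => /(_ isT) /andP[].
  by [].
move=> y yW evy; left; rewrite (only y yW evy); apply/infixP; exists s1, s2.
by [].
Qed.

Section InducedHexagons.
Variables (V : finType) (G : sgraph V).

Lemma adj_sym : symmetric (adj G).
Proof. by move=> x y; rewrite /adj setUC. Qed.

Lemma edges_card2 f : f \in edges G -> #|f| = 2.
Proof. by have /forall_inP h := edgesP G; move=> /h /eqP. Qed.

Lemma adj_irr : irreflexive (adj G).
Proof.
by move=> x; apply/negP => /edges_card2; rewrite setUid cards1.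
Qed.

Lemma adj_of_rel (W : finType) (r : rel W) x y :
  adj (sgraph_of_rel r) x y = (x != y) && (r x y || r y x).
Proof.
rewrite /adj /=; apply/imsetP/andP => [[[a b]]|[xy /orP[rxy|ryx]]].
- rewrite inE /= => /andP[ab rab] E.
  have : a \in [set x; y] by rewrite E !inE eqxx.
  have : b \in [set x; y] by rewrite E !inE eqxx orbT.
  rewrite !inE => /orP[] /eqP ? /orP[] /eqP ?; subst a b; rewrite ?eqxx // in ab *.
    by rewrite eq_sym ab rab orbT.
  by rewrite ab rab.
- by exists (x, y); rewrite // inE /= xy rxy.
by exists (y, x); rewrite ?inE /= 1?eq_sym ?xy ?ryx // setUC.
Qed.

Lemma induced_copy_hexes S : induced_copy G (cycle_graph 6) S = (S \in hexes (adj G)).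
Proof.
pose o k (h : k < 6) := Ordinal h.
have ordE (i : 'I_6) : [\/ i = @o 0 isT, i = @o 1 isT | [\/ i = @o 2 isT, i = @o 3 isT,
    i = @o 4 isT | i = @o 5 isT]].
  case: i => -[|[|[|[|[|[|//]]]]]] h.
  - by constructor 1; apply/val_inj.
  - by constructor 2; apply/val_inj.
  - by constructor 3; constructor 1; apply/val_inj.
  - by constructor 3; constructor 2; apply/val_inj.
  - by constructor 3; constructor 3; apply/val_inj.
  by constructor 3; constructor 4; apply/val_inj.
apply/existsP/hexesP.
  move=> [f /and3P[/injectiveP inj /eqP <- /forallP h]].
  have {h} h x y : adj G (f x) (f y) = (x != y) && ((y == ordS x) || (x == ordS y)).
    by have /forallP/(_ y)/eqP-> := h x; rewrite adj_of_rel.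
  exists (f (@o 0 isT)), (f (@o 1 isT)), (f (@o 2 isT)), (f (@o 3 isT)), (f (@o 4
    isT)), (f (@o 5 isT)).
  split.
    rewrite /hex !h /= !inE !(inj_eq inj) /=.
    by vm_compute.
  apply/setP => v; rewrite /set6 in_set !in_cons in_nil orbF.
  apply/imsetP/idP => [[i _ ->]|].
    by case: (ordE i) => [->|->|[]->]; rewrite eqxx ?orbT.
  by do 5?[case/predU1P => [->|]]; try move/eqP=> ->; eexists.
move=> [v0 [v1 [v2 [v3 [v4 [v5 [hx ->]]]]]]].
have /and3P[un /and5P[e01 e12 e23 e34 /andP[e45 e50]]] := hx.
move=> /and5P[n02 n03 n04 n13 /and5P[n14 n15 n24 n25 n35]].
pose s := [:: v0; v1; v2; v3; v4; v5].
exists [ffun i : 'I_6 => nth v0 s i]; apply/and3P; split.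
- apply/injectiveP => i j; rewrite !ffunE => /eqP.
  by rewrite nth_uniq ?(ltn_ord i) ?(ltn_ord j) // => /eqP /val_inj.
- apply/eqP/setP => v; rewrite in_set; apply/imsetP/idP => [[i _ ->]|].
    by rewrite ffunE mem_nth //= ltn_ord.
  move=> vs; have iv : index v s < 6 by rewrite -[6]/(size s) index_mem.
  by exists (Ordinal iv); rewrite // ffunE /= nth_index.
apply/forallP => i; apply/forallP => j; rewrite !ffunE adj_of_rel.
have sy := adj_sym.
by case: (ordE i) => [->|->|[]->]; case: (ordE j) => [->|->|[]->]; rewrite /s /=;
  apply/eqP; rewrite ?adj_irr ?e01 ?e12 ?e23 ?e34 ?e45 ?e50 ?(negPf n02) ?(negPf n03)
   ?(negPf n04) ?(negPf n13) ?(negPf n14) ?(negPf n15) ?(negPf n24) ?(negPf n25)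
     ?(negPf n35)
   1?sy ?e01 ?e12 ?e23 ?e34 ?e45 ?e50 ?(negPf n02) ?(negPf n03)
   ?(negPf n04) ?(negPf n13) ?(negPf n14) ?(negPf n15) ?(negPf n24) ?(negPf n25)
     ?(negPf n35); vm_compute.
Qed.

Lemma num_induced_hexes : num_induced G (cycle_graph 6) = #|hexes (adj G)|.
Proof.
by congr #|pred_of_set _|; apply/setP => S; rewrite in_set induced_copy_hexes.
Qed.
End InducedHexagons.

Lemma balanced3P k l m : reflect (balanced3 k l m) (almost_equal3 k l m).
Proof.
apply: (iffP idP) => [h i j|h].
  rewrite !inE; case/and5P: h => ? ? ? ? /andP[? ?].
  by do ![case/or3P => /eqP->|].
by rewrite /almost_equal3 !h // !inE eqxx ?orbT.
Qed.

Section Family.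
Variables (V : finType) (G : sgraph V).
Local Notation e := (adj G).

Lemma edge_adj (f : {set V}) : f \in edges G -> exists x y, f = [set x; y] /\ e x y.
Proof.
move=> fG; have /eqP/cards2P[x [y [_ fE]]] := edges_card2 fG.
by exists x, y; split=> //; rewrite /adj -fE.
Qed.

(** One vertex from each class and the three hubs span a hexagon: all edges besides the hub edges
    join consecutive terms of a labeling, so they stay within a class and give no chord. *)
Lemma family_hexes : extremal_family G -> even_split3 (#|V| - 3) <= #|hexes e|.
Proof.
move=> [u1 [u2 [u3 [A [B [C]]]]]].
set hub_edges := (_ :|: _); case=> -[un dAB dBC dAC cover] bal /subsetP hubG.
move=> [sa [sb [sc [pa pb pc rest]]]].
have es := adj_sym G; have ei := @adj_irr _ G.
have [h12 [h13 h23]] : u1 != u2 /\ u1 != u3 /\ u2 != u3.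
  by move: un; rewrite /= !inE negb_or => /and3P[/andP[-> ->] -> _].
have part v : [|| v \in A, v \in B | v \in C] = (v \notin [set u1; u2; u3]).
  by move/setP/(_ v): cover; rewrite !in_setU in_setC -orbA !in_setU.
have notU v : [|| v \in A, v \in B | v \in C] -> [/\ v != u1, v != u2 & v != u3].
  by rewrite part !inE !negb_or -andbA => /and3P.
have AB v : v \in A -> v \in B = false by move=> vA; rewrite (disjointFr dAB).
have BC v : v \in B -> v \in C = false by move=> vB; rewrite (disjointFr dBC).
have AC v : v \in A -> v \in C = false by move=> vA; rewrite (disjointFr dAC).
have path_in s (S : {set V}) p q : perm_eq s (enum S) -> path_edge s [set p; q] ->
    (p \in S) && (q \in S).
  move=> ps [x [y [/mem_infix inf E]]].
  have inS z : z \in [set p; q] -> z \in S.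
    rewrite E !inE => zxy; rewrite -mem_enum -(perm_mem ps); apply: inf.
    by rewrite !inE.
  by rewrite !inS // !inE eqxx ?orbT.
pose ok p q := [|| (p \in A) && ((q == u1) || (q == u2)),
  (p \in B) && ((q == u2) || (q == u3)) | (p \in C) && ((q == u3) || (q == u1))].
have adjP p q : e p q -> [|| (p \in A) && (q \in A), (p \in B) && (q \in B),
    (p \in C) && (q \in C), ok p q | ok q p].
  move=> epq; have [hub|nhub] := boolP ([set p; q] \in hub_edges); last first.
    have [h|h|h] := rest _ epq nhub.
    - by rewrite (path_in _ _ _ _ pa h).
    - by rewrite (path_in _ _ _ _ pb h) orbT.
    by rewrite (path_in _ _ _ _ pc h) !orbT.
  have pair x u : [set p; q] = [set x; u] -> (p == x) && (q == u) || (q == x) && (p == u).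
    have pq : p != q by apply: contraTneq epq => ->; rewrite ei.
    move=> E; have : p \in [set x; u] by rewrite -E !inE eqxx.
    have : q \in [set x; u] by rewrite -E !inE eqxx orbT.
    rewrite !inE => /orP[] /eqP ? /orP[] /eqP ?; subst p q; rewrite ?eqxx ?orbT //;
      by rewrite eqxx in pq.
  suff : ok p q || ok q p by case/orP => ->; rewrite !orbT.
  move: hub; rewrite /hub_edges !in_setU /ok -!orbA.
  by case/or4P => [|||/or3P[]] /imsetP[x xS /pair /orP[] /andP[/eqP-> /eqP->]];
    rewrite xS !eqxx ?orbT.
have hub x u : ok x u -> e x u.
  move=> h; apply: hubG; move: h; rewrite /ok /hub_edges !in_setU -!orbA.
  case/or3P => /andP[xS /orP[] /eqP->].
  - by rewrite (imset_f (fun x => [set x; u1]) xS) ?orbT.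
  - by rewrite (imset_f (fun x => [set x; u2]) xS) ?orbT.
  - by rewrite (imset_f (fun x => [set x; u2]) xS) ?orbT.
  - by rewrite (imset_f (fun x => [set x; u3]) xS) ?orbT.
  - by rewrite (imset_f (fun x => [set x; u3]) xS) ?orbT.
  by rewrite (imset_f (fun x => [set x; u1]) xS) ?orbT.
have [nA nB nC] : [/\ forall v, v \in A -> [/\ v != u1, v != u2 & v != u3],
   forall v, v \in B -> [/\ v != u1, v != u2 & v != u3] &
   forall v, v \in C -> [/\ v != u1, v != u2 & v != u3]].
  by split=> v vS; apply: notU; rewrite vS ?orbT.
have [A1 A2 A3] : [/\ (u1 \in A) = false, (u2 \in A) = false & (u3 \in A) = false].
  by split; apply/negP => /nA[]; rewrite eqxx.
have [B1 B2 B3] : [/\ (u1 \in B) = false, (u2 \in B) = false & (u3 \in B) = false].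
  by split; apply/negP => /nB[]; rewrite eqxx.
have [C1 C2 C3] : [/\ (u1 \in C) = false, (u2 \in C) = false & (u3 \in C) = false].
  by split; apply/negP => /nC[]; rewrite eqxx.
pose f (t : V * (V * V)) := set6 u1 t.1 u2 t.2.1 u3 t.2.2.
have sizes : #|setX A (setX B C)| = even_split3 (#|V| - 3).
  rewrite !cardsX mulnA; move/balanced3P/almost_equal3_prod: bal => ->; congr even_split3.
  have : #|A :|: B :|: C| = #|A| + #|B| + #|C|.
    rewrite cardsU (_ : (A :|: B) :&: C = set0).
      rewrite cards0 subn0 cardsU (_ : A :&: B = set0) ?cards0 ?subn0 //.
      by apply/eqP; rewrite setI_eq0.
    apply/setP => v; rewrite !inE; apply/negP => /andP[/orP[/AC->|/BC->]] //.
  rewrite cover => <-; rewrite -(cardsC [set u1; u2; u3]).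
  have -> : #|[set u1; u2; u3]| = 3.
    by rewrite -setUA !cardsU1 !inE cards1 negb_or h12 h13 h23.
  by rewrite addKn.
rewrite -sizes.
have f_inj : {in setX A (setX B C) &, injective f}.
  move=> [a [b c]] [a' [b' c']]; rewrite !in_setX.
  move=> /and3P[aA bB cC] /and3P[aA' bB' cC'] /setP E.
  have [a1 a2 a3] := nA a aA; have [b1 b2 b3] := nB b bB; have [c1 c2 c3] := nC c cC.
  have ne (S T : pred V) v w : S v -> T w -> (forall z, S z -> T z = false) -> v != w.
    by move=> Sv Tw ST; apply/eqP => vw; rewrite vw in Sv; rewrite ST in Tw.
  have ab' : a != b' by apply: (ne (mem A) (mem B)).
  have ac' : a != c' by apply: (ne (mem A) (mem C)).
  have bc' : b != c' by apply: (ne (mem B) (mem C)).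
  have a'b : a' != b by apply: (ne (mem A) (mem B)).
  have a'c : a' != c by apply: (ne (mem A) (mem C)).
  have b'c : b' != c by apply: (ne (mem B) (mem C)).
  move: (E a) (E b) (E c); rewrite /f /= !inE !eqxx !orbT.
  rewrite (negPf a1) (negPf a2) (negPf a3) (negPf b1) (negPf b2) (negPf b3).
  rewrite (negPf c1) (negPf c2) (negPf c3) (negPf ab') (negPf ac') (negPf bc').
  rewrite (eq_sym b) (negPf a'b) (eq_sym c) (negPf a'c) (eq_sym c) (negPf b'c).
  by rewrite /= ?orbF => /esym/eqP-> /esym/eqP-> /esym/eqP->.
rewrite -(card_in_imset f_inj); apply: subset_leq_card; apply/subsetP => S.
move=> /imsetP[[a [b c]] + ->]; rewrite !in_setX => /and3P[aA bB cC].
have [a1 a2 a3] := nA a aA; have [b1 b2 b3] := nB b bB; have [c1 c2 c3] := nC c cC.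
have [ab ac bc] : [/\ a != b, a != c & b != c].
  split; apply/eqP => E; subst; [have := AB b aA|have := AC c aA|have := BC c bB];
    by rewrite ?bB ?cC.
have AB' v : v \in B -> v \in A = false by move=> vB; apply/negP => /AB; rewrite vB.
have AC' v : v \in C -> v \in A = false by move=> vC; apply/negP => /AC; rewrite vC.
have BC' v : v \in C -> v \in B = false by move=> vC; apply/negP => /BC; rewrite vC.
apply/hexesP; exists u1, a, u2, b, u3, c; split=> //.
have inA := (aA, AB a aA, AC a aA).
have inB := (bB, AB' b bB, BC b bB).
have inC := (cC, AC' c cC, BC' c cC).
have e1 : e a u1 by apply: hub; rewrite /ok aA eqxx.
have e2 : e a u2 by apply: hub; rewrite /ok aA eqxx orbT.
have e3 : e b u2 by apply: hub; rewrite /ok bB eqxx ?orbT.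
have e4 : e b u3 by apply: hub; rewrite /ok bB eqxx ?orbT.
have e5 : e c u3 by apply: hub; rewrite /ok cC eqxx ?orbT.
have e6 : e c u1 by apply: hub; rewrite /ok cC eqxx ?orbT.
have neqs := (negPf a1, negPf a2, negPf a3, negPf b1, negPf b2, negPf b3,
  negPf c1, negPf c2, negPf c3, negPf h12, negPf h13, negPf h23).
have syms := (eq_sym u1 a, eq_sym u1 b, eq_sym u1 c, eq_sym u2 a, eq_sym u2 b,
  eq_sym u2 c, eq_sym u3 a, eq_sym u3 b, eq_sym u3 c, eq_sym u2 u1, eq_sym u3 u1,
    eq_sym u3 u2).
have nadj p q : [|| (p \in A) && (q \in A), (p \in B) && (q \in B),
    (p \in C) && (q \in C), ok p q | ok q p] = false -> ~~ e p q.
  by move=> h; apply/negP => /adjP; rewrite h.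
apply/and3P; split.
- by rewrite /= !inE !negb_or !syms !neqs /= ab ac bc.
- by rewrite (es u1) (es u2) (es u3) e1 e2 e3 e4 e5 e6.
have facts := (A1, A2, A3, B1, B2, B3, C1, C2, C3).
by do ?[apply/andP; split]; apply: nadj; rewrite /ok ?inA ?inB ?inC ?facts ?syms ?neqs
  ?eqxx /=.
Qed.

(** Within a class degrees are at most two by K_{3,3}, and the class spans a forest, so it spans a
    union of paths, which can be arranged in one sequence. The absence of outside vertices, cross
    edges and hub edges leaves no other edges. *)
Lemma blowup_family u1 u2 u3 : van_kampen e -> uniq [:: u1; u2; u3] ->
  hexagon_blowup e u1 u2 u3 -> extremal_family G.
Proof.
move=> vk un [out0 cross0 nhub [A0 B0 C0 /balanced3P bal]].
have es := adj_sym G; have ei := @adj_irr _ G.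
have [h12 h23 h31] := hubs_neq un; have [un2 un3] := hub_uniq_rot un.
set A := between e u1 u2 u3 in A0 bal *; set B := between e u2 u3 u1 in B0 bal *.
set C := between e u3 u1 u2 in C0 bal *.
have partition v : (v \in A :|: B :|: C) = (v \notin [set u1; u2; u3]).
  have : v \notin outside e u1 u2 u3 by rewrite out0 in_set0.
  rewrite in_setC negbK in_setU -[_ \in A :|: _ :|: _]/(v \in blown_up e u1 u2 u3).
  have [vY _|vY] := boolP (v \in blown_up e u1 u2 u3).
    by rewrite (blown_not_hub ei vY).
  by rewrite orbF => ->.
have order x y z : uniq [:: x; y; z] -> between e y z x != set0 ->
    between e z x y != set0 -> exists s : seq V, perm_eq s (enum (between e x y z)) /\
    {in between e x y z &, forall p q, e p q -> infix [:: p; q] s \/ infix [:: q; p] s}.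
  move=> unx n1 n2; apply: linear_forest => // [v vA|W' sW].
    have [xy _ _] := hubs_neq unx.
    by apply: card_nbrs_between => //; move: vA; rewrite in_between => /and4P[_ h1 h2 _];
       [have := adj_neq ei h1|have := adj_neq ei h2].
  exact: between_forest sW.
have [sa [pa la]] := order _ _ _ un B0 C0.
have [sb [pb lb]] := order _ _ _ un2 C0 A0.
have [sc [pc lc]] := order _ _ _ un3 A0 B0.
have disj x y z x' y' z' v : v \in between e x y z -> v \in between e x' y' z' ->
    z = x' \/ z = y' -> False.
  by rewrite !in_between => /and4P[_ _ _ /negPf h1] /and4P[_ h2 h3 _] [] zE;
     rewrite -zE ?h1 in h2 h3.
exists u1, u2, u3, A, B, C; split.
- split=> //.
  + by rewrite disjoint_subset; apply/subsetP => v vA; rewrite inE /=;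
    apply/negP => vB; apply: (disj _ _ _ _ _ _ _ vA vB); right.
  + by rewrite disjoint_subset; apply/subsetP => v vA; rewrite inE /=;
    apply/negP => vB; apply: (disj _ _ _ _ _ _ _ vA vB); right.
  + by rewrite disjoint_subset; apply/subsetP => v vA; rewrite inE /=;
    apply/negP => vB; apply: (disj _ _ _ _ _ _ _ vA vB); left.
  by apply/setP => v; rewrite partition in_setC.
- exact: bal.
- have hub x y z (v : V) : v \in between e x y z -> e v x /\ e v y.
    by rewrite in_between => /and4P[].
  rewrite !subUset -!andbA; do ?[apply/andP; split]; apply/subsetP => f /imsetP[v vS ->];
    by have [] := hub _ _ _ v vS.
exists sa, sb, sc; split=> // f fG nhf; have [p [q [fE epq]]] := edge_adj fG.
have path s p' q' : infix [:: p'; q'] s \/ infix [:: q'; p'] s -> path_edge s [set p';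
  q'].
  by case=> h; [exists p', q'|exists q', p'; rewrite setUC].
have inner v : v \in [set u1; u2; u3] \/ v \in A :|: B :|: C.
  by rewrite partition; case: (v \in [set u1; u2; u3]); [left|right].
have hubY u v : u \in [set u1; u2; u3] -> v \in A :|: B :|: C -> e v u ->
    f = [set v; u] -> False.
  move=> uU vY evu E; move: nhf; rewrite E.
  have [w3 w1 w2] : [/\ v \in A -> u != u3, v \in B -> u != u1 & v \in C -> u != u2].
    by split; rewrite in_between => /and4P[_ _ _]; apply: contraNneq => <-.
  rewrite !in_setU; move: vY uU; rewrite !in_setU -!orbA !in_set1.
  move=> /or3P[] vS /or3P[] /eqP uE; subst u.
  - by rewrite (imset_f (fun x => [set x; u1]) vS).
  - by rewrite (imset_f (fun x => [set x; u2]) vS) ?orbT.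
  - by have := w3 vS; rewrite eqxx.
  - by have := w1 vS; rewrite eqxx.
  - by rewrite (imset_f (fun x => [set x; u2]) vS) ?orbT.
  - by rewrite (imset_f (fun x => [set x; u3]) vS) ?orbT.
  - by rewrite (imset_f (fun x => [set x; u1]) vS) ?orbT.
  - by have := w2 vS; rewrite eqxx.
  by rewrite (imset_f (fun x => [set x; u3]) vS) ?orbT.
case: (inner p) => [pU|pY]; case: (inner q) => [qU|qY].
- by case/negP: nhub; apply/exists_inP; exists p => //; apply/exists_inP; exists q.
- by exfalso; apply: (hubY p q pU qY); rewrite 1?es // fE setUC.
- by exfalso; apply: (hubY q p qU pY).
have same u : u \in [set u1; u2; u3] -> e p u = e q u.
  move=> uU; apply/eqP; have := in_set0 (p, q); rewrite -cross0 in_set /=.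
  rewrite -[p \in blown_up _ _ _ _]/(p \in A :|: B :|: C) pY.
  rewrite -[q \in blown_up _ _ _ _]/(q \in A :|: B :|: C) qY epq /=.
  by move/negbT; rewrite negb_exists_in => /forall_inP/(_ u uU); rewrite negbK.
have [U1 U2 U3] : [/\ u1 \in [set u1; u2; u3], u2 \in [set u1; u2;
  u3] & u3 \in [set u1; u2; u3]].
  by rewrite !inE !eqxx !orbT.
have mates x y z : [:: x; y; z] \in [:: [:: u1; u2; u3]; [:: u2; u3; u1]; [:: u3; u1;
  u2]] ->
    x \in [set u1; u2; u3] -> y \in [set u1; u2; u3] ->
    p \in between e x y z -> q \in between e x y z.
  move=> xyz xU yU; rewrite in_between => /and4P[_ px py _].
  by apply: (between_blown ei xyz qY); rewrite -same.
move: (pY); rewrite !in_setU -orbA => /or3P[] pS; [constructor 1|constructor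
  2|constructor 3];
  rewrite fE; apply: path; [apply: la|apply: lb|apply: lc] => //; apply: mates pS;
  by rewrite // !inE eqxx ?orbT.
Qed.
End Family.

From mathcomp Require Import all_classical all_reals all_analysis.
Import Order.TTheory GRing.Theory Num.Theory.
Import numFieldNormedType.Exports.

Local Open Scope ring_scope.

(** * From drawings to the van Kampen obstruction *)

Section ArcTopology.
Variable R : realType.

(** Precomposition with this retraction turns an arc continuous within the unit interval into a
    function continuous on the whole line. *)
Definition clamp01 (t : R) : R := Num.max 0 (Num.min 1 t).

Lemma clamp01_itv t : clamp01 t \in `[0, 1].
Proof.
rewrite in_itv /= /clamp01 le_max lexx /=.
by rewrite ge_max ler01 ge_min lexx.
Qed.

Lemma clamp01_id t : t \in `[0, 1] -> clamp01 t = t.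
Proof. by rewrite in_itv /= /clamp01 => /andP[t0 t1]; rewrite min_r // max_r. Qed.

Lemma clamp01_continuous : continuous clamp01.
Proof.
move=> t; apply: (@continuous_max R R^o (fun=> 0) (fun t => Num.min 1 t)).
  exact: cvg_cst.
apply: (@continuous_min R R^o (fun=> 1) id); first exact: cvg_cst.
exact: cvg_id.
Qed.

Lemma clamp01_comp_continuous (T : topologicalType) (c : R -> T) :
  {within `[0, 1], continuous c}%classic -> continuous (c \o clamp01).
Proof.
move=> /subspace_continuousP cc t.
have h := cc _ (clamp01_itv t).
apply: cvg_comp h => A nA.
have nt : nbhs t (fun s => clamp01 s \in `[0, 1] -> A (clamp01 s)).
  exact: clamp01_continuous nA.
by apply: filterS nt => s; apply; exact: clamp01_itv.
Qed.

Lemma arcs_apart (c d : R -> R * R) :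
  {within `[0, 1], continuous c}%classic -> {within `[0, 1], continuous d}%classic ->
  (forall s t, s \in `[0, 1] -> t \in `[0, 1] -> c s <> d t) ->
  exists2 eps : R, 0 < eps &
    forall s t, s \in `[0, 1] -> t \in `[0, 1] -> eps <= `|c s - d t|.
Proof.
move=> /clamp01_comp_continuous cc /clamp01_comp_continuous cd ne.
pose f (p : R * R) : R := `|c (clamp01 p.1) - d (clamp01 p.2)|.
have cf : continuous f.
  move=> p; apply: cvg_norm; apply: cvgB.
    by apply: (@continuous_comp _ _ _ fst (c \o clamp01)); [exact: cvg_fst|exact: cc].
  by apply: (@continuous_comp _ _ _ snd (d \o clamp01)); [exact: cvg_snd|exact: cd].
have K : compact (`[0, 1] `*` `[0, 1] : set (R * R))%classic.
  by apply: compact_setX; exact: segment_compact.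
have [|[s t] st min] := compact_EVT_min _ K (continuous_subspaceT cf).
  by exists (0, 0); split; rewrite /= in_itv /= lexx ler01.
exists (f (s, t)) => [|s' t' s1 t1].
  by rewrite normr_gt0 subr_eq0; apply/eqP; apply: ne; apply: clamp01_itv.
have := min (s', t'); rewrite /f /= (clamp01_id s1) (clamp01_id t1); apply.
by rewrite inE.
Qed.

(** The parameter pairs whose images are at least [eps] apart form a compact set missing the
    diagonal; the minimum of |s - t| on it serves as [delta]. *)
Lemma arc_uniformly_continuous (c : R -> R * R) (eps : R) :
  {within `[0, 1], continuous c}%classic -> 0 < eps ->
  exists2 delta : R, 0 < delta &
    forall s t, s \in `[0, 1] -> t \in `[0, 1] -> `|s - t| < delta ->
      `|c s - c t| < eps.
Proof.
move=> /clamp01_comp_continuous cc eps0.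
pose f (p : R * R) : R := `|c (clamp01 p.1) - c (clamp01 p.2)|.
have cf : continuous f.
  move=> p; apply: cvg_norm; apply: cvgB.
    by apply: (@continuous_comp _ _ _ fst (c \o clamp01)); [exact: cvg_fst|exact: cc].
  by apply: (@continuous_comp _ _ _ snd (c \o clamp01)); [exact: cvg_snd|exact: cc].
pose K : set (R * R) := ((`[0, 1] `*` `[0, 1]) `&` (f @^-1` [set x | eps <= x]))%classic.
have cK : compact K.
  apply: compact_closedI; first by apply: compact_setX; exact: segment_compact.
  by apply: preimage_closed => [x _|]; [exact: cf|exact: closed_ge].
have cg : continuous (fun p : R * R => `|p.1 - p.2|).
  by move=> p; apply: cvg_norm; apply: cvgB; [exact: cvg_fst|exact: cvg_snd].
have [K0|/set0P K0] := eqVneq K set0%classic.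
  exists 1 => // s t s1 t1 _; rewrite ltNge; apply/negP => le.
  suff : K (s, t) by rewrite K0.
  by split; rewrite // /f /= !clamp01_id.
have [[s t] st min] := compact_EVT_min K0 cK (continuous_subspaceT cg).
exists `|s - t| => [|s' t' s1 t1].
  rewrite normr_gt0 subr_eq0; apply/eqP => sE.
  by move: st; rewrite inE => -[_]; rewrite /f /= sE subrr normr0 leNgt eps0.
rewrite !ltNge; apply: contraNN => le.
apply: (min (s', t')); rewrite inE; split; first by [].
by rewrite /f /= !clamp01_id.
Qed.
End ArcTopology.

Section Crossings.
Variable R : realType.
Implicit Types (v w : R * R) (eps : R).

(** The half-plane contains the positive half of its boundary line, so that exactly one of v and - v
    belongs to it whenever v is nonzero. *)
Definition upper v : bool := (0 < v.2) || (v.2 == 0) && (0 < v.1).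

(* The segment vw crosses the positive horizontal axis; meaningful only when
   v and w are much closer to each other than to the origin. *)
Definition ray_cross v w : bool := (upper v (+) upper w) && (0 < v.1).

Lemma upperN v : v != 0 -> upper (- v) = ~~ upper v.
Proof.
case: v => a b; rewrite /upper /= oppr_gt0 oppr_eq0 oppr_gt0 => ab0.
case: (ltgtP b 0) => //= b0; case: (ltgtP a 0) => //= a0.
by move: ab0; rewrite a0 b0 eqxx.
Qed.

Lemma normP_lt eps v : (`|v| < eps) = (`|v.1| < eps) && (`|v.2| < eps).
Proof. by rewrite prod_normE gt_max. Qed.

(** The norm is the maximum of the coordinates. Changing sides within distance [eps] forces a small
    second coordinate, so the first one carries the norm, and its sign is shared by all points
    nearby. *)
Lemma upper_neq_far eps v w : eps <= `|v| -> `|v - w| < eps ->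
  upper v != upper w -> eps <= `|v.1|.
Proof.
rewrite normP_lt /= => v0 /andP[_ h2] uvw.
have : `|v.2| < eps.
  move: h2 uvw; rewrite /upper.
  move: v.2 w.2 (0 < v.1) (0 < w.1) => a b c d; rewrite ltr_norml => /andP[h1 h2].
  rewrite ltr_norml; case: (ltgtP 0 a) => a0; case: (ltgtP 0 b) => b0 //= _;
    apply/andP; split; lra.
by move: v0; rewrite prod_normE le_max => /orP[//|]; rewrite leNgt => /negPf->.
Qed.

Lemma near_same_side eps v w : eps <= `|v.1| -> `|v - w| < eps ->
  (0 < w.1) = (0 < v.1).
Proof.
rewrite normP_lt /= ler_normr ltr_norml => h /andP[/andP[h1 h2] _].
by apply/idP/idP => ?; case/orP: h => h; lra.
Qed.

(** If some corner changes side, all corners have first coordinates of the same sign, and the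
    crossings reduce to side changes around a closed cycle. *)
Lemma ray_cross_square eps (a b c d : R * R) :
  {in [:: a; b; c; d], forall v, eps <= `|v|} ->
  {in [:: a; b; c; d] &, forall v w, `|v - w| < eps} ->
  (ray_cross a b (+) ray_cross b c) (+) (ray_cross c d (+) ray_cross d a) = false.
Proof.
move=> far close.
have [/and4P[/eqP ub /eqP uc /eqP ud _]|/allPn[v vs uv]] :=
  boolP (all (fun v => upper v == upper a) [:: b; c; d]).
  by rewrite /ray_cross ub uc ud addbb.
have {}vs : v \in [:: a; b; c; d] by rewrite inE vs orbT.
have farv : eps <= `|v.1|.
  by apply: upper_neq_far uv; [exact: far|exact: (close _ _ vs (mem_head _ _))].
have side w : w \in [:: a; b; c; d] -> (0 < w.1) = (0 < v.1).
  by move=> ws; apply: near_same_side farv _; exact: (close _ _ vs ws).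
rewrite /ray_cross (side a) ?(side b) ?(side c) ?(side d) ?inE ?eqxx ?orbT //.
by case: (upper a); case: (upper b); case: (upper c); case: (upper d); case: (0 < _).
Qed.

Lemma ray_crossC eps v w : eps <= `|v| -> `|v - w| < eps ->
  ray_cross v w = ray_cross w v.
Proof.
move=> far close; rewrite /ray_cross; have [->|uv] := eqVneq (upper v) (upper w).
  by rewrite addbb.
by rewrite (near_same_side (upper_neq_far far close uv) close) addbC.
Qed.

(** A change of side takes place across the positive or the negative half of the axis, and negation
    exchanges the two halves. *)
Lemma ray_cross_opp eps v w : 0 < eps -> eps <= `|v| -> `|v - w| < eps ->
  ray_cross v w (+) ray_cross (- v) (- w) = upper v (+) upper w.
Proof.
move=> eps0 far close.
have v0 : v != 0 by apply: contraTneq far => ->; rewrite normr0 -ltNge.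
have w0 : w != 0.
  by apply: contraTneq far => w0; move: close; rewrite w0 subr0 ltNge.
rewrite /ray_cross !upperN //; have [->|uv] := eqVneq (upper v) (upper w).
  by rewrite !addbb.
have := upper_neq_far far close uv.
rewrite /= oppr_gt0; case: (ltgtP v.1 0) => [||->]; last by rewrite normr0 leNgt eps0.
  by rewrite andbF andbT; case: (upper v); case: (upper w).
by rewrite andbF andbT addbF.
Qed.

Definition crossings (N : nat) (u : nat -> R * R) : bool :=
  \big[addb/false]_(i < N) ray_cross (u i) (u i.+1).

Lemma crossings0 u : crossings 0 u = false.
Proof. exact: big_ord0. Qed.

Lemma crossingsS N u :
  crossings N.+1 u = crossings N u (+) ray_cross (u N) (u N.+1).
Proof. exact: big_ord_recr. Qed.

Lemma crossings_opp eps N (u : nat -> R * R) : 0 < eps ->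
  (forall i, (i <= N)%N -> eps <= `|u i|) ->
  (forall i, (i < N)%N -> `|u i - u i.+1| < eps) ->
  crossings N u (+) crossings N (fun i => - u i) = upper (u 0%N) (+) upper (u N).
Proof.
move=> eps0; elim: N => [|N IH] far close; first by rewrite !crossings0 !addbb.
rewrite !crossingsS.
have := IH (fun i iN => far i (leqW iN)) (fun i iN => close i (leqW iN)).
have := ray_cross_opp eps0 (far N (leqnSn N)) (close N (ltnSn N)).
do 2!case: (crossings _ _); do 2!case: (ray_cross _ _);
  by case: (upper (u 0%N)); case: (upper (u N)); case: (upper _).
Qed.

(** The sum of [ray_cross_square] over the cells between the two polygons; the inner rungs
    cancel. *)
Lemma crossings_strip eps N (u w : nat -> R * R) :
  (forall i, (i <= N)%N -> eps <= `|u i|) ->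
  (forall i, (i <= N)%N -> eps <= `|w i|) ->
  (forall i, (i <= N)%N -> `|u i - w i| < eps) ->
  (forall i, (i < N)%N -> [/\ `|u i - u i.+1| < eps, `|w i - w i.+1| < eps,
     `|u i - w i.+1| < eps & `|w i - u i.+1| < eps]) ->
  crossings N u (+) crossings N w = ray_cross (u 0%N) (w 0%N) (+) ray_cross (u N) (w N).
Proof.
elim: N => [|N IH] fu fw cuw c; first by rewrite !crossings0 !addbb.
rewrite !crossingsS.
have eps0 : 0 < eps by apply: le_lt_trans (cuw 0%N _).
have := IH (fun i iN => fu i (leqW iN)) (fun i iN => fw i (leqW iN))
   (fun i iN => cuw i (leqW iN)) (fun i iN => c i (leqW iN)).
have [c1 c2 c3 c4] := c N (ltnSn N).
have cN := cuw N (leqnSn N); have cN1 := cuw N.+1 (leqnn _).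
have fN := fu N (leqnSn N); have fN1 := fu N.+1 (leqnn _).
have gN := fw N (leqnSn N); have gN1 := fw N.+1 (leqnn _).
have sq : (ray_cross (u N) (u N.+1) (+) ray_cross (u N.+1) (w N.+1)) (+)
          (ray_cross (w N.+1) (w N) (+) ray_cross (w N) (u N)) = false.
  apply: (@ray_cross_square eps).
    by move=> v; rewrite !inE => /or4P[] /eqP->.
  by move=> v v'; rewrite !inE => /or4P[] /eqP-> /or4P[] /eqP->;
    rewrite ?subrr ?normr0 // distrC.
move: sq; rewrite (ray_crossC (w := w N) gN1) 1?distrC //.
rewrite (ray_crossC (w := u N) gN) 1?distrC //.
do 2!case: (crossings _ _); case: (ray_cross (u 0%N) _); case: (ray_cross (u N) (u _));
 case: (ray_cross (w N) _); case: (ray_cross (u N) _); by case: (ray_cross _ _).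
Qed.

(* The differences P i - Q j, for 0 <= i, j <= N, form a grid with small cells:
   the crossings along its boundary cancel. *)
Lemma crossings_grid eps N (P Q : nat -> R * R) :
  (forall i j, (i <= N)%N -> (j <= N)%N -> eps <= `|P i - Q j|) ->
  (forall i, (i < N)%N -> `|P i - P i.+1| < eps / 2) ->
  (forall i, (i < N)%N -> `|Q i - Q i.+1| < eps / 2) ->
  crossings N (fun i => P i - Q 0%N) (+) crossings N (fun i => P i - Q N) =
  crossings N (fun j => P 0%N - Q j) (+) crossings N (fun j => P N - Q j).
Proof.
move=> far cP cQ.
suff h M : (M <= N)%N ->
  crossings N (fun i => P i - Q 0%N) (+) crossings N (fun i => P i - Q M) =
  crossings M (fun j => P 0%N - Q j) (+) crossings M (fun j => P N - Q j) by exact: h.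
elim: M => [|M IH] MN; first by rewrite addbb !crossings0.
have eps0 : 0 < eps / 2 by apply: le_lt_trans (cQ M MN).
have eps2 : eps / 2 < eps by lra.
rewrite !crossingsS.
have := IH (ltnW MN).
(* Corners of a cell differ by at most one step of P and one step of Q; steps below [eps / 2] keep
   even the diagonals below [eps]. *)
have near2 (a b c d : R * R) : `|a - b| < eps / 2 -> `|c - d| < eps / 2 ->
    `|a - c - (b - d)| < eps.
  move=> ab cd; rewrite opprD addrACA -opprD.
  by apply: le_lt_trans (ler_normB _ _) _; lra.
have near0 (a : R * R) : `|a - a| < eps / 2 by rewrite subrr normr0.
have -> : crossings N (fun i => P i - Q M.+1) = crossings N (fun i => P i - Q M)
    (+) (ray_cross (P 0%N - Q M) (P 0%N - Q M.+1) (+) ray_cross (P N - Q M) (P N - Q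
      M.+1)).
  rewrite -(@crossings_strip eps N (fun i => P i - Q M) (fun i => P i - Q M.+1)) ?addKb
    //.
  - by move=> i iN; apply: far => //; apply: ltnW.
  - by move=> i iN; apply: far.
  - by move=> i iN; apply: near2 => //; apply: cQ.
  move=> i iN; have h1 := cP i iN; have h2 := cQ M MN.
  by split; apply: near2 => //; rewrite distrC.
do 2!case: (crossings N _); do 2!case: (crossings M _);
  do 2!case: (ray_cross _ _) => //.
Qed.
End Crossings.

Lemma exists_common_eps (R : realType) (T : finType) (P : T -> R -> Prop) :
  (forall x, exists2 eps, 0 < eps & P x eps) ->
  (forall x eps eps', 0 < eps' <= eps -> P x eps -> P x eps') ->
  exists2 eps, 0 < eps & forall x, P x eps.
Proof.
move=> ex mono.
suff [eps eps0 h] : exists2 eps, 0 < eps & {in enum T, forall x, P x eps}.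
  by exists eps => // x; apply: h; rewrite mem_enum.
elim: (enum T) => [|x s [eps eps0 h]]; first by exists 1.
have [eps' eps'0 h'] := ex x; exists (Num.min eps eps'); first by rewrite lt_min eps0.
move=> y; rewrite inE => /orP[/eqP->|ys].
  by apply: mono h'; rewrite lt_min eps0 eps'0 ge_min lexx orbT.
by apply: mono (h y ys); rewrite lt_min eps0 eps'0 ge_min lexx.
Qed.

Lemma planar_van_kampen (R : realType) (V : finType) (G : sgraph V) :
  planar R G -> van_kampen (adj G).
Proof.
move=> [p [g [pinj arc novtx nocross]]].
have g01 e : e \in edges G -> exists x y, [/\ e = [set x; y], g e 0 = p x & g e 1 = p y].
  by move=> /arc[].
have endpt e t : e \in edges G -> t \in `[0, 1] ->
    (exists2 v, v \in e & g e t = p v) \/ t \in `]0, 1[.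
  move=> eG; have [x [y [-> g0 g1]]] := g01 e eG.
  rewrite !in_itv /= !le_eqVlt => /andP[/orP[/eqP<-|t0] /orP[/eqP->|t1]].
  - by left; exists y; rewrite ?inE ?eqxx ?orbT.
  - by left; exists x; rewrite ?inE ?eqxx ?orbT.
  - by left; exists y; rewrite ?inE ?eqxx ?orbT.
  by right; rewrite t0.
have [eps eps0 far] : exists2 eps : R, 0 < eps & forall ef : {set V} * {set V},
    ef.1 \in edges G -> ef.2 \in edges G -> [disjoint ef.1 & ef.2] ->
    forall s t, s \in `[0, 1] -> t \in `[0, 1] -> eps <= `|g ef.1 s - g ef.2 t|.
  apply: exists_common_eps => [[e f] /=|x a b /andP[_ ba] h eG fG ef s t s1 t1];
    last first.
    exact: le_trans ba (h eG fG ef s t s1 t1).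
  have [/and3P[eG fG ef]|nef] := boolP [&& e \in edges G, f \in edges G & [disjoint e &
    f]];
    last by exists 1 => // eG fG ef; rewrite eG fG ef in nef.
  have [||s t s1 t1|eps eps0 h] := @arcs_apart R (g e) (g f).
  - by have [] := arc e eG.
  - by have [] := arc f fG.
  - have [[v ve ->]|so] := endpt e s eG s1; have [[w wf ->]|to] := endpt f t fG t1.
    + by move=> /pinj vw; move: (disjointFr ef ve); rewrite vw wf.
    + by apply/nesym; apply: novtx.
    + exact: novtx.
    apply: nocross => //; apply: contraTneq ef => ->.
    rewrite -setI_eq0 finset.setIid -card_gt0.
    by have /forall_inP/(_ f fG)/eqP-> := edgesP G.
  by exists eps.
have [delta delta0 unif] : exists2 delta : R, 0 < delta & forall e, e \in edges G ->
    forall s t, s \in `[0, 1] -> t \in `[0, 1] -> `|s - t| < delta ->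
      `|g e s - g e t| < eps / 2.
  apply: exists_common_eps => [e|e a b /andP[_ ba] h eG s t s1 t1 st]; last first.
    exact: h (lt_le_trans st ba).
  have [eG|/negP ne] := boolP (e \in edges G); last by exists 1.
  have [ce _ _] := arc e eG; have [|d d0 h] := arc_uniformly_continuous ce (_ : 0 < eps
    / 2).
    by rewrite divr_gt0.
  by exists d.
have [N N0 Nd] : exists2 N : nat, (0 < N)%N & (N%:R : R)^-1 < delta.
  exists (Num.truncn delta^-1).+1 => //.
  by rewrite invf_plt ?posrE ?ltr0n // truncnS_gt.
pose t_ (i : nat) : R := i%:R / N%:R.
have tI i : (i <= N)%N -> t_ i \in `[0, 1].
  move=> iN; rewrite in_itv /= /t_ divr_ge0 // ler_pdivrMr ?ltr0n // mul1r ler_nat.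
  by rewrite iN.
have t0 : t_ 0%N = 0 by rewrite /t_ mul0r.
have tN : t_ N = 1 by rewrite /t_ divff // pnatr_eq0 -lt0n.
pose P (e : {set V}) i := g e (t_ i).
have Pclose e i : e \in edges G -> (i < N)%N -> `|P e i - P e i.+1| < eps / 2.
  move=> eG iN; apply: unif => //; [exact: tI (ltnW iN)|exact: tI|].
  rewrite /t_ -mulrBl -addn1 natrD opprD addrA subrr sub0r mulN1r normrN.
  by rewrite ger0_norm // invr_ge0.
(* The set e does not tell in which direction its arc is parametrized, so both directions are
   treated; the relation is symmetric under the reversal. *)
have Pends e x y : e \in edges G -> e = [set x; y] ->
    (P e 0%N = p x /\ P e N = p y) \/ (P e 0%N = p y /\ P e N = p x).
  move=> eG eE; rewrite /P t0 tN; have [x' [y' [eE' -> ->]]] := g01 e eG.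
  have xy' : x' != y'.
    by have /forall_inP/(_ e eG) := edgesP G; rewrite eE' cards2; case: (x' != y').
  have : x' \in e by rewrite eE' !inE eqxx.
  have : y' \in e by rewrite eE' !inE eqxx orbT.
  rewrite eE !inE => /orP[] /eqP yE /orP[] /eqP xE; subst x' y';
    by [rewrite eqxx in xy'|left|right].
pose U a b := upper (p a - p b).
pose K w x y := crossings N (fun i => P [set x; y] i - p w).
have eq_crossings M u w : u =1 w -> crossings M u = crossings M w.
  by move=> uw; apply: eq_bigr => i _; rewrite !uw.
exists U, K; split.
- by move=> x y xy; rewrite /U -[p y - p x]opprB upperN // subr_eq0 inj_eq.
- by move=> w x y; rewrite /K finset.setUC.
move=> x y z w exy ezw un.
set e := [set x; y] in exy; set f := [set z; w] in ezw.
have ef : [disjoint e & f].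
  rewrite disjoint_subset; apply/fintype.subsetP => v; rewrite !inE.
  move: un; rewrite /= !inE !negb_or => /and4P[/and3P[_ xz xw] /andP[yz yw] _ _].
  by case/orP=> /eqP->; rewrite ?xz ?xw ?yz ?yw.
have farP i j : (i <= N)%N -> (j <= N)%N -> eps <= `|P e i - P f j|.
  by move=> iN jN; apply: (far (e, f)) => //; apply: tI.
have := crossings_grid farP (fun i iN => Pclose e i exy iN) (fun i iN => Pclose f i ezw
  iN).
(* On these two sides of the grid the arc of f appears negated, as a fixed point minus the arc;
   [crossings_opp] converts this into [K] and two values of [U]. *)
have flip v i0 : (i0 <= N)%N -> P e i0 = p v ->
    crossings N (fun j => P e i0 - P f j) =
    K v z w (+) (upper (P f 0%N - p v) (+) upper (P f N - p v)).
  move=> i0N Pv; rewrite -(@crossings_opp R eps N (fun j => P f j - p v)) // ?addKb.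
  - by apply: eq_crossings => j; rewrite opprB Pv.
  - by move=> j jN; rewrite -Pv distrC; apply: farP.
  move=> j jN; rewrite opprD addrACA subrr addr0.
  by apply: lt_trans (Pclose f j ezw jN) _; lra.
have xorE (a b : bool) : xorb a b = a (+) b by case: a; case: b.
rewrite /van_kampen_sum !xorE /U.
have [[e0 eN]|[e0 eN]] := Pends e x y exy erefl;
  have [[f0 fN]|[f0 fN]] := Pends f z w ezw erefl;
  rewrite (flip _ _ (leq0n N) e0) (flip _ _ (leqnn N) eN) f0 fN /K -/e -/f;
  do 4!case: (crossings _ _); do 4!case: (upper _) => //.
Qed.

(** * A drawing of an extremal graph *)

Section Drawing.
Variables (R : realType) (n : nat).
Hypothesis n6 : (6 <= n)%N.

(** The residue of j modulo 3 selects the hub that j misses: 2, 0 and 1 for the residues 0, 1 and 2.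
    There are no edges inside the classes. *)
Definition blowup_rel : rel 'I_n :=
  fun i j => [&& (i < 3)%N, (3 <= j)%N & i != (j + 2) %% 3 :> nat]%N.

Definition blowup_graph : sgraph 'I_n := sgraph_of_rel blowup_rel.

Lemma blowup_edge (f : {set 'I_n}) : f \in edges blowup_graph ->
  exists h j, f = [set h; j] /\ blowup_rel h j.
Proof.
move=> /imsetP[[a b]]; rewrite inE /= => /andP[_ rab] ->.
by exists a, b.
Qed.

(** The hubs have abscissas 0, 2 and 4, with midpoints 1, 3 and 2. As the height is the index
    itself, the tents over the same two hubs are nested. *)
Definition tip_x (j : nat) : R :=
  if (j %% 3 == 0)%N then 1 else if (j %% 3 == 1)%N then 3 else 2.
Definition tip_y (j : nat) : R := if (j %% 3 == 2)%N then - j%:R else j%:R.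

(* The three hubs lie on the horizontal axis; the vertices between the first two
   hubs, and between the last two, lie above the midpoint, those between the
   first and the last below the midpoint. *)
Definition position (i : 'I_n) : R * R :=
  if (i < 3)%N then (2 * i%:R, 0) else (tip_x i, tip_y i).

Definition spoke (h j : nat) (t : R) : R * R :=
  (2 * h%:R + t * (tip_x j - 2 * h%:R), t * tip_y j).

Lemma spoke_cases h j : blowup_rel h j ->
  [\/ (h = 0 :> nat /\ j %% 3 = 0)%N, (h = 1 :> nat /\ j %% 3 = 0)%N |
  [\/ (h = 1 :> nat /\ j %% 3 = 1)%N, (h = 2 :> nat /\ j %% 3 = 1)%N |
  [\/ (h = 0 :> nat /\ j %% 3 = 2)%N | (h = 2 :> nat /\ j %% 3 = 2)%N]]].
Proof.
move=> /and3P[h3 j3]; rewrite -modnDml.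
have : (j %% 3 < 3)%N by rewrite ltn_mod.
case: (j %% 3)%N => [|[|[|//]]] _; case: (nat_of_ord h) h3 => [|[|[|//]]] _ //= _;
  first [by constructor 1 | by constructor 2 | constructor 3;
    first [by constructor 1 | by constructor 2 | constructor 3; by [left | right]]].
Qed.

Lemma position_inj : injective position.
Proof.
move=> i j; rewrite /position.
have pos (k : 'I_n) : (3 <= k)%N -> (0 < k%:R :> R) by move=> k3; rewrite ltr0n; lia.
case: (ltnP i 3) => i3; case: (ltnP j 3) => j3.
- move=> [ij]; apply/val_inj/eqP; rewrite -(eqr_nat R) /=; apply/eqP; lra.
- by move=> [_]; have := pos _ j3; rewrite /tip_y; move: (j%:R : R) => y;
  case: ifP => _ *; exfalso; lra.
- by move=> [_]; have := pos _ i3; rewrite /tip_y; move: (i%:R : R) => y;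
  case: ifP => _ *; exfalso; lra.
move=> [_ yE]; apply/val_inj/eqP; rewrite -(eqr_nat R) /=; apply/eqP; move: yE.
have := pos _ i3; have := pos _ j3; rewrite /tip_y.
move: (i%:R : R) (j%:R : R) => x y.
by case: ifP => _; case: ifP => _ *; lra.
Qed.

Lemma spoke_position h j t v : blowup_rel h j -> 0 < t < 1 -> spoke h j t <> position v.
Proof.
move=> r /andP[t0 t1]; have /and3P[h3 j3 _] := r.
have Y0 : (0 < j%:R :> R) by rewrite ltr0n; lia.
have tY : 0 < t * j%:R by rewrite mulr_gt0.
rewrite /position /spoke; case: (ltnP v 3) => v3 [].
  move=> _; rewrite /tip_y; move: (j%:R : R) tY => z tY.
  by case: ifP => _; rewrite ?mulrN => ?; lra.
have V0 : (0 < v%:R :> R) by rewrite ltr0n; lia.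
rewrite /tip_y; move: (v%:R : R) (j%:R : R) V0 Y0 tY => y z V0 Y0 tY.
have : (v %% 3 < 3)%N by rewrite ltn_mod.
rewrite /tip_x.
by case: (spoke_cases r) => [[-> ->]|[-> ->]|[[-> ->]|[-> ->]|[[-> ->]|[-> ->]]]];
  case: (v %% 3)%N => [|[|[|//]]] _ /= xE yE; rewrite ?mulrN in yE; lra.
Qed.

(** The six kinds of spokes occupy disjoint regions: four unit strips above the axis and two strips
    of width two below it. Within one kind the abscissa determines the parameter, and then the
    ordinate determines the tip. *)
Lemma spoke_cross h j h' j' s t : blowup_rel h j -> blowup_rel h' j' ->
  0 < s < 1 -> 0 < t < 1 -> spoke h j s = spoke h' j' t -> h = h' /\ j = j'.
Proof.
move=> r r' /andP[s0 s1] /andP[t0 t1]; have /and3P[_ j3 _] := r;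
  have /and3P[_ j3' _] := r'.
have Y0 : (0 < j%:R :> R) by rewrite ltr0n; lia.
have Y0' : (0 < j'%:R :> R) by rewrite ltr0n; lia.
have sY : 0 < s * j%:R by rewrite mulr_gt0.
have tY : 0 < t * j'%:R by rewrite mulr_gt0.
rewrite /spoke => -[].
have same : nat_of_ord h = h' -> s = t -> s * j%:R = t * j'%:R -> h = h' /\ j = j'.
  move=> hh st; rewrite st => /(mulfI (lt0r_neq0 t0))/eqP; rewrite eqr_nat => /eqP jj.
  by split; apply: val_inj.
rewrite /tip_x /tip_y.
by case: (spoke_cases r) => [[hE ->]|[hE ->]|[[hE ->]|[hE ->]|[[hE ->]|[hE ->]]]];
  case: (spoke_cases r') => [[hE' ->]|[hE' ->]|[[hE' ->]|[hE' ->]|[[hE' ->]|[hE' ->]]]];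
  rewrite hE hE' /=; move: (j%:R : R) (j'%:R : R) sY tY same => y z sY tY same xE yE;
    rewrite ?mulrN in yE; first [exfalso; lra | apply: same; [lia|lra|lra]].
Qed.

Lemma blowup_planar : planar R blowup_graph.
Proof.
have i0 : 'I_n by exists 0%N; lia.
(* An edge has exactly one end below 3, so hub and tip are recovered from the set; the default [i0]
   is harmless because [gE] covers all edges. *)
pose hub (f : {set 'I_n}) := odflt i0 [pick i in f | (i < 3)%N].
pose tip (f : {set 'I_n}) := odflt i0 [pick i in f | (3 <= i)%N].
pose g f t := spoke (hub f) (tip f) t.
have gE h j : blowup_rel h j -> hub [set h; j] = h /\ tip [set h; j] = j.
  move=> /and3P[h3 j3 _]; rewrite /hub /tip; split.
    case: pickP => [x /andP[]|/(_ h)]; last by rewrite !inE eqxx h3.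
    by rewrite !inE => /orP[] /eqP-> // ; rewrite ltnNge j3.
  case: pickP => [x /andP[]|/(_ j)]; last by rewrite !inE eqxx orbT j3.
  by rewrite !inE => /orP[] /eqP-> //; rewrite leqNgt h3.
have tip0 j : (3 <= j)%N -> tip_y j != 0.
  by move=> j3; rewrite /tip_y; case: ifP => _; rewrite ?oppr_eq0 pnatr_eq0; lia.
exists position, g; split.
- exact: position_inj.
- move=> f /blowup_edge[h [j [fE r]]]; have [hE tE] := gE h j r.
  have /and3P[h3 j3 _] := r; rewrite /g fE hE tE; split.
  + apply: continuous_subspaceT => t.
    have lin (a b : R) : ((fun x : R => a + x * b) @ t --> a + t * b)%classic.
      by apply: cvgD; [exact: cvg_cst|apply: cvgM; [exact: cvg_id|exact: cvg_cst]].
    have lin0 (b : R) : ((fun x : R => x * b) @ t --> t * b)%classic.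
      by apply: cvgM; [exact: cvg_id|exact: cvg_cst].
    exact: (cvg_pair (lin _ _) (lin0 _)).
  + by move=> s t _ _ [_ /(mulIf (tip0 _ j3))].
  exists h, j; split=> //; first by rewrite /spoke /position h3 !mul0r addr0.
  by rewrite /spoke /position ltnNge j3 /= !mul1r addrC subrK.
- move=> f /blowup_edge[h [j [fE r]]] t v; have [hE tE] := gE h j r.
  by rewrite in_itv /= /g fE hE tE; apply: spoke_position.
move=> f f' /blowup_edge[h [j [-> r]]] /blowup_edge[h' [j' [-> r']]] ne s t.
rewrite !in_itv /= /g; have [-> ->] := gE h j r; have [-> ->] := gE h' j' r'.
move=> s01 t01 E; have [hh jj] := spoke_cross r r' s01 t01 E.
by rewrite hh jj eqxx in ne.
Qed.

End Drawing.

(** * The drawn graph as an extremal graph, and the final formula *)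

Lemma blowup_extremal n : (6 <= n)%N -> extremal_family (blowup_graph n).
Proof.
move=> n6; have [lt0 lt1 lt2] : [/\ (0 < n)%N, (1 < n)%N & (2 < n)%N] by split; lia.
pose u1 := Ordinal lt0; pose u2 := Ordinal lt1; pose u3 := Ordinal lt2.
pose P (c : nat) : {set 'I_n} := [set i : 'I_n | (3 <= i)%N && (i %% 3 == c)%N].
have inP c i : (i \in P c) = (3 <= i)%N && (i %% 3 == c)%N by rewrite finset.in_set.
have disj c d : c != d -> [disjoint P c & P d].
  move=> cd; rewrite disjoint_subset; apply/fintype.subsetP => i;
    rewrite inP => /andP[_ /eqP ic].
  by rewrite inE /= inP ic (negPf cd) andbF.
have predlt (i : 'I_n) : (i.-1 < n)%N by apply: leq_ltn_trans (leq_pred i) (ltn_ord i).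
(* The predecessor sends class 2 into class 1, class 1 into class 0, and class 0 without the vertex
   3 into class 2, so the class sizes differ by at most one. *)
pose pr i := Ordinal (predlt i).
have shift (S T : {set 'I_n}) : (forall i, i \in S -> (3 <= i)%N /\ pr i \in T) ->
    (#|S| <= #|T|)%N.
  move=> h; rewrite -(@card_in_imset _ _ pr S).
    by apply: subset_leq_card; apply/fintype.subsetP => j /imsetP[i /h[_ hi] ->].
  move=> i j /h[i3 _] /h[j3 _] /(congr1 val) /= ij; apply/val_inj => /=; lia.
have hubneq (v : 'I_n) c : v \in P c -> [/\ v != u1, v != u2 & v != u3].
  rewrite inP => /andP[v3 _]; split; apply/eqP => /(congr1 val) /= E; lia.
exists u1, u2, u3, (P 0%N), (P 1%N), (P 2%N).
set hub_edges := (_ :|: _).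
split.
- split; rewrite ?disj //.
  apply/setP => i; rewrite !finset.in_setU finset.in_setC !inP !inE -!val_eqE /=.
  have : (i %% 3 < 3)%N by rewrite ltn_mod.
  case: (nat_of_ord i) => [|[|[|k]]] //=.
  by case: (_ %% 3)%N => [|[|[|]]].
- apply/balanced3P; have BA : (#|P 1%N| <= #|P 0%N|)%N.
    apply: shift => i; rewrite inP => /andP[i3 /eqP ic]; split=> //.
    by rewrite inP /=; apply/andP; split; lia.
  have CB : (#|P 2%N| <= #|P 1%N|)%N.
    apply: shift => i; rewrite inP => /andP[i3 /eqP ic]; split=> //.
    by rewrite inP /=; apply/andP; split; lia.
  have lt3 : (3 < n)%N by lia.
  have AC : (#|P 0%N| <= #|P 2%N|.+1)%N.
    rewrite (cardsD1 (Ordinal lt3) (P 0%N)) inP /= add1n ltnS.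
    apply: shift => i; rewrite finset.in_setD1 inP -val_eqE /= => /and3P[ne i3 /eqP ic].
    by split=> //; rewrite inP /=; apply/andP; split; lia.
  move: BA CB AC; rewrite /almost_equal3; move: #|P 0%N| #|P 1%N| #|P 2%N| => a b c.
  by clear => BA CB AC; do 5?[apply/andP; split]; lia.
- have star (u : 'I_n) (c : nat) : (u < 3)%N -> (forall x : 'I_n, x \in P c -> u != ((x
  + 2) %% 3)%N :> nat) ->
      [set [set x; u] | x in P c] \subset edges (blowup_graph n).
    move=> u3' hu; apply/fintype.subsetP => f /imsetP[x xP ->].
    rewrite -[_ \in _]/(adj (blowup_graph n) x u) adj_of_rel.
    have := xP; rewrite inP => /andP[x3 _].
    rewrite /blowup_rel u3' x3 hu // orbT andbT.
    by apply/eqP => /(congr1 val) /= E; lia.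
  rewrite !finset.subUset -!andbA.
  by do ?[apply/andP; split]; apply: star => // x; rewrite inP => /andP[_ /eqP xc] /=;
    apply/eqP; lia.
exists (enum (P 0%N)), (enum (P 1%N)), (enum (P 2%N));
  split=> // f /blowup_edge[h [j [-> r]]].
move=> nhub; exfalso; move/negP: nhub; apply.
have /and3P[_ j3 _] := r.
have jP c : (j %% 3 = c)%N -> j \in P c by move=> jc; rewrite inP j3 jc eqxx.
have mem u c (uh : h = u) (jc : (j %% 3 = c)%N) : [set h; j] \in [set [set x;
  u] | x in P c].
  by apply/imsetP; exists j; [exact: jP|rewrite finset.setUC uh].
have hE u : (h = nat_of_ord u :> nat) -> h = u by move=> E; apply: val_inj.
rewrite !finset.in_setU.
by case: (spoke_cases r) => [[/(hE u1) E c]|[/(hE u2) E c]|[[/(hE u2) E c]|[/(hE u3) E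
  c]|[[/(hE u1) E c]|[/(hE u3) E c]]]];
  rewrite (mem _ _ E c) ?orbT.
Qed.

Lemma even_split3_value (F : realFieldType) (m : nat) : (3 <= m)%N ->
  let N : F := m%:R in let f := even_split3 (m - 3) in
  [/\ (m %% 3 = 0)%N ->
        f%:R = (N / 3 - 1) ^+ 3 /\
        (N / 3 - 1) ^+ 3 = 1 / 27 * (N ^+ 3 - 9 * N ^+ 2 + 27 * N - 27),
      (m %% 3 = 1)%N ->
        f%:R = ((N - 4) / 3) ^+ 2 * ((N - 1) / 3) /\
        ((N - 4) / 3) ^+ 2 * ((N - 1) / 3)
          = 1 / 27 * (N ^+ 3 - 9 * N ^+ 2 + 24 * N - 16) &
      (m %% 3 = 2)%N ->
        f%:R = ((N - 2) / 3) ^+ 2 * ((N - 5) / 3) /\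
        ((N - 2) / 3) ^+ 2 * ((N - 5) / 3)
          = 1 / 27 * (N ^+ 3 - 9 * N ^+ 2 + 24 * N - 20)].
Proof.
move=> m3 N f; rewrite /f /N /even_split3.
have [q qE] : exists q, m = (q * 3 + m %% 3 + 3)%N by exists (m %/ 3).-1; lia.
split=> rE; (split; last by field).
- have mE : m = (q * 3 + 3)%N by lia.
  have e0 : ((m - 3) %/ 3 = q)%N by rewrite mE; clear; lia.
  have e1 : ((m - 3 + 1) %/ 3 = q)%N by rewrite mE; clear; lia.
  have e2 : ((m - 3 + 2) %/ 3 = q)%N by rewrite mE; clear; lia.
  by rewrite e0 e1 e2 mE !natrM !natrD !natrM; field.
- have mE : m = (q * 3 + 4)%N by lia.
  have e0 : ((m - 3) %/ 3 = q)%N by rewrite mE; clear; lia.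
  have e1 : ((m - 3 + 1) %/ 3 = q)%N by rewrite mE; clear; lia.
  have e2 : ((m - 3 + 2) %/ 3 = q + 1)%N by rewrite mE; clear; lia.
  by rewrite e0 e1 e2 mE !natrM !natrD !natrM; field.
have mE : m = (q * 3 + 5)%N by lia.
have e0 : ((m - 3) %/ 3 = q)%N by rewrite mE; clear; lia.
have e1 : ((m - 3 + 1) %/ 3 = q + 1)%N by rewrite mE; clear; lia.
have e2 : ((m - 3 + 2) %/ 3 = q + 1)%N by rewrite mE; clear; lia.
by rewrite e0 e1 e2 mE !natrM !natrD !natrM; field.
Qed.

Theorem theorem1p3 (R : realType) :
  exists n0 : nat, forall n : nat, (n0 <= n)%N ->
    let N : rat := n%:R in
    let f : nat := max_induced R n (cycle_graph 6) in
    [/\ (forall (V : finType) (G : sgraph V), #|V| = n -> planar R G ->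
           (num_induced G (cycle_graph 6) = f <-> extremal_family G)),
        (n %% 3 = 0)%N ->
          f%:R = (N / 3 - 1) ^+ 3 /\
          (N / 3 - 1) ^+ 3 = 1 / 27 * (N ^+ 3 - 9 * N ^+ 2 + 27 * N - 27),
        (n %% 3 = 1)%N ->
          f%:R = ((N - 4) / 3) ^+ 2 * ((N - 1) / 3) /\
          ((N - 4) / 3) ^+ 2 * ((N - 1) / 3)
            = 1 / 27 * (N ^+ 3 - 9 * N ^+ 2 + 24 * N - 16) &
        (n %% 3 = 2)%N ->
          f%:R = ((N - 2) / 3) ^+ 2 * ((N - 5) / 3) /\
          ((N - 2) / 3) ^+ 2 * ((N - 5) / 3)
            = 1 / 27 * (N ^+ 3 - 9 * N ^+ 2 + 24 * N - 20)].
Proof.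
have [n1 upper] := planar_hexes_upper.
exists (n1 + 6)%N => n nlarge N f.
have [n1n n6] : (n1 <= n)%N /\ (6 <= n)%N by lia.
have bound (V : finType) (G : sgraph V) : #|V| = n -> planar R G ->
    (num_induced G (cycle_graph 6) <= even_split3 (n - 3))%N /\
    (num_induced G (cycle_graph 6) = even_split3 (n - 3) -> extremal_family G).
  move=> Vn /planar_van_kampen vk; rewrite num_induced_hexes -Vn.
  have [|le ex] := upper V (adj G) (adj_sym G) (@adj_irr _ G) vk; first by rewrite Vn.
  by split=> // /ex[u1 [u2 [u3 [un blow]]]]; apply: blowup_family blow.
have lower (V : finType) (G : sgraph V) : #|V| = n -> extremal_family G ->
    (even_split3 (n - 3) <= num_induced G (cycle_graph 6))%N.
  by move=> <- ?; rewrite num_induced_hexes; apply: family_hexes.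
have fE : f = even_split3 (n - 3).
  apply/eqP; rewrite eqn_leq; apply/andP; split.
    by apply/bigmax_leqP => G /asboolP pG; have [] := bound _ G (card_ord n) pG.
  apply: leq_trans (lower _ _ (card_ord n) (blowup_extremal n6)) _.
  apply: (leq_bigmax_cond (F := fun G => num_induced G (cycle_graph 6))).
  by apply/asboolP; apply: blowup_planar.
have [v0 v1 v2] := even_split3_value rat (leq_trans (isT : 3 <= 6)%N n6).
split=> [V G Vn pG|r|r|r]; rewrite ?fE; [|exact: v0|exact: v1|exact: v2].
have [le ex] := bound V G Vn pG; split=> [|fam]; first exact: ex.
by apply/eqP; rewrite eqn_leq le lower.
Qed.
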